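(* Let $\alpha\colon\mathbb{Z}_+^n\to\mathrm{End}(A)$ be a unital C*-dynamical system, let $\sigma\colon\mathbb{R}\to\mathrm{Aut}(\mathcal{NT}(A,\alpha))$ be the action related to $\lambda=(\lambda_1,\dots,\lambda_n)\in\mathbb{R}^n$, i.e. $\sigma_t=\gamma_{(\exp(i\lambda_1t),\dots,\exp(i\lambda_nt))}$, and let $\beta\in\mathbb{R}$ be such that $\lambda_k\beta>0$ for all $k=1,\dots,n$. Then there is an affine homeomorphism (for the weak*-topologies) from the simplex of the tracial states on $A$ onto the simplex of the $(\sigma,\beta)$-KMS states on $\mathcal{NT}(A,\alpha)$.
   Context: A C*-dynamical system over $\mathbb{Z}_+^n$ is a semigroup action $\alpha\colon\mathbb{Z}_+^n\to\mathrm{End}(A)$ by $*$-endomorphisms of a C*-algebra $A$; it is unital if $A$ is unital and every $\alpha_x$ is unital. Let $\mathbf{e}_1,\dots,\mathbf{e}_n$ be the standard generators of $\mathbb{Z}_+^n$; write $V_i=V_{\mathbf{e}_i}$, $\alpha_i=\alpha_{\mathbf{e}_i}$. An isometric Nica covariant pair $(\pi,V)$ on a Hilbert space $H$ consists of a $*$-representation $\pi\colon A\to\mathcal{B}(H)$ and a semigroup homomorphism $V$ of $\mathbb{Z}_+^n$ into the isometries on $H$ with $V_iV_j^*=V_j^*V_i$ for $i\neq j$, such that $\pi(a)V_i=V_i\pi(\alpha_i(a))$ for all $a\in A$ and all $i$. The Toeplitz-Nica-Pimsner algebra $\mathcal{NT}(A,\alpha)$ is the universal C*-algebra generated by the elements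 $V_x\pi(a)$ ($x\in\mathbb{Z}_+^n$, $a\in A$) over all such pairs. $A$ embeds isometrically (write $a$ for $\pi(a)$), $1\in A$ is the unit of $\mathcal{NT}(A,\alpha)$, and the elements $V_xaV_y^*$ span a dense $*$-subalgebra. The gauge action $\gamma$ of $\mathbb{T}^n$ is $\gamma_z(V_xaV_y^* )=z_1^{x_1-y_1}\cdots z_n^{x_n-y_n}V_xaV_y^*$. For an action $\sigma$ of $\mathbb{R}$ on a C*-algebra $\mathcal{A}$, with $\mathcal{A}_{\mathrm{an}}$ the dense $*$-subalgebra of analytic elements (those $a$ for which $t\mapsto\sigma_t(a)$ extends to an entire function $z\mapsto\sigma_z(a)$), a state $\psi$ is a $(\sigma,\beta)$-KMS state if $\psi(ab)=\psi(b\sigma_{i\beta}(a))$ for all $a,b$ in a norm-dense $\sigma$-invariant $*$-subalgebra of $\mathcal{A}_{\mathrm{an}}$. *)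

(* Defs.v *)
From HB Require Import structures.
From mathcomp Require Import all_boot all_order all_algebra.
From mathcomp Require Import sesquilinear.
From mathcomp Require Import complex.
From mathcomp Require Import all_classical all_reals all_analysis.

Set Implicit Arguments.
Unset Strict Implicit.
Unset Printing Implicit Defensive.

Import Order.TTheory GRing.Theory Num.Theory.
Import numFieldNormedType.Exports.

Local Open Scope classical_set_scope.
Local Open Scope ring_scope.

(* The scalar field [K] is specialized to [R[i]], the complex numbers over
   [R : realType]; norms then take nonnegative real values inside [R[i]].     *)

(* Unital C*-algebras, the zero algebra included.  The product is a field of
   the mixin, because no structure extending both the library's rings and its
   normed modules can be declared after numDomainType. *)
HB.mixin Record isCStarAlgebra (K : numClosedFieldType) (A : Type)
    & CompleteNormedModule K A := {
  cmul : A -> A -> A ;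
  cone : A ;
  star : A -> A ;
  cmulA : associative cmul ;
  cmul1l : left_id cone cmul ;
  cmul1r : right_id cone cmul ;
  cmulDl : left_distributive cmul +%R ;
  cmulDr : right_distributive cmul +%R ;
  cmulZl : forall (k : K) (a b : A), cmul (k *: a) b = k *: cmul a b ;
  cmulZr : forall (k : K) (a b : A), cmul a (k *: b) = k *: cmul a b ;
  norm_cmul : forall a b : A, `|cmul a b| <= `|a| * `|b| ;
  starK : involutive star ;
  starD : {morph star : a b / a + b} ;
  starZ : forall (k : K) (a : A), star (k *: a) = Num.conj k *: star a ;
  starM : forall a b : A, star (cmul a b) = cmul (star b) (star a) ;
  norm_star_cmul : forall a : A, `|cmul (star a) a| = `|a| ^+ 2
}.

#[short(type="cstarAlgType")]
HB.structure Definition CStarAlgebra (K : numClosedFieldType) :=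
  {A of CompleteNormedModule K A & isCStarAlgebra K A}.

Notation "a ** b" := (cmul a b) (at level 40, left associativity) : ring_scope.

(* The inner product is linear in its first argument. *)
HB.mixin Record isHilbert (K : numClosedFieldType) (H : Type)
    & CompleteNormedModule K H := {
  inner : {dot H for (@Num.conj K)} ;
  normE : forall u : H, `|u| ^+ 2 = inner u u
}.

#[short(type="hilbertType")]
HB.structure Definition Hilbert (K : numClosedFieldType) :=
  {H of CompleteNormedModule K H & isHilbert K H}.

Section StarAlgebras.
Variable K : numClosedFieldType.

(* Not required to preserve the unit. *)
Definition star_hom (A B : cstarAlgType K) (f : A -> B) : Prop :=
  [/\ linear f, {morph f : a b / a ** b} & {morph f : a / star a}].

(* Not required to contain the unit. *)
Definition star_subalgebra (A : cstarAlgType K) (B : set A) : Prop :=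
  [/\ B 0,
      forall a b, B a -> B b -> B (a + b),
      forall (k : K) a, B a -> B (k *: a),
      forall a b, B a -> B b -> B (a ** b)
    & forall a, B a -> B (star a)].

Definition is_opnorm (E F : normedModType K) (f : E -> F) (c : K) : Prop :=
  [/\ 0 <= c,
      forall x, `|f x| <= c * `|x|
    & forall M : K, 0 <= M -> (forall x, `|f x| <= M * `|x|) -> c <= M].

Definition state (A : cstarAlgType K) (phi : A -> K) : Prop :=
  [/\ linear (phi : A -> K^o),
      forall a, 0 <= phi (star a ** a)
    & is_opnorm (phi : A -> K^o) 1].

Definition tracial_state (A : cstarAlgType K) (tau : A -> K) : Prop :=
  state tau /\ forall a b, tau (a ** b) = tau (b ** a).

Definition bounded_op (H : hilbertType K) (T : H -> H) : Prop :=
  linear T /\ exists M : K, forall u, `|T u| <= M * `|u|.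

Definition is_adjoint (H : hilbertType K) (T S : H -> H) : Prop :=
  forall u v, inner (T u) v = inner u (S v).

Definition star_rep (A : cstarAlgType K) (H : hilbertType K)
    (pi : A -> H -> H) : Prop :=
  [/\ forall a, bounded_op (pi a),
      forall u, linear (pi^~ u),
      forall a b, pi (a ** b) = pi a \o pi b
    & forall a, is_adjoint (pi a) (pi (star a))].

Definition isometry_op (H : hilbertType K) (T : H -> H) : Prop :=
  linear T /\ forall u, `|T u| = `|u|.

(* The topology of pointwise convergence on [A -> K] induces the weak-*
   topology on the bounded functionals. *)
Definition affine_homeomorphic (A B : Type) (S : set {ptws A -> K})
    (T : set {ptws B -> K}) : Prop :=
  exists (Phi : {ptws A -> K} -> {ptws B -> K})
         (Psi : {ptws B -> K} -> {ptws A -> K}),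
  [/\ forall f, S f -> T (Phi f) /\ Psi (Phi f) = f,
      forall g, T g -> S (Psi g) /\ Phi (Psi g) = g,
      forall (s : K) f1 f2, 0 <= s <= 1 -> S f1 -> S f2 ->
        Phi (fun a => s * f1 a + (1 - s) * f2 a) =
        (fun b => s * Phi f1 b + (1 - s) * Phi f2 b),
      {within S, continuous Phi}
    & {within T, continuous Psi}].

End StarAlgebras.

(* The semigroup Z_+^n, with pointwise addition. *)
Notation Zplus n := {ffun 'I_n -> nat}.

Definition Zgen n (i : 'I_n) : Zplus n := [ffun j => (j == i : nat)].

Section ToeplitzNicaPimsner.
Variables (K : numClosedFieldType) (n : nat).

Definition unital_dynamical_system (A : cstarAlgType K)
    (alpha : Zplus n -> A -> A) : Prop :=
  [/\ forall x, star_hom (alpha x),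
      forall x, alpha x cone = cone,
      alpha 0 = id
    & forall x y, alpha (x + y) = alpha x \o alpha y].

Definition nica_covariant_pair (A : cstarAlgType K)
    (alpha : Zplus n -> A -> A) (H : hilbertType K)
    (pi : A -> H -> H) (V : Zplus n -> H -> H) : Prop :=
  [/\ star_rep pi,
      forall x, isometry_op (V x),
      V 0 = id /\ (forall x y, V (x + y) = V x \o V y),
      forall i j : 'I_n, i != j ->
        exists2 Vj' : H -> H, is_adjoint (V (Zgen j)) Vj' &
          V (Zgen i) \o Vj' = Vj' \o V (Zgen i)
    & forall a i, pi a \o V (Zgen i) = V (Zgen i) \o pi (alpha (Zgen i) a)].

(* [N] is the universal C*-algebra generated by the elements [w x a], which
   stand for V_x pi(a): it is the C*-algebra generated by the V_x pi(a) for
   one pair, and it is represented, compatibly with the generators, in the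
   Hilbert space of every pair. *)
Record toeplitz_nica_pimsner (A : cstarAlgType K) (alpha : Zplus n -> A -> A)
    (N : cstarAlgType K) (w : Zplus n -> A -> N) : Prop := {
  tnp_generated : forall B : set N, star_subalgebra B -> closed B ->
    (forall x a, B (w x a)) -> B = setT ;
  tnp_realized : exists (H : hilbertType K) (pi : A -> H -> H)
      (V : Zplus n -> H -> H) (rho : N -> H -> H),
    [/\ nica_covariant_pair alpha pi V,
        star_rep rho,
        forall b, is_opnorm (rho b) `|b|
      & forall x a, rho (w x a) = V x \o pi a] ;
  tnp_universal : forall (H : hilbertType K) (pi : A -> H -> H)
      (V : Zplus n -> H -> H),
    nica_covariant_pair alpha pi V ->
    exists2 Phi : N -> H -> H, star_rep Phi &
      forall x a, Phi (w x a) = V x \o pi a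
}.

(* V_x a V_y^*, which equals (V_x a) (V_y 1)^* as A is unital. *)
Definition tnp_monomial (A N : cstarAlgType K) (w : Zplus n -> A -> N)
    (x : Zplus n) (a : A) (y : Zplus n) : N :=
  w x a ** star (w y cone).

Definition torus : set ('I_n -> K) := [set z | forall i, `|z i| = 1].

(* Only the values of [gamma] on the torus matter. *)
Definition gauge_action (A N : cstarAlgType K) (w : Zplus n -> A -> N)
    (gamma : ('I_n -> K) -> N -> N) : Prop :=
  [/\ forall z, torus z -> star_hom (gamma z) /\ bijective (gamma z),
      gamma (fun=> 1) = id,
      forall z z', torus z -> torus z' ->
        gamma (fun i => z i * z' i) = gamma z \o gamma z'
    & forall z x a y, torus z ->
        gamma z (tnp_monomial w x a y) =
        (\prod_(i < n) z i ^ ((x i)%:Z - (y i)%:Z)) *: tnp_monomial w x a y].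

End ToeplitzNicaPimsner.

Definition entire (K : numFieldType) (N : normedModType K) (f : K -> N) :=
  forall z : K, derivable (f : K^o -> N) z 1.

Section KMS.
Variable R : realType.
Local Open Scope complex_scope.

(* exp(i s) *)
Definition expi (s : R) : R[i] := cos s +i* sin s.

(* The action of the real line related to [lambda]. *)
Definition gauge_flow n (N : cstarAlgType R[i])
    (gamma : ('I_n -> R[i]) -> N -> N) (lambda : 'I_n -> R) (t : R) : N -> N :=
  gamma (fun k => expi (lambda k * t)).

(* [f] is the entire extension z |-> sigma_z(a) of t |-> sigma_t(a). *)
Definition analytic_extension (N : cstarAlgType R[i]) (sigma : R -> N -> N)
    (a : N) (f : R[i] -> N) : Prop :=
  entire f /\ forall t : R, f t%:C = sigma t a.

Definition analytic (N : cstarAlgType R[i]) (sigma : R -> N -> N) : set N :=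
  [set a | exists f, analytic_extension sigma a f].

(* [f (0 +i* beta)] is sigma_{i beta}(a); the extension [f] is unique. *)
Definition KMS_state (N : cstarAlgType R[i]) (sigma : R -> N -> N) (beta : R)
    (psi : N -> R[i]) : Prop :=
  state psi /\
  exists B : set N,
  [/\ star_subalgebra B /\ dense B,
      forall t a, B a -> B (sigma t a),
      B `<=` analytic sigma
    & forall a b f, B a -> B b -> analytic_extension sigma a f ->
        psi (a ** b) = psi (b ** f (0 +i* beta))].

End KMS.

(* Main.v *)
(* Write [q_i = exp(- beta lambda_i)], so that [0 < q_i < 1], and
   [E_i = 1 - V_i V_i^*], [P = prod_i E_i].  A state [psi] is KMS if and only if
   [psi(V_i b) = q_i psi(b V_i)] and [psi(a b) = psi(b a)] for [a] in [A].
   The KMS condition is given on a dense subalgebra which need not contain the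
   eigenvectors [V_i] and [a] of the flow; it is carried over to an eigenvector
   [v] of weight [mu] by approximating [v] by [u] in the subalgebra: the entire
   function [z |-> exp(- i mu z) psi(b sigma_z(u))] is bounded on the strip
   between the real line and its translate by [i beta], and nearly equal to a
   constant on each of the two lines, so that by Cauchy's theorem on long
   rectangles the two constants are close.

   A bounded functional [D] with these commutation rules is determined by
   [a |-> D(a P)]: the factors of [P] are removed one by one, because
   [D(a E_i Q) = D(a Q) - q_i D(alpha_i(a) Q)] for a product [Q] of the other
   factors, and a bounded [F] with [F = q_i F o alpha_i] vanishes.
   Hence [psi |-> psi(. P) / prod_i (1 - q_i)] embeds the KMS states in the
   tracial states.  It is onto: on the Fock space built from the GNS form of a
   tracial state [tau], [prod_i (1 - q_i) sum_z q^z <b e_z, e_z>] defines a KMS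
   state which is mapped to [tau].  On [V_x a V_x^*] this state is a limit,
   uniform in [tau], of linear combinations of the values [tau(alpha_z(a))],
   whence the weak-* continuity of the inverse. *)

Require Import Defs.
From HB Require Import structures.
From mathcomp Require Import all_boot all_order all_algebra.
From mathcomp Require Import sesquilinear complex.
From mathcomp Require Import all_classical all_reals all_analysis.
From mathcomp Require Import ring lra.

Set Implicit Arguments.
Unset Strict Implicit.
Unset Printing Implicit Defensive.

Import Order.TTheory GRing.Theory Num.Theory.
Import numFieldNormedType.Exports.
Import Normc.
Local Notation Re := complex.Re.
Local Notation Im := complex.Im.

Local Open Scope classical_set_scope.
Local Open Scope ring_scope.

(** * Cauchy's theorem and entire functions *)

Section RealIntegral.
Variable R : realType.
Implicit Types (f g : R -> R) (a b m k M : R).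

(** Two analytic facts carry the KMS condition: the strip estimate and the identity theorem. The
    latter makes psi(b f(i beta)) independent of the entire extension f, over which the condition
    quantifies. Both are applied to scalar functions obtained by composing with v |-> psi(b v), and
    both come from Cauchy's theorem on rectangles. As only lambda_k beta > 0 is assumed, beta may be
    negative, and the strip then lies below the real line. Uniqueness concerns differences of
    states, which are not positive, so it is proved for bounded linear functionals. Representations
    may be degenerate, so the relations in the Toeplitz algebra must allow for pi(1) being a mere
    projection. The GNS form may be degenerate too; completing inside the antidual removes its
    kernel without a quotient. That prod_i (1 - q_i) is the inverse of the total mass sum_z q^z
    follows by comparing two expressions for psi(P), not by summing the series. The inverse map is
    continuous by uniform approximation, without compactness. *)

Definition rint f a b : R := \int[lebesgue_measure]_(x in `[a, b]) f x.

Lemma rint_integrable f a b : continuous f ->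
  lebesgue_measure.-integrable `[a, b] (EFin \o f).
Proof.
move=> cf; apply: continuous_compact_integrable; first exact: segment_compact.
exact: continuous_subspaceT.
Qed.

Lemma rintD f g a b : continuous f -> continuous g ->
  rint (fun x => f x + g x) a b = rint f a b + rint g a b.
Proof. by move=> cf cg; rewrite /rint RintegralD//; exact: rint_integrable. Qed.

Lemma rint_cst k a b : a <= b -> rint (fun=> k) a b = k * (b - a).
Proof.
move=> ab; rewrite /rint Rintegral_cst//.
rewrite [X in fine X](_ : _ = lebesgue_measure `[a, b])//.
rewrite lebesgue_measure_itv/= lte_fin.
by move: ab; rewrite le_eqVlt => /predU1P[->|->//]; rewrite ltxx subrr.
Qed.

Lemma rint_split f a m b : continuous f -> a <= m -> m <= b ->
  rint f a b = rint f a m + rint f m b.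
Proof.
move=> cf am mb; rewrite -[LHS](subrK (rint f a m)) addrC; congr (_ + _).
rewrite /rint Rintegral_itvB ?bnd_simp//; last exact: rint_integrable.
rewrite Rintegral_itv_obnd_cbnd//.
apply: (@integrableS _ _ _ lebesgue_measure `[m, b]) => //.
  by apply: subset_itvr; rewrite bnd_simp.
exact: rint_integrable.
Qed.

Lemma le_rint f g a b : continuous f -> continuous g ->
  (forall x, a <= x <= b -> f x <= g x) -> rint f a b <= rint g a b.
Proof.
move=> cf cg fg; apply: le_Rintegral => //; try exact: rint_integrable.
Qed.

Lemma rint_bound f a b M : a <= b -> continuous f ->
  (forall x, a <= x <= b -> `|f x| <= M) -> `|rint f a b| <= M * (b - a).
Proof.
move=> ab cf fM; rewrite ler_norml -mulNr -!rint_cst//.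
by apply/andP; split; apply: le_rint => //; try exact: cst_continuous;
  move=> x xab; have := fM x xab; rewrite ler_norml => /andP[].
Qed.

Lemma eq_rint f g a b : (forall x, a <= x <= b -> f x = g x) ->
  rint f a b = rint g a b.
Proof.
by move=> fg; apply: eq_Rintegral => x; rewrite inE/= in_itv/= => /fg.
Qed.

End RealIntegral.

(** * Goursat's theorem for rectangles *)

Section Goursat.
Variable R : realType.
Local Open Scope complex_scope.
Implicit Types (h : R[i] -> R[i]) (z w k : R[i]) (a b c d m e M : R).

Lemma normcE2 z : normc z = Num.sqrt (Re z ^+ 2 + Im z ^+ 2).
Proof. by case: z. Qed.

Lemma normc_ge0 z : 0 <= normc z.
Proof. by rewrite normcE2 sqrtr_ge0. Qed.

Lemma normc_norm z : `|z| = (normc z)%:C.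
Proof. by rewrite normc_def normcE2. Qed.

Lemma Re_le_normc z : `|Re z| <= normc z.
Proof.
by rewrite normcE2 -sqrtr_sqr ler_sqrt ?addr_ge0 ?sqr_ge0// lerDl sqr_ge0.
Qed.

Lemma Im_le_normc z : `|Im z| <= normc z.
Proof.
by rewrite normcE2 -sqrtr_sqr ler_sqrt ?addr_ge0 ?sqr_ge0// lerDr sqr_ge0.
Qed.

Lemma normc_le_ReIm z : normc z <= `|Re z| + `|Im z|.
Proof.
rewrite normcE2 -(ger0_norm (addr_ge0 (normr_ge0 (Re z)) (normr_ge0 (Im z)))).
rewrite -sqrtr_sqr ler_sqrt ?sqr_ge0// sqrrD !real_normK ?num_real//.
by rewrite addrAC lerDl mulrn_wge0 ?mulr_ge0.
Qed.

(** Stated with the real modulus [normc] and real tolerances, so that real arithmetic applies;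
    [cdiffP] identifies [cdiff] with derivability over R[i]. *)
Definition ccont h := forall z e, 0 < e ->
  exists2 dl, 0 < dl & forall w, normc (w - z) < dl -> normc (h w - h z) < e.

Definition cdiff h z := exists k, forall e, 0 < e ->
  exists2 dl, 0 < dl & forall w, normc (w - z) < dl ->
    normc (h w - h z - k * (w - z)) <= e * normc (w - z).

Lemma ccont_line h (p : R -> R[i]) (L : R[i] -> R) : ccont h ->
  (forall x y, normc (p x - p y) <= `|x - y|) ->
  (forall z w, L (z - w) = L z - L w) -> (forall z, `|L z| <= normc z) ->
  continuous (fun x => L (h (p x))).
Proof.
move=> ch pl LB Ll x; apply/cvgrPdist_lt => e e0.
have [dl dl0 H] := ch (p x) e e0.
near=> y; rewrite -LB (le_lt_trans (Ll _))// -normcN opprB H//.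
by rewrite (le_lt_trans (pl _ _))//; near: y; exists dl.
Unshelve. all: by end_near. Qed.

Lemma normc_real (x : R) : normc x%:C = `|x|.
Proof. by rewrite normcE2/= expr0n/= addr0 sqrtr_sqr. Qed.

Lemma normc_imag (x : R) : normc (0 +i* x) = `|x|.
Proof. by rewrite normcE2/= expr0n/= add0r sqrtr_sqr. Qed.

Lemma normc_hline c x y : normc ((x +i* c) - (y +i* c)) <= `|x - y|.
Proof.
rewrite [X in normc X](_ : _ = (x - y)%:C) ?normc_real//.
by apply/eqP; rewrite eq_complex/= subrr !eqxx.
Qed.

Lemma normc_vline c x y : normc ((c +i* x) - (c +i* y)) <= `|x - y|.
Proof.
rewrite [X in normc X](_ : _ = 0 +i* (x - y)) ?normc_imag//.
by apply/eqP; rewrite eq_complex/= subrr !eqxx.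
Qed.

Lemma ReB z w : Re (z - w) = Re z - Re w. Proof. by case: z; case: w. Qed.
Lemma ImB z w : Im (z - w) = Im z - Im w. Proof. by case: z; case: w. Qed.
Lemma ReD z w : Re (z + w) = Re z + Re w. Proof. by case: z; case: w. Qed.
Lemma ImD z w : Im (z + w) = Im z + Im w. Proof. by case: z; case: w. Qed.

Lemma ccont_Imh h c : ccont h -> continuous (fun x => Im (h (x +i* c))).
Proof.
move=> ch; apply: (@ccont_line h (fun x => x +i* c) (@Im R)) => //.
- exact: normc_hline.
- exact: ImB.
- exact: Im_le_normc.
Qed.

Lemma ccont_Rev h c : ccont h -> continuous (fun x => Re (h (c +i* x))).
Proof.
move=> ch; apply: (@ccont_line h (fun x => c +i* x) (@Re R)) => //.
- exact: normc_vline.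
- exact: ReB.
- exact: Re_le_normc.
Qed.

(* The imaginary part of the integral of [h] along the boundary of
   [a, b] x [c, d]. *)
Definition bdint h a b c d : R :=
  rint (fun x => Im (h (x +i* c)) - Im (h (x +i* d))) a b +
  rint (fun y => Re (h (b +i* y)) - Re (h (a +i* y))) c d.

Lemma ccont_hdiff h c d : ccont h ->
  continuous (fun x => Im (h (x +i* c)) - Im (h (x +i* d))).
Proof. by move=> ch x; apply: cvgB; exact: ccont_Imh. Qed.

Lemma ccont_vdiff h c d : ccont h ->
  continuous (fun y => Re (h (c +i* y)) - Re (h (d +i* y))).
Proof. by move=> ch x; apply: cvgB; exact: ccont_Rev. Qed.

Lemma bdint_hsplit h a b c d m : ccont h -> a <= m -> m <= b ->
  bdint h a b c d = bdint h a m c d + bdint h m b c d.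
Proof.
move=> ch am mb; rewrite /bdint (rint_split (ccont_hdiff (c:=c) (d:=d) ch) am mb).
rewrite [in RHS]addrACA; congr (_ + _).
rewrite addrC -rintD; [|exact: ccont_vdiff..].
by apply: eq_rint => y _; rewrite addrA subrK.
Qed.

Lemma bdint_vsplit h a b c d m : ccont h -> c <= m -> m <= d ->
  bdint h a b c d = bdint h a b c m + bdint h a b m d.
Proof.
move=> ch am mb; rewrite /bdint (rint_split (ccont_vdiff (c:=b) (d:=a) ch) am mb).
rewrite [in RHS]addrACA; congr (_ + _).
rewrite -rintD; [|exact: ccont_hdiff..].
by apply: eq_rint => y _; rewrite addrA subrK.
Qed.

Lemma bdintD h1 h2 a b c d : ccont h1 -> ccont h2 ->
  bdint (fun z => h1 z + h2 z) a b c d = bdint h1 a b c d + bdint h2 a b c d.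
Proof.
move=> c1 c2; rewrite /bdint addrACA -!rintD;
  [|exact: ccont_vdiff|exact: ccont_vdiff|exact: ccont_hdiff|exact: ccont_hdiff].
by congr (_ + _); apply: eq_rint => x _; rewrite ?ReD ?ImD; ring.
Qed.

Lemma bdint_affine z k a b c d : a <= b -> c <= d ->
  bdint (fun w => z + k * w) a b c d = 0.
Proof.
move=> ab cd; rewrite /bdint; case: z k => [z1 z2] [k1 k2] /=.
rewrite (eq_rint (g := fun=> k1 * (c - d))); last by move=> x _; simpc; ring.
rewrite (eq_rint (b := d) (g := fun=> k1 * (b - a))); last by move=> x _; simpc; ring.
by rewrite !rint_cst//; ring.
Qed.

Lemma bdint_bound h a b c d M : ccont h -> a <= b -> c <= d ->
  (forall x y, a <= x <= b -> c <= y <= d -> normc (h (x +i* y)) <= M) ->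
  `|bdint h a b c d| <= 2 * M * ((b - a) + (d - c)).
Proof.
move=> ch ab cd hM; rewrite mulrDr (le_trans (ler_normD _ _))// lerD//.
  apply: rint_bound => // [|x xab]; first exact: ccont_hdiff.
  rewrite (le_trans (ler_normB _ _))// mulr_natl mulr2n lerD//;
    by rewrite (le_trans (Im_le_normc _))// hM// ?lexx ?ab ?cd.
apply: rint_bound => // [|x xab]; first exact: ccont_vdiff.
rewrite (le_trans (ler_normB _ _))// mulr_natl mulr2n lerD//;
  by rewrite (le_trans (Re_le_normc _))// hM// ?lexx ?ab ?cd.
Qed.

Lemma ccont_affine z k : ccont (fun w => z + k * w).
Proof.
move=> w e e0; exists (e / (normc k + 1)) => [|w' ww'].
  by rewrite divr_gt0// ltr_pwDr// normc_ge0.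
have -> : z + k * w' - (z + k * w) = k * (w' - w) by ring.
rewrite normcM (@le_lt_trans _ _ ((normc k + 1) * normc (w' - w)))//.
  by rewrite ler_wpM2r ?normc_ge0// lerDl.
by rewrite mulrC -ltr_pdivlMr// ltr_pwDr// normc_ge0.
Qed.

Lemma ccontD h1 h2 : ccont h1 -> ccont h2 -> ccont (fun z => h1 z + h2 z).
Proof.
move=> c1 c2 z e e0; have e20 : 0 < e / 2 by rewrite divr_gt0.
have [d1 d10 H1] := c1 z _ e20; have [d2 d20 H2] := c2 z _ e20.
exists (Num.min d1 d2) => [|w]; first by rewrite lt_min d10.
rewrite lt_min => /andP[/H1 w1 /H2 w2].
rewrite opprD addrACA (le_lt_trans (le_normcD _ _))// (splitr e).
exact: ltrD.
Qed.

(** Subtracting the tangent [h z + k * (w - z)] leaves the integral unchanged, and the remainder is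
    at most [e] times the half-perimeter, which bounds the distance to [z] inside the rectangle. *)
Lemma bdint_local h z e a b c d (dl : R) : ccont h -> 0 <= e -> a <= b -> c <= d ->
  forall k, (forall w, normc (w - z) < dl ->
     normc (h w - h z - k * (w - z)) <= e * normc (w - z)) ->
  a <= Re z <= b -> c <= Im z <= d -> (b - a) + (d - c) < dl ->
  `|bdint h a b c d| <= 2 * e * ((b - a) + (d - c)) ^+ 2.
Proof.
move=> ch e0 ab cd k kP zab zcd lt_dl.
pose r w := h w + (- (h z - k * z) + (- k) * w).
have cr : ccont r by apply: ccontD => //; exact: ccont_affine.
have -> : bdint h a b c d = bdint r a b c d.
  by rewrite /r bdintD ?bdint_affine ?addr0//; exact: ccont_affine.
rewrite expr2 mulrA -(mulrA 2); apply: bdint_bound => // x y xab ycd.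
have nz : normc ((x +i* y) - z) <= (b - a) + (d - c).
  rewrite (le_trans (normc_le_ReIm _))// ReB ImB/= lerD// ler_norml; lra.
rewrite /r (_ : _ + _ = h (x +i* y) - h z - k * ((x +i* y) - z)); last by ring.
by rewrite (le_trans (kP _ _))// ?ler_wpM2l// (le_lt_trans nz).
Qed.

(** The integrals over the four quarters add up to the whole, so they cannot all be smaller in
    modulus than a fourth of it. *)
Lemma bdint_quarter h a b c d : ccont h -> a <= b -> c <= d ->
  exists a' c', [/\ a <= a' <= a + (b - a) / 2, c <= c' <= c + (d - c) / 2 &
   `|bdint h a b c d| / 4 <=
   `|bdint h a' (a' + (b - a) / 2) c' (c' + (d - c) / 2)|].
Proof.
move=> ch ab cd; apply: contrapT => /forallNP H.
have {}H a' c' : a <= a' <= a + (b - a) / 2 -> c <= c' <= c + (d - c) / 2 ->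
   `|bdint h a' (a' + (b - a) / 2) c' (c' + (d - c) / 2)| < `|bdint h a b c d| / 4.
  by move=> a'P c'P; rewrite ltNge; apply/negP => ?; apply: (H a'); exists c'.
have H1 := H a c; have H2 := H a (c + (d - c) / 2).
have H3 := H (a + (b - a) / 2) c; have H4 := H (a + (b - a) / 2) (c + (d - c) / 2).
have eb : a + (b - a) / 2 + (b - a) / 2 = b by field.
have ed : c + (d - c) / 2 + (d - c) / 2 = d by field.
rewrite ?eb ?ed in H1 H2 H3 H4.
have am : a <= a + (b - a) / 2 <= b by lra.
have cm : c <= c + (d - c) / 2 <= d by lra.
have [am1 am2] := andP am; have [cm1 cm2] := andP cm.
have E := bdint_hsplit c d ch am1 am2.
have E1 := bdint_vsplit a (a + (b - a) / 2) ch cm1 cm2.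
have E2 := bdint_vsplit (a + (b - a) / 2) b ch cm1 cm2.
rewrite E1 E2 in E.
have := ler_normD (bdint h a (a + (b - a) / 2) c (c + (d - c) / 2) +
  bdint h a (a + (b - a) / 2) (c + (d - c) / 2) d)
  (bdint h (a + (b - a) / 2) b c (c + (d - c) / 2) +
       bdint h (a + (b - a) / 2) b (c + (d - c) / 2) d).
rewrite -E.
have := ler_normD (bdint h a (a + (b - a) / 2) c (c + (d - c) / 2))
  (bdint h a (a + (b - a) / 2) (c + (d - c) / 2) d).
have := ler_normD (bdint h (a + (b - a) / 2) b c (c + (d - c) / 2))
       (bdint h (a + (b - a) / 2) b (c + (d - c) / 2) d).
have {}H1 : `|bdint h a (a + (b - a) / 2) c (c + (d - c) / 2)| < `|bdint h a b c d| / 4.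
  by apply: H1; rewrite ?lexx ?am1 ?cm1.
have {}H2 : `|bdint h a (a + (b - a) / 2) (c + (d - c) / 2) d| < `|bdint h a b c d| / 4.
  by apply: H2; rewrite ?lexx ?am1 ?cm1.
have {}H3 : `|bdint h (a + (b - a) / 2) b c (c + (d - c) / 2)| < `|bdint h a b c d| / 4.
  by apply: H3; rewrite ?lexx ?am1 ?cm1.
have {}H4 : `|bdint h (a + (b - a) / 2) b (c + (d - c) / 2) d| < `|bdint h a b c d| / 4.
  by apply: H4; rewrite ?lexx ?am1 ?cm1.
lra.
Qed.

Lemma nested_halves (W : R) (u : nat -> R) : 0 <= W ->
  (forall n, u n <= u n.+1 <= u n + W / 2 ^+ n.+1) ->
  exists x, forall n, u n <= x <= u n + W / 2 ^+ n.
Proof.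
move=> W0 uP.
have p n : W / 2 ^+ n = W / 2 ^+ n.+1 + W / 2 ^+ n.+1.
  by rewrite exprS invfM; field; rewrite expf_neq0.
have nd n p' : (n <= p')%N -> u n <= u p'.
  by apply: (homo_leq le_refl le_trans) => k; case/andP: (uP k).
have ni n p' : (n <= p')%N -> u p' + W / 2 ^+ p' <= u n + W / 2 ^+ n.
  move=> /subnKC <-; elim: (p' - n)%N => [|k]; first by rewrite addn0.
  by rewrite addnS; have := p (n + k)%N; have := uP (n + k)%N; lra.
have Wn n : 0 <= W / 2 ^+ n by rewrite divr_ge0// exprn_ge0.
have ub n : ubound (range u) (u n + W / 2 ^+ n).
  move=> _ [m _ <-]; have [nm|/ltnW mn] := leqP n m.
    by rewrite (le_trans _ (ni _ _ nm))// lerDl.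
  by rewrite (le_trans (nd _ _ mn))// lerDl.
exists (sup (range u)) => n; apply/andP; split.
  by apply: ub_le_sup; [exists (u 0%N + W / 2 ^+ 0); exact: ub|exists n].
by apply: ge_sup => //; exists (u 0%N), 0%N.
Qed.

(** Repeated bisection: the rectangle of stage [n] carries an integral of modulus at least
    [q / 4 ^+ n], while differentiability at the common point bounds it by
    [2 * e * (W + D) ^+ 2 / 4 ^+ n]. *)
Lemma goursat h a b c d : ccont h -> a <= b -> c <= d ->
  (forall z, a <= Re z <= b -> c <= Im z <= d -> cdiff h z) ->
  bdint h a b c d = 0.
Proof.
move=> ch ab cd dh; apply: contrapT => /eqP; rewrite -normr_gt0.
set q := `|_| => q0; pose W := b - a; pose D := d - c.
have W0 : 0 <= W by rewrite subr_ge0.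
have D0 : 0 <= D by rewrite subr_ge0.
pose P n (p : R * R) := q / 4 ^+ n <=
  `|bdint h p.1 (p.1 + W / 2 ^+ n) p.2 (p.2 + D / 2 ^+ n)|.
have half n (X : R) : X / 2 ^+ n / 2 = X / 2 ^+ n.+1.
  by rewrite exprS invfM; field; rewrite expf_neq0.
(* The implication makes the choice total: where [P] fails, any pair will do. *)
have step (np : nat * (R * R)) : exists p', P np.1 np.2 -> [/\ P np.1.+1 p',
    np.2.1 <= p'.1 <= np.2.1 + W / 2 ^+ np.1.+1 &
    np.2.2 <= p'.2 <= np.2.2 + D / 2 ^+ np.1.+1].
  case: np => n [x y] /=; have [Pn|nPn] := pselect (P n (x, y)); last by exists 0.
  have Wn : x <= x + W / 2 ^+ n by rewrite lerDl divr_ge0// exprn_ge0.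
  have Dn : y <= y + D / 2 ^+ n by rewrite lerDl divr_ge0// exprn_ge0.
  have [x' [y' []]] := bdint_quarter ch Wn Dn.
  rewrite ![_ + _ / _ - _]addrAC !subrr !add0r !half => x'P y'P xyP.
  exists (x', y') => _; split => //; rewrite /P/= (le_trans _ xyP)//.
  by rewrite exprS invfM mulrCA mulrC ler_pM2r// invr_gt0.
have [f fP] := choice step.
pose s := fix s n := if n is n'.+1 then f (n', s n') else (a, c).
have sP n : P n (s n).
  elim: n => [|n /(fP (n, s n))[]//].
  by rewrite /P !expr0 !divr1 /W /D /= ![_ + (_ - _)]addrC !subrK.
have [x xP] : exists x, forall n, (s n).1 <= x <= (s n).1 + W / 2 ^+ n.
  by apply: nested_halves => // n; have [] := fP (n, s n) (sP n).
have [y yP] : exists x, forall n, (s n).2 <= x <= (s n).2 + D / 2 ^+ n.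
  by apply: nested_halves => // n; have [] := fP (n, s n) (sP n).
have [k kP] : cdiff h (x +i* y).
  apply: dh => /=.
    by have := xP 0%N; rewrite expr0 divr1/= /W addrC subrK.
  by have := yP 0%N; rewrite expr0 divr1/= /D addrC subrK.
(* Small enough for [2 * e * (W + D) ^+ 2 < q]; the [+ 1] covers a rectangle reduced to a point. *)
pose e := q / (4 * ((W + D) ^+ 2 + 1)).
have e0 : 0 < e by rewrite divr_gt0// mulr_gt0// ltr_wpDl// sqr_ge0.
have [dl dl0 dlP] := kP e e0.
have [n nP] : exists n, (W + D) / 2 ^+ n < dl.
  have : (fun n => (W + D) * (2^-1 ^+ n)) @ \oo --> (W + D) * 0.
    apply: cvgMr; apply: cvg_expr.
    by rewrite ger0_norm// invf_lt1// ltr1n.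
  rewrite mulr0 => /cvgrPdist_lt/(_ _ dl0)[N _ /(_ N (leqnn _))] /=.
  rewrite sub0r normrN exprVn ger0_norm; first by exists N.
  apply: divr_ge0; [exact: addr_ge0|exact: exprn_ge0].
have Wn : (s n).1 <= (s n).1 + W / 2 ^+ n by rewrite lerDl divr_ge0// exprn_ge0.
have Dn : (s n).2 <= (s n).2 + D / 2 ^+ n by rewrite lerDl divr_ge0// exprn_ge0.
have := bdint_local ch (ltW e0) Wn Dn dlP (xP n) (yP n).
rewrite ![_ + _ / _ - _]addrAC !subrr !add0r -mulrDl => /(_ nP).
move=> /(le_trans (sP n)).
have -> : ((W + D) / 2 ^+ n) ^+ 2 = (W + D) ^+ 2 / 4 ^+ n.
  by rewrite expr_div_n -exprM mulnC exprM; congr (_ / _ ^+ _); ring.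
rewrite mulrA ler_pM2r; last first.
  by rewrite invr_gt0 exprn_gt0.
have X0 : 0 < (W + D) ^+ 2 + 1 by rewrite ltr_wpDl// sqr_ge0.
have : 2 * e * (W + D) ^+ 2 < q; last by move: {+}q0; clear; lra.
have eX : 0 <= e * (W + D) ^+ 2 by rewrite mulr_ge0 ?sqr_ge0 ?ltW.
have eq : e * (4 * ((W + D) ^+ 2 + 1)) = q by rewrite divfK// gt_eqF// mulr_gt0.
clear -e0 eX eq; lra.
Qed.

End Goursat.

(** * Real-valued norms and geometric Cauchy sequences *)

Section RealNorm.
Variable R : realType.
Local Open Scope complex_scope.

Lemma complex_ge0 (x : R[i]) : 0 <= x -> x = (Re x)%:C /\ 0 <= Re x.
Proof. by case: x => a b; rewrite lecE/= => /andP[/eqP -> ?]. Qed.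

Lemma complex_gt0 (x : R[i]) : 0 < x -> exists2 e : R, 0 < e & x = e%:C.
Proof. by case: x => a b; rewrite ltcE/= => /andP[/eqP -> ?]; exists a. Qed.

Section Def.
Variable V : normedModType R[i].
Implicit Types u v : V.

Definition nr v : R := Re `|v|.

Lemma nrE v : `|v| = (nr v)%:C.
Proof. by have [] := complex_ge0 (normr_ge0 v). Qed.

Lemma nr_ge0 v : 0 <= nr v.
Proof. by have [] := complex_ge0 (normr_ge0 v). Qed.

Lemma nr_le v (r : R) : (`|v| <= r%:C) = (nr v <= r).
Proof. by rewrite nrE lecR. Qed.

Lemma nrD u v : nr (u + v) <= nr u + nr v.
Proof. by rewrite -nr_le rmorphD/= -!nrE ler_normD. Qed.

Lemma nrN v : nr (- v) = nr v.
Proof. by rewrite /nr normrN. Qed.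

Lemma nrB u v : nr (u - v) <= nr u + nr v.
Proof. by rewrite (le_trans (nrD _ _))// nrN. Qed.

Lemma nrC u v : nr (u - v) = nr (v - u).
Proof. by rewrite -nrN opprB. Qed.

Lemma nr_dist w u v : nr (u - v) <= nr (u - w) + nr (w - v).
Proof. by rewrite (le_trans _ (nrD _ _))// addrA subrK. Qed.

Lemma nrZ (k : R[i]) v : nr (k *: v) = normc k * nr v.
Proof. by apply: complexI; rewrite rmorphM/= -normc_norm -!nrE normrZ. Qed.

Lemma nr0 : nr (0 : V) = 0.
Proof. by rewrite /nr normr0. Qed.

Lemma nr_eq0 v : nr v = 0 -> v = 0.
Proof. by move=> v0; apply/eqP; rewrite -normr_eq0 nrE v0. Qed.

Lemma cvg_nrP (u : nat -> V) l : (u @ \oo --> l) <->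
  forall e : R, 0 < e -> exists N, forall n, (N <= n)%N -> nr (u n - l) < e.
Proof.
split=> [/cvgrPdist_lt H e e0|H].
  have [|N _ NP] := H e%:C; first by rewrite ltcR.
  by exists N => n /NP /=; rewrite nrE ltcR nrC.
apply/cvgrPdist_lt => _ /complex_gt0[e e0 ->]; have [N NP] := H e e0.
by exists N => // n /NP /=; rewrite nrE ltcR nrC.
Qed.

Lemma eq_of_nr u v : (forall e : R, 0 < e -> nr (u - v) <= e) -> u = v.
Proof.
move=> H; apply/subr0_eq/nr_eq0/eqP; rewrite eq_le nr_ge0 andbT.
by apply/ler_addgt0Pl => e e0; rewrite addr0 H.
Qed.

End Def.

Lemma nr_scalar (z : R[i]) : nr (z : R[i]^o) = normc z.
Proof. by rewrite /nr normc_norm. Qed.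

Lemma cauchy_nr (V : completeNormedModType R[i]) (u : nat -> V) :
  (forall e : R, 0 < e -> exists N, forall m n, (N <= m)%N -> (N <= n)%N ->
     nr (u m - u n) < e) ->
  exists l, forall e : R, 0 < e -> exists N, forall n, (N <= n)%N -> nr (u n - l) < e.
Proof.
move=> H; suff /cvg_ex[l /cvg_nrP ul] : cvg (u @ \oo) by exists l.
apply/cauchy_cvgP/cauchy_ballP => _ /complex_gt0[e e0 ->].
have [N NP] := H e e0; near_simpl.
near=> p => /=; rewrite -ball_normE/= nrE ltcR NP//; near: p.
  by exists ([set n | (N <= n)%N], setT) => [|[? ?] []//]; split; [exists N|exact: filterT].
by exists (setT, [set n | (N <= n)%N]) => [|[? ?] []//]; split; [exact: filterT|exists N].
Unshelve. all: by end_near. Qed.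

Lemma geometric_cauchy (V : completeNormedModType R[i]) (u : nat -> V) (C r : R) :
  0 <= C -> 0 <= r < 1 -> (forall n, nr (u n.+1 - u n) <= C * r ^+ n) ->
  exists l, forall e : R, 0 < e -> exists N, forall n, (N <= n)%N -> nr (u n - l) < e.
Proof.
move=> C0 /andP[r0 r1] H; apply: cauchy_nr => e e0.
have r1' : 0 < 1 - r by rewrite subr_gt0.
(* With the factor [1 - r ^+ m] the bound is the exact geometric sum, so that the induction closes
   with equality. *)
have K n m : nr (u (n + m)%N - u n) <= C / (1 - r) * r ^+ n * (1 - r ^+ m).
  elim: m => [|m IH]; first by rewrite addn0 !subrr nr0 mulr0.
  rewrite addnS (le_trans (nr_dist (u (n + m)%N) _ _))// (le_trans (lerD (H _) IH))//.
  rewrite exprD exprS le_eqVlt; apply/orP; left; apply/eqP; field.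
  by rewrite gt_eqF.
have K' n m : (n <= m)%N -> nr (u m - u n) <= C / (1 - r) * r ^+ n.
  move=> /subnKC <-; rewrite (le_trans (K _ _))// ler_piMr//.
    by rewrite !mulr_ge0 ?exprn_ge0// invr_ge0 ltW.
  by rewrite gerBl exprn_ge0.
have [N NP] : exists N, C / (1 - r) * r ^+ N < e / 2.
  have : (fun n => C / (1 - r) * (r ^+ n)) @ \oo --> C / (1 - r) * 0.
    by apply: cvgMr; apply: cvg_expr; rewrite ger0_norm.
  have e20 : 0 < e / 2 by rewrite divr_gt0.
  rewrite mulr0 => /cvgrPdist_lt/(_ _ e20)[N _ /(_ N (leqnn _))] /=.
  rewrite sub0r normrN ger0_norm; first by exists N.
  by rewrite !mulr_ge0 ?exprn_ge0// invr_ge0 ltW.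
exists N => m n Nm Nn; rewrite (le_lt_trans (nr_dist (u N) _ _))// (nrC (u N)).
by rewrite (splitr e) ltrD// (le_lt_trans (K' _ _ _)).
Qed.

End RealNorm.

(** * Complex derivatives of vector-valued functions *)

Section Differentiability.
Variable R : realType.
Local Open Scope complex_scope.
Variable V : normedModType R[i].
Implicit Types (f : R[i] -> V) (z w : R[i]) (e : R).

Definition vdiff f z := exists k : V, forall e, 0 < e ->
  exists2 dl, 0 < dl & forall w, normc (w - z) < dl ->
    nr (f w - f z - (w - z) *: k) <= e * normc (w - z).

Lemma vdiffP f z : derivable (f : R[i]^o -> V) z 1 <-> vdiff f z.
Proof.
split.
  move=> df; exists ('D_1 (f : R[i]^o -> V) z) => e e0.
  have /cvgrPdist_lt/(_ e%:C) := df; rewrite ltcR => /(_ e0).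
  move=> [_ /posnumP[dl] dlP]; have [d d0 dE] := complex_gt0 [gt0 of dl%:num].
  exists d => // w wz; have [->|nwz] := eqVneq w z.
    by rewrite !subrr scale0r subrr nr0 normc0 mulr0.
  have wz0 : w - z != 0 by rewrite subr_eq0.
  have := dlP (w - z); rewrite /= sub0r normrN dE normc_norm ltcR => /(_ wz wz0).
  rewrite /= scaler1 subrK nrE ltcR => H.
  have -> : f w - f z - (w - z) *: 'D_1 (f : R[i]^o -> V) z =
      - ((w - z) *: ('D_1 (f : R[i]^o -> V) z - (w - z)^-1 *: (f w - f z))).
    by rewrite scalerBr scalerA divff// scale1r opprB.
  by rewrite nrN nrZ mulrC ler_wpM2r ?normc_ge0// ltW.
move=> [k kP]; apply/cvg_ex; exists k; apply/cvgrPdist_lt => _ /complex_gt0[e e0 ->].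
have e20 : 0 < e / 2 by rewrite divr_gt0.
have [d d0 dP] := kP _ e20; exists d%:C => /=; first by rewrite ltcR.
move=> w; rewrite /= sub0r normrN normc_norm ltcR => wd w0.
rewrite scaler1 nrE ltcR.
have := dP (w + z); rewrite addrK => /(_ wd) H.
have w0' : 0 < normc w.
  by rewrite lt_def normc_ge0 andbT; apply: contra_neq w0 => /eq0_normc.
have -> : k - w^-1 *: (f (w + z) - f z) = - (w^-1 *: (f (w + z) - f z - w *: k)).
  by rewrite [in RHS]scalerBr scalerA mulVf// scale1r opprB.
rewrite nrN nrZ normcV mulrC ltr_pdivrMr// (le_lt_trans H)//.
by rewrite ltr_pM2r// ltr_pdivrMr// ltr_pMr// ltr1n.
Qed.

Lemma vdiff_cont f z : vdiff f z -> forall e, 0 < e ->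
  exists2 dl, 0 < dl & forall w, normc (w - z) < dl -> nr (f w - f z) < e.
Proof.
move=> [k kP] e e0; have [d d0 dP] := kP 1 ltr01.
have M0 : 0 < nr k + 1 by rewrite ltr_pwDr// nr_ge0.
exists (Num.min d (e / (nr k + 1))) => [|w]; first by rewrite lt_min d0 divr_gt0.
rewrite lt_min => /andP[/dP]; rewrite mul1r => wd; rewrite ltr_pdivlMr// => we.
rewrite -[f w - f z](subrK ((w - z) *: k)) (le_lt_trans (nrD _ _))//.
by apply: le_lt_trans we; rewrite [leRHS]mulrDr mulr1 addrC nrZ lerD.
Qed.

End Differentiability.

(** * Averages over a strip and the identity theorem *)

Section Identity.
Variable R : realType.
Local Open Scope complex_scope.
Implicit Types (h : R[i] -> R[i]) (z w k : R[i]) (a b c d m e M : R).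

Lemma cdiff_vdiff h z : cdiff h z <-> vdiff (h : R[i] -> R[i]^o) z.
Proof.
by split=> -[k kP]; exists k => e /kP[d d0 dP]; exists d => // w /dP;
  rewrite nr_scalar [_ *: _]mulrC.
Qed.

Lemma cdiffP h z : derivable (h : R[i]^o -> R[i]^o) z 1 <-> cdiff h z.
Proof. by rewrite vdiffP cdiff_vdiff. Qed.

Lemma cdiff_ext h1 h2 z : (exists2 dl, 0 < dl & forall w, normc (w - z) < dl -> h1 w = h2 w) ->
  cdiff h1 z -> cdiff h2 z.
Proof.
move=> [d d0 dP] [k kP]; exists k => e e0; have [d' d'0 d'P] := kP e e0.
exists (Num.min d d') => [|w]; first by rewrite lt_min d0.
rewrite lt_min => /andP[wd /d'P]; rewrite !dP//.
by rewrite subrr normc0.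
Qed.

Lemma cdiff_cont_at h z : cdiff h z -> forall e, 0 < e ->
  exists2 dl, 0 < dl & forall w, normc (w - z) < dl -> normc (h w - h z) < e.
Proof.
by move=> /cdiff_vdiff/vdiff_cont H e /H[d d0 dP]; exists d.
Qed.

Lemma cdiff_ccont h : (forall z, cdiff h z) -> ccont h.
Proof. by move=> dh z; exact: cdiff_cont_at. Qed.

Lemma cdiff_cst k z : cdiff (fun=> k) z.
Proof. by apply/cdiffP; exact: derivable_cst. Qed.

Lemma cdiff_id z : cdiff id z.
Proof. by apply/cdiffP; exact: derivable_id. Qed.

Lemma cdiffD h1 h2 z : cdiff h1 z -> cdiff h2 z -> cdiff (fun w => h1 w + h2 w) z.
Proof. by move=> /cdiffP ? /cdiffP ?; apply/cdiffP; exact: derivableD. Qed.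

Lemma cdiffM h1 h2 z : cdiff h1 z -> cdiff h2 z -> cdiff (fun w => h1 w * h2 w) z.
Proof. move=> /cdiffP d1 /cdiffP d2; apply/cdiffP.
exact: (@derivableM R[i] R[i]^o (h1 : R[i]^o -> R[i]^o) (h2 : R[i]^o -> R[i]^o) z 1 d1 d2). Qed.

Lemma cdiffV h z : h z != 0 -> cdiff h z -> cdiff (fun w => (h w)^-1) z.
Proof. by move=> ? /cdiffP ?; apply/cdiffP; exact: derivableV. Qed.

Lemma cdiff_affine_comp h z k w : cdiff h (k + z * w) -> cdiff (fun w => h (k + z * w)) w.
Proof.
move=> [k' kP]; exists (k' * z) => e e0.
have M0 : 0 < normc z + 1 by rewrite ltr_pwDr// normc_ge0.
have [d d0 dP] := kP (e / (normc z + 1)) (divr_gt0 e0 M0).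
exists (d / (normc z + 1)); first by rewrite divr_gt0.
move=> w' ww'.
have zE : k + z * w' - (k + z * w) = z * (w' - w) by ring.
have zw : normc (z * (w' - w)) <= (normc z + 1) * normc (w' - w).
  by rewrite normcM ler_wpM2r ?normc_ge0// lerDl.
have := dP (k + z * w'); rewrite zE mulrA => H; rewrite (le_trans (H _))//.
  by rewrite (le_lt_trans zw)// mulrC -ltr_pdivlMr.
by rewrite -mulrA ler_pM2l// mulrC ler_pdivrMr// [leRHS]mulrC.
Qed.

(** Goursat on the four rectangles between the two squares identifies the integral over the large
    square with that over the square of half-side [e], which is O(e). The origin may thus be an
    exceptional point. *)
Lemma bdint_small h a m M : ccont h -> 0 < a -> 0 < m ->
  (forall e, 0 < e -> e < m -> `|bdint h (- e) e (- e) e| <= M * e) ->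
  (forall z, z != 0 -> cdiff h z) -> bdint h (- a) a (- a) a = 0.
Proof.
move=> ch a0 m0 H dh; apply/eqP; rewrite -normr_le0; apply/ler_addgt0Pl => d d0.
rewrite addr0.
pose e := Num.min (Num.min (a / 2) (m / 2)) (d / (`|M| + 1)).
have M0 : 0 < `|M| + 1 by rewrite ltr_pwDr.
have e0 : 0 < e by rewrite !lt_min !divr_gt0.
have ea : e < a.
  by apply: (@le_lt_trans _ _ (a / 2)); [rewrite !ge_min lexx|clear -a0; lra].
have em : e < m.
  by apply: (@le_lt_trans _ _ (m / 2)); [rewrite !ge_min lexx !orbT|clear -m0; lra].
have [e1 e2] : - a <= - e /\ e <= a by split; lra.
have e3 : - e <= e by lra.
have aa : - a <= a by lra.
have ea' : - e <= a by lra.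
rewrite (bdint_hsplit _ _ ch e1 ea') (bdint_hsplit _ _ ch e3 e2).
rewrite (bdint_vsplit (- e) e ch e1 ea') (bdint_vsplit (- e) e ch e3 e2).
have G a1 b1 c1 d1 : a1 <= b1 -> c1 <= d1 ->
    (b1 < 0) || (0 < a1) || (d1 < 0) || (0 < c1) -> bdint h a1 b1 c1 d1 = 0.
  move=> ab cd z0; apply: goursat => // z zab zcd; apply: dh.
  by apply: contraTN z0 => /eqP z0; move: zab zcd; rewrite z0/=; lra.
rewrite (G (- a) (- e))//; last by lra.
rewrite (G e a)//; last by lra.
rewrite (G _ _ (- a) (- e))//; last by lra.
rewrite (G _ _ e a)//; last by lra.
rewrite add0r addr0 add0r addr0 (le_trans (H _ _ _))//.
have : e <= d / (`|M| + 1) by rewrite ge_min lexx orbT.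
rewrite ler_pdivlMr// => H1; rewrite (le_trans _ H1)// mulrC ler_pM2l//.
by rewrite (le_trans (ler_norm _))// lerDl.
Qed.

Lemma rint_const_dist (f : R -> R) (r e T : R) : 0 <= T -> continuous f ->
  (forall x, `|f x - r| <= e) -> `|rint f 0 T - r * T| <= e * T.
Proof.
move=> T0 cf fr.
have -> : rint f 0 T - r * T = rint (fun x => f x + (- r)) 0 T.
  by rewrite rintD//; [rewrite rint_cst// subr0 mulNr|exact: cst_continuous].
have := @rint_bound R (fun x => f x + (- r)) 0 T e T0; rewrite subr0; apply => //.
by move=> x; apply: cvgB; [exact: cf|exact: cst_continuous].
Qed.

(* Cauchy's theorem on [0, T] x [c, d], divided by [T]: the vertical sides
   contribute O(M / T). *)
Lemma strip_average_Im h c d (C0 C1 : R[i]) e M : c <= d -> 0 <= M ->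
  (forall z, cdiff h z) ->
  (forall t, normc (h (t +i* c) - C0) <= e) ->
  (forall t, normc (h (t +i* d) - C1) <= e) ->
  (forall t y, c <= y <= d -> normc (h (t +i* y)) <= M) ->
  `|Im (C0 - C1)| <= 2 * e.
Proof.
move=> cd M0 dh h0 h1 hM; have ch := cdiff_ccont dh.
apply/ler_addgt0Pl => r r0; pose K := 2 * M * (d - c).
have K0 : 0 <= K by rewrite !mulr_ge0// subr_ge0.
(* Long enough for the vertical sides, which contribute at most [K], to fall below [r] after
   division by [T]. *)
pose T := (K + 1) / r; have T0 : 0 < T by rewrite divr_gt0// ltr_wpDl.
have Q : bdint h 0 T c d = 0 by apply: goursat => //; exact: ltW.
have e1 x : `|Im (h (x +i* c)) - Im (h (x +i* d)) - Im (C0 - C1)| <= 2 * e.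
  have := h0 x; have := h1 x => /(le_trans (Im_le_normc _)) + /(le_trans (Im_le_normc _)).
  by rewrite !ImB !ler_norml; lra.
have := rint_const_dist (ltW T0) (ccont_hdiff (c := c) (d := d) ch) e1.
have : `|rint (fun y => Re (h (T +i* y)) - Re (h (0 +i* y))) c d| <= K.
  apply: rint_bound => // [|y ycd]; first exact: ccont_vdiff.
  rewrite (le_trans (ler_normB _ _))// mulr_natl mulr2n lerD//;
  by rewrite (le_trans (Re_le_normc _))// hM.
move: Q; rewrite /bdint => /eqP; rewrite addr_eq0 => /eqP ->.
set I := rint _ _ _ => IK.
rewrite -opprD normrN => H.
have {}H : `|Im (C0 - C1)| * T <= 2 * e * T + K.
  rewrite -(ger0_norm (ltW T0)) -normrM (ger0_norm (ltW T0)).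
  have -> : Im (C0 - C1) * T = (I + Im (C0 - C1) * T) - I by ring.
  by rewrite (le_trans (ler_normB _ _))// lerD.
have rT : r * T = K + 1 by rewrite mulrC divfK// gt_eqF.
by rewrite -(ler_pM2r T0) mulrDl rT; move: H; lra.
Qed.

(** The imaginary part for ['i * h] is the real part for [h]; the two bounds [2 * e] add up. *)
Lemma strip_average h c d (C0 C1 : R[i]) e M : c <= d -> 0 <= M ->
  (forall z, cdiff h z) ->
  (forall t, normc (h (t +i* c) - C0) <= e) ->
  (forall t, normc (h (t +i* d) - C1) <= e) ->
  (forall t y, c <= y <= d -> normc (h (t +i* y)) <= M) ->
  normc (C0 - C1) <= 4 * e.
Proof.
move=> cd M0 dh h0 h1 hM.
have I := strip_average_Im cd M0 dh h0 h1 hM.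
have ni : normc ('i : R[i]) = 1 by rewrite normc_imag normr1.
have := @strip_average_Im (fun z => 'i * h z) c d ('i * C0) ('i * C1) e M cd M0.
rewrite -mulrBr => Hr; have {}Hr : `|Re (C0 - C1)| <= 2 * e.
  have -> : Re (C0 - C1) = Im ('i * (C0 - C1)) by case: (C0 - C1) => x y /=; ring.
  apply: Hr => [z|t|t|t y ty]; last by rewrite normcM ni mul1r hM.
  - by apply: cdiffM; [exact: cdiff_cst|exact: dh].
  - by rewrite -mulrBr normcM ni mul1r.
  - by rewrite -mulrBr normcM ni mul1r.
by rewrite (le_trans (normc_le_ReIm _))//; lra.
Qed.

(* If [h 0 != 0], Cauchy's theorem for [(h / h 0 - 1) / z] on the square makes
   the integral of [dz / z] vanish, as [h] is zero on the boundary. *)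
Lemma square_zero h a : 0 < a -> (forall z, cdiff h z) ->
  (forall x y, - a <= x <= a -> - a <= y <= a ->
     [|| x == - a, x == a, y == - a | y == a] -> h (x +i* y) = 0) ->
  h 0 = 0.
Proof.
move=> a0 dh hb; apply: contrapT => /eqP h0.
have ch := cdiff_ccont dh; have [k kP] := dh 0.
(* The value at 0 is the derivative of [h / h 0] there, which makes [g] continuous. *)
pose g z := if z == 0 then k / h 0 else (h z / h 0 - 1) / z.
have dg z : z != 0 -> cdiff g z.
  move=> z0; apply: (@cdiff_ext (fun w => (h w * (h 0)^-1 + (- 1)) * w^-1)).
    exists (normc z) => [|w wz].
      by rewrite lt_def normc_ge0 andbT; apply: contra_neq z0 => /eq0_normc.
    rewrite /g; case: eqVneq => // w0.
    by move: wz; rewrite w0 sub0r normcN ltxx.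
  apply: cdiffM; last by apply: cdiffV => //; exact: cdiff_id.
  apply: cdiffD; last exact: cdiff_cst.
  by apply: cdiffM; [exact: dh|exact: cdiff_cst].
have nh0 : 0 < normc (h 0).
  by rewrite lt_def normc_ge0 andbT; apply: contra_neq h0 => /eq0_normc.
have cg0 e : 0 < e -> exists2 dl, 0 < dl &
    forall w, normc (w - 0) < dl -> normc (g w - g 0) < e.
  move=> e0; have e'0 : 0 < e / 2 * normc (h 0) by rewrite !mulr_gt0// invr_gt0.
  have [d d0 dP] := kP _ e'0; exists d => // w /dP; rewrite subr0 => H.
  rewrite /g eqxx; case: eqVneq => [_|w0]; first by rewrite subrr normc0.
  have nw0 : 0 < normc w.
    by rewrite lt_def normc_ge0 andbT; apply: contra_neq w0 => /eq0_normc.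
  have -> : (h w / h 0 - 1) / w - k / h 0 = (h w - h 0 - k * w) / (w * h 0).
    by field; rewrite h0 w0.
  rewrite normcM normcV normcM ltr_pdivrMr ?mulr_gt0// (le_lt_trans H)//.
  have : 0 < e * (normc w * normc (h 0)) by rewrite !mulr_gt0.
  by move: (normc w) (normc (h 0)) => X Y; lra.
have cg : ccont g.
  move=> z; have [->|z0] := eqVneq z 0; [exact: cg0|exact/cdiff_cont_at/dg].
have [dl dl0 dlP] := cg0 1 ltr01.
pose N := normc (g 0) + 1.
have Q : bdint g (- a) a (- a) a = 0.
  apply: (@bdint_small _ _ (dl / 2) (8 * N)) => //; first by rewrite divr_gt0.
  move=> e e0 edl; have ee : - e <= e by lra.
  have -> : 8 * N * e = 2 * N * ((e - - e) + (e - - e)) by ring.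
  apply: bdint_bound => // x y xe ye.
  have /ltW : normc (g (x +i* y) - g 0) < 1.
    apply: dlP; rewrite subr0 (le_lt_trans (normc_le_ReIm _))//=.
    by rewrite (@le_lt_trans _ _ (e + e))// ?lerD// ?ler_norml//; lra.
  rewrite -(lerD2l (normc (g 0))) => H; apply: le_trans H.
  by rewrite (le_trans _ (le_normcD _ _))// addrC subrK.
(* On the boundary [h] vanishes, so [g] is [- 1 / z] there. *)
have gE x y : - a <= x <= a -> - a <= y <= a ->
    [|| x == - a, x == a, y == - a | y == a] ->
    g (x +i* y) = (- x / (x ^+ 2 + y ^+ 2)) +i* (y / (x ^+ 2 + y ^+ 2)).
  move=> xa ya xy; rewrite /g hb// mul0r add0r; case: eqVneq => [z0|z0].
    by exfalso; case: z0 xy => -> -> /or4P[] /eqP; clear -a0; lra.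
  by apply/eqP; rewrite eq_complex/= !(mulN1r, mul0r, mulNr, opprK, subr0, addr0, oppr0) !eqxx.
(* With this bound each pair of opposite sides contributes at most [- a^-1] times the length
   [2 * a], so the integral is at most -4; for - 1 / z its exact value is - 2 pi. *)
have lb t u : - a <= t <= a -> u ^+ 2 = a ^+ 2 ->
    a / (u ^+ 2 + t ^+ 2) >= (2 * a)^-1.
  move=> ta ->; have X0 : 0 < a ^+ 2 + t ^+ 2 by rewrite ltr_pwDl ?sqr_ge0// exprn_gt0.
  rewrite ler_pdivlMr// ler_pdivrMl ?mulr_gt0//; nra.
have aa : - a <= a by lra.
suff : bdint g (- a) a (- a) a < 0 by rewrite Q ltxx.
rewrite /bdint.
have H1 : rint (fun x => Im (g (x +i* - a)) - Im (g (x +i* a))) (- a) a <=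
          rint (fun=> - a^-1) (- a) a.
  apply: le_rint => //; [exact: ccont_hdiff|exact: cst_continuous|].
  move=> x xa; rewrite !gE ?lexx ?aa ?eqxx ?orbT//= sqrrN.
  have := @lb x a xa erefl; rewrite invfM addrC mulNr; set y := a / _.
  by move: (a^-1) => r; clear; lra.
have H2 : rint (fun y => Re (g (a +i* y)) - Re (g (- a +i* y))) (- a) a <=
          rint (fun=> - a^-1) (- a) a.
  apply: le_rint => //; [exact: ccont_vdiff|exact: cst_continuous|].
  move=> x xa; rewrite !gE ?lexx ?aa ?eqxx ?orbT//= sqrrN.
  have := @lb x a xa erefl; rewrite invfM opprK mulNr; set y := a / _.
  by move: (a^-1) => r; clear; lra.
rewrite (le_lt_trans (lerD H1 H2))// rint_cst//.
have : a^-1 * a = 1 by rewrite mulVf// gt_eqF.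
by move: (a^-1) => b; lra.
Qed.

(** The identity theorem without power series: a product of four copies of [h], rotated about [z],
    is entire and vanishes on the boundary of a square, hence at its centre, where it equals
    [h z ^+ 4]. *)
Lemma entire_eq0 h : (forall z, cdiff h z) -> (forall t : R, h t%:C = 0) ->
  forall z, h z = 0.
Proof.
move=> dh h0 [x y]; have [->|y0] := eqVneq y 0; first exact: h0.
pose p (j : R[i]) w := h ((x +i* y) + j * w).
(* Rotating the square of centre [x + i y] and half-side [|y|] takes each of
   its sides to the one on the real line. *)
pose H w := p 1 w * p 'i w * p (- 1) w * p (- 'i) w.
have H0 : H 0 = h (x +i* y) ^+ 4.
  by rewrite /H /p !mulr0 !addr0; ring.
have dp j w : cdiff (p j) w by apply: cdiff_affine_comp; exact: dh.
suff : H 0 = 0 by rewrite H0 => /eqP; rewrite expf_eq0 => /andP[_ /eqP].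
apply: (@square_zero _ `|y|); first by rewrite normr_gt0.
  by move=> z; do !apply: cdiffM; exact: dp.
have hr r s : s = 0 -> h (r +i* s) = 0 by move=> ->; exact: h0.
have p1 u v : v = - y -> p 1 (u +i* v) = 0.
  by move=> ->; rewrite /p; simpc; apply: hr; ring.
have p2 u v : u = - y -> p 'i (u +i* v) = 0.
  by move=> ->; rewrite /p; simpc; apply: hr; ring.
have p3 u v : v = y -> p (-1) (u +i* v) = 0.
  by move=> ->; rewrite /p; simpc; apply: hr; ring.
have p4 u v : u = y -> p (- 'i) (u +i* v) = 0.
  by move=> ->; rewrite /p; simpc; apply: hr; ring.
move=> u v _ _ uv; rewrite /H.
have : [|| u == - y, u == y, v == - y | v == y].
  by move: uv; case: (ger0P y) => _; rewrite ?opprK => /or4P[] /eqP ->;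
    rewrite !eqxx ?orbT.
by case/or4P => /eqP E; [rewrite (p2 u v E)|rewrite (p4 u v E)|
  rewrite (p1 u v E)|rewrite (p3 u v E)]; rewrite !(mul0r, mulr0).
Qed.

End Identity.

(** * Positive functionals and representations *)

Section Forms.
Variable R : realType.
Local Open Scope complex_scope.

Definition clin (E : lmodType R[i]) (f : E -> R[i]) :=
  forall (k : R[i]) u v, f (k *: u + v) = k * f u + f v.

Section ClinTheory.
Variables (E : lmodType R[i]) (f : E -> R[i]) (cf : clin f).

Lemma clinD u v : f (u + v) = f u + f v.
Proof. by rewrite -[u]scale1r cf mul1r scale1r. Qed.

Lemma clin0 : f 0 = 0.
Proof. by apply: (addrI (f 0)); rewrite -clinD !addr0. Qed.

Lemma clinZ k u : f (k *: u) = k * f u.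
Proof. by rewrite -[k *: u]addr0 cf clin0 addr0. Qed.

Lemma clinN u : f (- u) = - f u.
Proof. by rewrite -scaleN1r clinZ mulN1r. Qed.

Lemma clinB u v : f (u - v) = f u - f v.
Proof. by rewrite clinD clinN. Qed.

End ClinTheory.

(* A positive semidefinite form is automatically hermitian. *)
Record psd_form (E : lmodType R[i]) (B : E -> E -> R[i]) : Prop := {
  psd_linear : forall v, clin (B^~ v) ;
  psd_antilinear : forall u (k : R[i]) v w, B u (k *: v + w) = conjc k * B u v + B u w ;
  psd_ge0 : forall u, 0 <= B u u }.

Section PsdTheory.
Variables (E : lmodType R[i]) (B : E -> E -> R[i]) (pB : psd_form B).

Lemma psdDl u v w : B (u + v) w = B u w + B v w.
Proof. exact: (clinD (psd_linear pB w)). Qed.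

Lemma psdZl k u w : B (k *: u) w = k * B u w.
Proof. exact: (clinZ (psd_linear pB w)). Qed.

Lemma psdBl u v w : B (u - v) w = B u w - B v w.
Proof. exact: (clinB (psd_linear pB w)). Qed.

Lemma psdDr u v w : B w (u + v) = B w u + B w v.
Proof. by have := psd_antilinear pB w 1 u v; rewrite !scale1r rmorph1 mul1r. Qed.

Lemma psd0r w : B w 0 = 0.
Proof. by apply: (addrI (B w 0)); rewrite -psdDr !addr0. Qed.

Lemma psdZr k u w : B w (k *: u) = conjc k * B w u.
Proof. by rewrite -[k *: u]addr0 (psd_antilinear pB) psd0r addr0. Qed.

Lemma psdNr u w : B w (- u) = - B w u.
Proof. by rewrite -scaleN1r psdZr rmorphN rmorph1 mulN1r. Qed.

Lemma psdBr u v w : B w (u - v) = B w u - B w v.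
Proof. by rewrite psdDr psdNr. Qed.

Lemma psd_real u : Im (B u u) = 0.
Proof. by have [-> _] := complex_ge0 (psd_ge0 pB u). Qed.

Lemma psdRe_ge0 u : 0 <= Re (B u u).
Proof. by have [] := complex_ge0 (psd_ge0 pB u). Qed.

Lemma psdE u : B u u = (Re (B u u))%:C.
Proof. by have [] := complex_ge0 (psd_ge0 pB u). Qed.

(** The values of the form at [u + v] and at ['i *: u + v] are real; this makes the imaginary parts
    of [B u v] and [B v u] opposite and their real parts equal. *)
Lemma psd_herm u v : B v u = conjc (B u v).
Proof.
have := psd_real (u + v); have := psd_real ('i *: u + v).
rewrite !(psdDl, psdDr, psdZl, psdZr) !ImD !psd_real.
have := psd_real ('i *: u); rewrite psdZl psdZr => ->.
case: (B u v) => a b; case: (B v u) => a' b' /=.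
rewrite !(mul0r, mul1r, addr0, add0r, mulN1r, subr0, sub0r, oppr0).
by move=> /eqP; rewrite addr_eq0 => /eqP E1 E2; congr (_ +i* _); lra.
Qed.

(** Positivity at u - t B(u, v) v for real t. The optimal t is the inverse of [B v v]; if
    [B v v = 0], which a degenerate form allows for nonzero v, a large t contradicts
    [B u v != 0]. *)
Lemma psd_cauchy_schwarz u v : normc (B u v) ^+ 2 <= Re (B u u) * Re (B v v).
Proof.
set X := Re _; set Y := Re _; set N := _ ^+ 2.
have X0 : 0 <= X := psdRe_ge0 u; have Y0 : 0 <= Y := psdRe_ge0 v.
have N0 : 0 <= N by rewrite exprn_ge0 ?normc_ge0.
have NE : N = Re (B u v) ^+ 2 + Im (B u v) ^+ 2.
  by rewrite /N normcE2 sqr_sqrtr// addr_ge0 ?sqr_ge0.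
have H (t : R) : 0 <= X - 2 * t * N + t ^+ 2 * N * Y.
  have := psdRe_ge0 (u - (t%:C * B u v) *: v).
  rewrite psdBl !psdBr !psdZl !psdZr (psd_herm u v) !ReB (psdE u) (psdE v).
  rewrite -/X -/Y NE.
  case: (B u v) => a b /=; rewrite !(mul0r, mulr0, subr0, addr0, add0r).
  by congr (_ <= _); ring.
have [N00|N00] := eqVneq N 0; first by rewrite N00 mulr_ge0.
have {}N0 : 0 < N by rewrite lt_def N00.
have [Y00|Y00] := eqVneq Y 0.
  have := H ((X + 1) / (2 * N)); rewrite Y00 mulr0 addr0.
  have -> : 2 * ((X + 1) / (2 * N)) * N = X + 1 by field.
  lra.
have {}Y0 : 0 < Y by rewrite lt_def Y00.
have := H Y^-1.
have -> : X - 2 / Y * N + Y^-1 ^+ 2 * N * Y = X - N / Y by field.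
by rewrite subr_ge0 ler_pdivrMr.
Qed.

End PsdTheory.

End Forms.

(** * Positive functionals and states of a C*-algebra *)

Section CStarBasics.
Variable R : realType.
Local Open Scope complex_scope.
Variable A : cstarAlgType R[i].
Implicit Types a b x y : A.

Lemma cmulBl a b x : (a - b) ** x = a ** x - b ** x.
Proof. by rewrite cmulDl -scaleN1r cmulZl scaleN1r. Qed.

Lemma cmulBr a b x : x ** (a - b) = x ** a - x ** b.
Proof. by rewrite cmulDr -scaleN1r cmulZr scaleN1r. Qed.

Lemma cmul0l x : 0 ** x = 0.
Proof. by rewrite -[in LHS](subrr 0) cmulBl subrr. Qed.

Lemma cmul0r x : x ** 0 = 0.
Proof. by rewrite -[in LHS](subrr 0) cmulBr subrr. Qed.

Lemma starZ_c (k : R[i]) a : star (k *: a) = conjc k *: star a.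
Proof. by rewrite starZ. Qed.

Lemma star0 : star (0 : A) = 0.
Proof. by rewrite -[in LHS](scale0r (0 : A)) starZ_c rmorph0 scale0r. Qed.

Lemma starN a : star (- a) = - star a.
Proof. by rewrite -scaleN1r starZ_c rmorphN rmorph1 scaleN1r. Qed.

Lemma starB a b : star (a - b) = star a - star b.
Proof. by rewrite starD starN. Qed.

Lemma star1 : star (cone : A) = cone.
Proof. by have := starM (star (cone : A)) cone; rewrite !cmul1r starK cmul1r => <-. Qed.

Lemma nrM a b : nr (a ** b) <= nr a * nr b.
Proof. by rewrite -nr_le rmorphM/= -!nrE norm_cmul. Qed.

Lemma nr_starM a : nr (star a ** a) = nr a ^+ 2.
Proof. by apply: complexI; rewrite rmorphXn/= -!nrE norm_star_cmul. Qed.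

Lemma nr_star a : nr (star a) = nr a.
Proof.
have H b : nr b <= nr (star b).
  have [->|b0] := eqVneq (nr b) 0; first exact: nr_ge0.
  rewrite -(@ler_pM2r _ (nr b)) ?lt_def ?b0 ?nr_ge0//.
  by rewrite -expr2 -nr_starM nrM.
by apply/le_anti; rewrite H andbT -{2}[a]starK H.
Qed.

Lemma nr_cone : nr (cone : A) <= 1.
Proof.
have : nr (cone : A) = nr (cone : A) ^+ 2 by rewrite -nr_starM star1 cmul1l.
by have := nr_ge0 (cone : A); nra.
Qed.

(** This takes the place of functional calculus: [cone - y] is a self-adjoint square root of
    [cone - x]. The equation (1 - y)^2 = 1 - x reads y = (x + y^2) / 2, and on the ball of radius
    [nr x] the right-hand side is a contraction of ratio [nr x]. *)
Lemma one_sub_square x : star x = x -> nr x < 1 ->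
  exists2 y, star y = y & cone - x = (cone - y) ** (cone - y).
Proof.
move=> sx x1; set r := nr x in x1; have r0 : 0 <= r := nr_ge0 x.
(* [y] is the limit of the iteration [y := (x + y ^ 2) / 2]. *)
pose u := fix u n : A := if n is n'.+1 then 2^-1 *: (x + u n' ** u n') else 0.
have n2 : normc (2^-1 : R[i]) = 2^-1.
  by rewrite (_ : 2^-1 = (2^-1)%:C) ?normc_real ?ger0_norm ?rmorphV ?rmorph_nat ?unitfE.
have ur n : nr (u n) <= r.
  elim: n => [|n IH] /=; first by rewrite nr0.
  rewrite nrZ n2 mulrC ler_pdivrMr// (le_trans (nrD _ _))// mulr_natr mulr2n lerD//.
  rewrite (le_trans (nrM _ _))//; have := nr_ge0 (u n); nra.
have us n : star (u n) = u n.
  elim: n => [|n IH] /=; first by rewrite star0.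
  rewrite starZ_c starD sx starM IH; congr (_ *: _).
  by rewrite (_ : 2^-1 = (2^-1)%:C) ?conjc_real// rmorphV ?rmorph_nat ?unitfE.
have sq a b : nr a <= r -> nr b <= r ->
    nr (2^-1 *: (x + a ** a) - 2^-1 *: (x + b ** b)) <= r * nr (a - b).
  move=> ar br; rewrite -scalerBr nrZ n2 mulrC ler_pdivrMr//.
  have -> : x + a ** a - (x + b ** b) = a ** (a - b) + (a - b) ** b.
    by rewrite cmulBl cmulBr opprD addrACA subrr add0r addrA subrK.
  rewrite (le_trans (nrD _ _))//.
  have := nrM a (a - b); have := nrM (a - b) b; have := nr_ge0 (a - b); nra.
have uS n : nr (u n.+1 - u n) <= r * r ^+ n.
  elim: n => [|n IH]; last first.
    rewrite [u n.+2]/= [u n.+1 in X in _ - X]/= (le_trans (sq _ _ (ur n.+1) (ur n)))//.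
    by rewrite exprS ler_wpM2l.
  by have := ur 1%N; rewrite [u 0%N]/= subr0 expr0 mulr1.
have [||y yP] := geometric_cauchy _ _ uS; [exact: r0|by rewrite r0|].
have yr : nr y <= r.
  apply/ler_addgt0Pl => e /yP[N /(_ N (leqnn _))].
  rewrite nrC -{2}[y](subrK (u N)) => H.
  by rewrite (le_trans (nrD _ _))// addrC addrC lerD// ltW.
have ys : star y = y.
  apply: eq_of_nr => e e0; have [N /(_ N (leqnn _)) NP] := yP (e / 2) (divr_gt0 e0 (ltr0n _ 2)).
  rewrite (le_trans (nr_dist (u N) _ _))// -{1}(us N) -starB nr_star nrC.
  by rewrite (splitr e) lerD// ltW.
have yE : y = 2^-1 *: (x + y ** y).
  apply: eq_of_nr => e e0; have [N NP] := yP (e / 2) (divr_gt0 e0 (ltr0n _ 2)).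
  rewrite (le_trans (nr_dist (u N.+1) _ _))// (nrC y) (splitr e) lerD//.
    by rewrite ltW// NP.
  rewrite [u N.+1]/= (le_trans (sq _ _ (ur N) yr))//.
  rewrite (@le_trans _ _ (nr (u N - y)))// ?ler_piMl ?nr_ge0// ltW//.
  exact: NP.
exists y => //.
have E : x + y ** y = y + y.
  by rewrite -[in RHS]mulr2n -scaler_nat [in RHS]yE scalerA divff ?scale1r// pnatr_eq0.
rewrite cmulBl cmul1l cmulBr cmul1r.
by rewrite -[x in LHS](addrK (y ** y)) E -addrA opprD addrA.
Qed.

Definition positive (f : A -> R[i]) := forall a, 0 <= f (star a ** a).

Section PositiveFunctional.
Variables (f : A -> R[i]) (cf : clin f) (pf : positive f).

Lemma positive_psd : psd_form (fun u v => f (star v ** u)).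
Proof.
split=> [v k u w|u k v w|u]; last exact: pf.
  by rewrite cmulDr cmulZr (clinD cf) (clinZ cf).
by rewrite starD starZ_c cmulDl cmulZl (clinD cf) (clinZ cf).
Qed.

Lemma positive_star a : f (star a) = conjc (f a).
Proof.
by have := psd_herm positive_psd a cone; rewrite star1 cmul1r cmul1l.
Qed.

Lemma positive_one : f cone = (Re (f cone))%:C /\ 0 <= Re (f cone).
Proof. by apply: complex_ge0; have := pf cone; rewrite star1 cmul1l. Qed.

(** For y = x / (nr x + d) both [cone - y] and [cone + y] are squares of self-adjoint elements, on
    which [f] is nonnegative; [d] keeps the norm of y below 1 and is then made small. *)
Lemma positive_selfadjoint x : star x = x -> normc (f x) <= Re (f cone) * nr x.
Proof.
move=> sx; have [f1E f1] := positive_one.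
have fx : Im (f x) = 0.
  by have := positive_star x; rewrite sx; case: (f x) => a b [/= E]; lra.
have nf : normc (f x) = `|Re (f x)|.
  by rewrite normcE2 fx expr0n/= addr0 sqrtr_sqr.
have half y : star y = y -> nr y < 1 -> Re (f y) <= Re (f cone).
  move=> sy y1; have [z sz yE] := one_sub_square sy y1.
  have : 0 <= f (cone - y) by rewrite yE -{1}sz -{1}star1 -starB pf.
  by move=> /complex_ge0[_]; rewrite (clinB cf) ReB subr_ge0.
rewrite nf; apply/ler_addgt0Pl => e e0.
pose d := e / (Re (f cone) + 1).
have f1' : 0 < Re (f cone) + 1 by rewrite ltr_wpDl.
have d0 : 0 < d by rewrite divr_gt0.
have r0 : 0 < nr x + d by rewrite ltr_wpDl ?nr_ge0.
suff H : `|Re (f x)| <= Re (f cone) * (nr x + d).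
  rewrite (le_trans H)// mulrDr addrC lerD2r /d mulrCA ler_piMr ?ltW//.
  by rewrite ltr_pdivrMr// mul1r ltrDl.
pose k : R[i] := ((nr x + d)^-1)%:C.
have sk (s : R[i]) : conjc s = s -> star ((s * k) *: x) = (s * k) *: x.
  move=> ss; rewrite starZ_c sx; congr (_ *: _).
  by rewrite rmorphM; congr (_ * _); [exact: ss|exact: conjc_real].
have nk s : normc s = 1 -> nr ((s * k) *: x) < 1.
  move=> s1; rewrite nrZ normcM s1 mul1r normc_real ger0_norm ?invr_ge0 ?ltW//.
  by rewrite mulrC ltr_pdivrMr// mul1r ltrDl.
have fk s : Re (f ((s * k) *: x)) = Re s * Re (f x) / (nr x + d) - Im s * 0.
  rewrite (clinZ cf); case: s (f x) fx => s1 s2 [x1 x2] /= ->; ring.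
have := half _ (sk 1 (rmorph1 _)) (nk 1 (normc1 _)); rewrite fk/= mul1r mul0r subr0.
have := half _ (sk (-1) _) (nk (-1) _); rewrite rmorphN rmorph1 normcN normc1.
move=> /(_ erefl erefl); rewrite fk/= oppr0 mul0r subr0 mulN1r.
by rewrite !ler_pdivrMr// ler_norml => H1 H2; apply/andP; split; lra.
Qed.

(** Cauchy-Schwarz against [cone] reduces the bound to the self-adjoint element [star a ** a], whose
    norm is [nr a ^+ 2]. *)
Lemma positive_bound a : normc (f a) <= Re (f cone) * nr a.
Proof.
have [f1E f1] := positive_one.
rewrite -(@ler_pXn2r _ 2) ?nnegrE ?normc_ge0 ?mulr_ge0 ?nr_ge0//.
have := psd_cauchy_schwarz positive_psd a cone; rewrite star1 !cmul1l => H.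
rewrite (le_trans H)// exprMn mulrC expr2 -mulrA ler_wpM2l//.
have sa : star (star a ** a) = star a ** a by rewrite starM starK.
have := positive_selfadjoint sa; rewrite nr_starM; apply: le_trans.
by rewrite (le_trans (ler_norm _))// Re_le_normc.
Qed.

End PositiveFunctional.

Lemma state_clin (f : A -> R[i]) : state f -> clin f.
Proof. by case=> lf _ _ k u v; rewrite lf. Qed.

Lemma state_positive (f : A -> R[i]) : state f -> positive f.
Proof. by case. Qed.

(** The norm of [cone] is only known to be at most 1, as the zero algebra is allowed; this gives one
    inequality. The other holds because [Re (f cone)] is itself a bound for [f], so the operator
    norm 1 does not exceed it. *)
Lemma state_one (f : A -> R[i]) : state f -> f cone = 1.
Proof.
move=> sf; have cf := state_clin sf; have pf := state_positive sf.
have [_ _ [_ f1 fmin]] := sf; have [f1E f10] := positive_one pf.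
rewrite f1E; congr _%:C; apply/le_anti/andP; split.
  have := f1 cone; rewrite mul1r !nrE lecR nr_scalar => H.
  by rewrite (le_trans (ler_norm _))// (le_trans (Re_le_normc _))// (le_trans H) ?nr_cone.
have := fmin (Re (f cone))%:C; rewrite ler0c lecR; apply=> // x.
by rewrite !nrE -rmorphM lecR nr_scalar positive_bound.
Qed.

Lemma positive_state (f : A -> R[i]) : clin f -> positive f -> f cone = 1 -> state f.
Proof.
move=> cf pf f1; split=> //; split=> // [x|M M0 H].
  by rewrite mul1r !nrE lecR nr_scalar (le_trans (positive_bound cf pf x))// f1 mul1r.
have := H cone; rewrite f1 normr1 => /le_trans; apply.
rewrite -[leRHS]mulr1 ler_wpM2l// nr_le; exact: nr_cone.
Qed.

Lemma state_convex (s : R[i]) (f1 f2 : A -> R[i]) : 0 <= s <= 1 ->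
  state f1 -> state f2 -> state (fun b => s * f1 b + (1 - s) * f2 b).
Proof.
move=> /andP[s0 s1] h1 h2; apply: positive_state.
- by move=> k u v; rewrite (state_clin h1) (state_clin h2); ring.
- move=> a; rewrite addr_ge0// mulr_ge0 ?subr_ge0//.
    exact: (state_positive h1).
  exact: (state_positive h2).
by rewrite (state_one h1) (state_one h2); ring.
Qed.

End CStarBasics.

(** * Hilbert spaces and representations *)

Section HilbertBasics.
Variable R : realType.
Local Open Scope complex_scope.
Variable H : hilbertType R[i].
Implicit Types u v w : H.

Lemma inner_psd : psd_form (fun u v : H => inner u v).
Proof.
split=> [v k u w|u k v w|u]; last exact: dnorm_ge0.
  by rewrite linearDl linearZl_LR.
by rewrite linearDr linearZr_LR.
Qed.

Lemma innerC u v : inner v u = conjc (inner u v).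
Proof. exact: (psd_herm inner_psd). Qed.

Lemma inner_nr u : inner u u = (nr u ^+ 2)%:C.
Proof. by rewrite -normE nrE -rmorphXn. Qed.

Lemma inner_CS u v : normc (inner u v) <= nr u * nr v.
Proof.
rewrite -(@ler_pXn2r _ 2) ?nnegrE ?normc_ge0 ?mulr_ge0 ?nr_ge0//.
by have := psd_cauchy_schwarz inner_psd u v; rewrite !inner_nr/= exprMn.
Qed.

Lemma inner_ext u w : (forall v, inner u v = inner w v) -> u = w.
Proof.
move=> uw; apply/subr0_eq/nr_eq0.
have : inner (u - w) (u - w) = 0 by rewrite (psdBl inner_psd) uw subrr.
by rewrite inner_nr => -[/eqP]; rewrite expf_eq0 => /eqP.
Qed.

Lemma inner_extr u w : (forall v, inner v u = inner v w) -> u = w.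
Proof.
by move=> uw; apply: inner_ext => v; rewrite !(innerC v) uw.
Qed.

Lemma isometry_inner (T : H -> H) : isometry_op T ->
  forall u v, inner (T u) (T v) = inner u v.
Proof.
move=> [lT iT].
have nT u : nr (T u) = nr u by rewrite /nr iT.
have re u v : Re (inner (T u) (T v)) = Re (inner u v).
  have TD : T (u + v) = T u + T v by have := lT 1 u v; rewrite !scale1r.
  have : inner (T (u + v)) (T (u + v)) = inner (u + v) (u + v).
    by rewrite !inner_nr nT.
  rewrite TD !(psdDl inner_psd, psdDr inner_psd).
  rewrite (psd_herm inner_psd u v) (psd_herm inner_psd (T u) (T v)) !inner_nr !nT.
  by move=> /(congr1 (@Re R)); case: (inner u v) => a b; case: (inner _ _) => c d /=; lra.
move=> u v.
have T0 : T 0 = 0 by have := lT (-1) 0 0; rewrite !scaleN1r !addNr.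
have TZ : T ('i *: u) = 'i *: T u by have := lT 'i u 0; rewrite T0 !addr0.
have := re ('i *: u) v; rewrite TZ !(psdZl inner_psd).
have := re u v; case: (inner u v) => a b; case: (inner _ _) => c d /= -> E.
by congr (_ +i* _); lra.
Qed.

Lemma is_adjointC (T S : H -> H) : is_adjoint T S -> is_adjoint S T.
Proof.
by move=> TS u v; rewrite innerC -TS -innerC.
Qed.

End HilbertBasics.

Section Representations.
Variable R : realType.
Local Open Scope complex_scope.
Variables (A : cstarAlgType R[i]) (H : hilbertType R[i]) (pi : A -> H -> H).
Hypothesis rp : star_rep pi.

Lemma rep_linearA u : linear (pi^~ u). Proof. by have [_ /(_ u)] := rp. Qed.

Lemma rep_mul a b u : pi (a ** b) u = pi a (pi b u).
Proof. by have [_ _ -> _] := rp. Qed.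

Lemma rep_star a u v : inner (pi a u) v = inner u (pi (star a) v).
Proof. by have [_ _ _] := rp; apply. Qed.

Lemma repB a b u : pi (a - b) u = pi a u - pi b u.
Proof.
have := rep_linearA u (-1) b a; rewrite /= !scaleN1r => E.
by rewrite [a - b]addrC E addrC.
Qed.

Lemma rep_clin u v : clin (fun a => inner (pi a u) v).
Proof.
move=> k a b; rewrite (rep_linearA u) (psdDl (inner_psd H)).
by rewrite (psdZl (inner_psd H)).
Qed.

Lemma rep_positive u : positive (fun a => inner (pi a u) u).
Proof. by move=> a; rewrite rep_mul rep_star starK; exact: dnorm_ge0. Qed.

(** [pi cone] is a self-adjoint idempotent but perhaps not the identity, as representations may be
    degenerate. *)
Lemma rep_one_le u : nr (pi cone u) <= nr u.
Proof.
have [->|u0] := eqVneq (nr (pi cone u)) 0; first exact: nr_ge0.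
have u0' : 0 < nr (pi cone u) by rewrite lt_def u0 nr_ge0.
rewrite -(ler_pM2r u0') -expr2.
have -> : nr (pi cone u) ^+ 2 = Re (inner u (pi cone u)).
  have -> : inner u (pi cone u) = inner (pi cone u) (pi cone u).
    by rewrite rep_star star1 -rep_mul cmul1l.
  by rewrite inner_nr.
by rewrite (le_trans (ler_norm _))// (le_trans (Re_le_normc _))// inner_CS.
Qed.

(** The vector functional at [u] is positive; [positive_bound] at [star a ** a] makes every
    representation contractive. *)
Lemma rep_bound a u : nr (pi a u) <= nr a * nr u.
Proof.
rewrite -(@ler_pXn2r _ 2) ?nnegrE ?mulr_ge0 ?nr_ge0//.
have -> : nr (pi a u) ^+ 2 = Re (inner (pi (star a ** a) u) u).
  by rewrite rep_mul rep_star starK inner_nr.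
rewrite (le_trans (ler_norm _))// (le_trans (Re_le_normc _))//.
rewrite (le_trans (positive_bound (rep_clin u u) (rep_positive u) _))//.
rewrite nr_starM mulrC exprMn ler_wpM2l ?exprn_ge0 ?nr_ge0//.
rewrite (le_trans (ler_norm _))// (le_trans (Re_le_normc _))//.
by rewrite (le_trans (inner_CS _ _))// ler_wpM2r ?nr_ge0// rep_one_le.
Qed.

End Representations.

(** * Completion of a pre-Hilbert space *)

Section Seminorm.
Variable R : realType.
Local Open Scope complex_scope.
Variables (E : lmodType R[i]) (B : E -> E -> R[i]) (pB : psd_form B).
Implicit Types (u v f g : E) (d e : R).

Definition sn u : R := Num.sqrt (Re (B u u)).

Lemma sn_ge0 u : 0 <= sn u. Proof. exact: sqrtr_ge0. Qed.

Lemma sn_sq u : sn u ^+ 2 = Re (B u u).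
Proof. by rewrite sqr_sqrtr// psdRe_ge0. Qed.

Lemma sn_CS u v : normc (B u v) <= sn u * sn v.
Proof.
rewrite -(@ler_pXn2r _ 2) ?nnegrE ?normc_ge0 ?mulr_ge0 ?sn_ge0//.
by rewrite exprMn !sn_sq psd_cauchy_schwarz.
Qed.

Lemma snD u v : sn (u + v) <= sn u + sn v.
Proof.
rewrite -(@ler_pXn2r _ 2) ?nnegrE ?addr_ge0 ?sn_ge0//.
rewrite sn_sq (psdDl pB) !(psdDr pB) !ReD -!sn_sq (psd_herm pB u v).
have : Re (B u v) <= sn u * sn v.
  by rewrite (le_trans (ler_norm _))// (le_trans (Re_le_normc _))// sn_CS.
by case: (B u v) => a b /=; nra.
Qed.

Lemma snZ (k : R[i]) u : sn (k *: u) = normc k * sn u.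
Proof.
rewrite /sn (psdZl pB) (psdZr pB) (psdE pB u).
have -> : Re (k * (conjc k * (Re (B u u))%:C)) = normc k ^+ 2 * Re (B u u).
  rewrite normcE2 sqr_sqrtr ?addr_ge0 ?sqr_ge0//.
  by case: k => a b /=; ring.
by rewrite sqrtrM ?sqr_ge0// sqrtr_sqr ger0_norm ?normc_ge0.
Qed.

End Seminorm.

Section ComplexCauchy.
Variable R : realType.
Local Open Scope complex_scope.

Lemma cauchy_real (u : nat -> R) :
  (forall e, 0 < e -> exists N, forall m n, (N <= m)%N -> (N <= n)%N ->
     `|u m - u n| < e) -> cvg (u @ \oo).
Proof.
move=> H; apply/cauchy_cvgP/cauchy_ballP => e e0.
have [N NP] := H e e0; near_simpl.
near=> p => /=; rewrite -ball_normE/= NP//; near: p.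
  by exists ([set n | (N <= n)%N], setT) => [|[? ?] []//]; split; [exists N|exact: filterT].
by exists (setT, [set n | (N <= n)%N]) => [|[? ?] []//]; split; [exact: filterT|exists N].
Unshelve. all: by end_near. Qed.

Lemma cauchy_complex (u : nat -> R[i]) :
  (forall e, 0 < e -> exists N, forall m n, (N <= m)%N -> (N <= n)%N ->
     normc (u m - u n) < e) ->
  exists l, forall e, 0 < e -> exists N, forall n, (N <= n)%N -> normc (u n - l) < e.
Proof.
move=> H.
have /cvg_ex[a ua] : cvg ((fun n => Re (u n)) @ \oo).
  apply: cauchy_real => e /H[N NP]; exists N => m n Nm Nn.
  by rewrite -ReB (le_lt_trans (Re_le_normc _))// NP.
have /cvg_ex[b ub] : cvg ((fun n => Im (u n)) @ \oo).
  apply: cauchy_real => e /H[N NP]; exists N => m n Nm Nn.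
  by rewrite -ImB (le_lt_trans (Im_le_normc _))// NP.
exists (a +i* b) => e e0; have e20 : 0 < e / 2 by rewrite divr_gt0.
have /cvgrPdist_lt/(_ _ e20)[N1 _ N1P] := ua.
have /cvgrPdist_lt/(_ _ e20)[N2 _ N2P] := ub.
exists (maxn N1 N2) => n; rewrite geq_max => /andP[/N1P/= H1 /N2P/= H2].
rewrite (le_lt_trans (normc_le_ReIm _))// (splitr e) ReB ImB/=.
by rewrite ltrD// distrC.
Qed.

Lemma inv_nat_small (e : R) : 0 < e -> exists N, forall n, (N <= n)%N -> n.+1%:R^-1 < e.
Proof.
move=> e0; have [N NP] : exists N, N.+1%:R^-1 < e.
  have /cvgrPdist_lt/(_ _ e0)[N _ /(_ N (leqnn _))] := @cvg_harmonic R.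
  by rewrite /= sub0r normrN ger0_norm ?invr_ge0//; exists N.
exists N => n Nn; rewrite (le_lt_trans _ NP)// lef_pV2 ?posrE// ler_nat ltnS//.
Qed.

Lemma normc_eq_of (x y : R[i]) : (forall e, 0 < e -> normc (x - y) <= e) -> x = y.
Proof.
move=> H; apply/subr0_eq/eq0_normc/eqP; rewrite eq_le normc_ge0 andbT.
by apply/ler_addgt0Pl => e e0; rewrite addr0 H.
Qed.

Lemma normc_dist (y x z : R[i]) : normc (x - z) <= normc (x - y) + normc (y - z).
Proof. by rewrite (le_trans _ (le_normcD _ _))// addrA subrK. Qed.

Lemma normcC (x y : R[i]) : normc (x - y) = normc (y - x).
Proof. by rewrite -normcN opprB. Qed.

End ComplexCauchy.

(* The completion of a pre-Hilbert space [E] is realized in its antidual: an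
   element is a functional which is a limit, in the dual seminorm, of the
   functionals [B f] with [f] in [E]. *)
Section Completion.
Variable R : realType.
Local Open Scope complex_scope.
Variables (E : lmodType R[i]) (B : E -> E -> R[i]) (pB : psd_form B).
Implicit Types (F G : E -> R[i]) (f g u v : E) (d e : R) (k : R[i]).
Local Notation sn := (sn B).

Definition approx F e f := forall g, normc (F g - B f g) <= e * sn g.

Definition in_compl F := forall e, 0 < e -> exists f, approx F e f.

Lemma approx_sub F d e f g : 0 <= d + e -> approx F d f -> approx F e g ->
  sn (f - g) <= d + e.
Proof.
move=> de fP gP; have [->//|s0] := eqVneq (sn (f - g)) 0.
have {}s0 : 0 < sn (f - g) by rewrite lt_def s0 sn_ge0.
rewrite -(ler_pM2r s0) -expr2 (sn_sq pB) (psdBl pB).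
rewrite (le_trans (ler_norm _))// (le_trans (Re_le_normc _))//.
rewrite (le_trans (normc_dist (F (f - g)) _ _))// normcC mulrDl lerD//.
Qed.

Lemma approx_bounded F f1 d f : d <= 1 -> 0 <= d -> approx F 1 f1 -> approx F d f ->
  sn f <= sn f1 + 2.
Proof.
move=> d1 d0 f1P fP; rewrite -(subrK f1 f) (le_trans (snD pB _ _))// addrC lerD2l.
by rewrite (le_trans (approx_sub _ fP f1P)) ?addr_ge0// -[2]/(1 + 1) lerD2r.
Qed.

Lemma compl_antilinear F k u v : in_compl F -> F (k *: u + v) = conjc k * F u + F v.
Proof.
move=> FP; apply: normc_eq_of => e e0.
pose C := sn (k *: u + v) + normc k * sn u + sn v + 1.
have C0 : 0 < C by rewrite ltr_pwDr// !addr_ge0 ?mulr_ge0 ?sn_ge0 ?normc_ge0.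
have [f fP] := FP _ (divr_gt0 e0 C0).
have -> : F (k *: u + v) - (conjc k * F u + F v) =
    (F (k *: u + v) - B f (k *: u + v)) - conjc k * (F u - B f u) - (F v - B f v).
  by rewrite (psd_antilinear pB); ring.
have nB (x y : R[i]) : normc (x - y) <= normc x + normc y.
  by rewrite (le_trans (le_normcD _ _))// normcN.
have nk : normc (conjc k) = normc k by case: (k) => a b /=; rewrite sqrrN.
rewrite (le_trans (nB _ _))// (le_trans (lerD (nB _ _) (lexx _)))// normcM nk.
rewrite (@le_trans _ _ (e / C * sn (k *: u + v) + normc k * (e / C * sn u) + e / C * sn v))//.
  by rewrite !lerD// ler_wpM2l ?normc_ge0.
have -> : e / C * sn (k *: u + v) + normc k * (e / C * sn u) + e / C * sn v =
  e / C * (C - 1) by rewrite /C; ring.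
by rewrite mulrAC ler_pdivrMr// ler_pM2l// gerBl.
Qed.

(** Functionals cannot be paired directly; their inner product is the limit of [B f g] over
    approximants [f] and [g] of a common tolerance. *)
Definition ip_lim F G (l : R[i]) := forall e, 0 < e -> exists2 d, 0 < d &
  forall f g, approx F d f -> approx G d g -> normc (l - B f g) <= e.

Lemma approxW F d e f : d <= e -> approx F d f -> approx F e f.
Proof. by move=> de H g; rewrite (le_trans (H g))// ler_wpM2r ?sn_ge0. Qed.

Lemma ip_cauchy F G : in_compl F -> in_compl G -> forall e, 0 < e ->
  exists2 d, 0 < d & forall f f' g g', approx F d f -> approx F d f' ->
    approx G d g -> approx G d g' -> normc (B f g - B f' g') <= e.
Proof.
move=> FP GP e e0.
have [f1 f1P] := FP 1 ltr01; have [g1 g1P] := GP 1 ltr01.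
pose C := sn f1 + 2 + (sn g1 + 2).
have C0 : 0 < C by have := sn_ge0 B f1; have := sn_ge0 B g1; rewrite /C; lra.
exists (Num.min 1 (e / (2 * C))) => [|f f' g g' fP f'P gP g'P].
  by rewrite lt_min ltr01 divr_gt0// mulr_gt0.
set d := Num.min _ _ in fP f'P gP g'P.
have d1 : d <= 1 by rewrite ge_min lexx.
have d0 : 0 < d by rewrite lt_min ltr01 divr_gt0// mulr_gt0.
have dC : d * (2 * C) <= e.
  by rewrite -ler_pdivlMr ?mulr_gt0// ge_min lexx orbT.
have sf : sn f' <= sn f1 + 2 := approx_bounded d1 (ltW d0) f1P f'P.
have sg : sn g <= sn g1 + 2 := approx_bounded d1 (ltW d0) g1P gP.
have dd : 0 <= d + d by rewrite addr_ge0// ltW.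
have sff := approx_sub dd fP f'P.
have sgg := approx_sub dd gP g'P.
rewrite (le_trans (normc_dist (B f' g) _ _))// -(psdBl pB) -(psdBr pB).
rewrite (le_trans (lerD (sn_CS pB _ _) (sn_CS pB _ _)))// (le_trans _ dC)//.
rewrite (@le_trans _ _ ((d + d) * (sn g1 + 2) + (sn f1 + 2) * (d + d)))//; last first.
  by rewrite /C le_eqVlt; apply/orP; left; apply/eqP; ring.
by rewrite lerD// ler_pM// ?sn_ge0.
Qed.

Lemma ip_ex F G : in_compl F -> in_compl G -> exists l, ip_lim F G l.
Proof.
have i0 (n : nat) : 0 < n.+1%:R^-1 :> R by rewrite invr_gt0.
move=> FP GP; have [f fP] := choice (fun n => FP _ (i0 n)).
have [g gP] := choice (fun n => GP _ (i0 n)).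
have [|l lP] := @cauchy_complex R (fun n => B (f n) (g n)).
  move=> e e0; have e20 : 0 < e / 2 by rewrite divr_gt0.
  have [d d0 dP] := ip_cauchy FP GP e20.
  have [N NP] := inv_nat_small d0; exists N => m n Nm Nn.
  rewrite (@le_lt_trans _ _ (e / 2))//; last by rewrite ltr_pdivrMr// ltr_pMr// ltr1n.
  by apply: dP; (apply: approxW (ltW (NP _ _)) _; [|exact: fP||exact: gP]).
exists l => e e0; have e20 : 0 < e / 2 by rewrite divr_gt0.
have [d d0 dP] := ip_cauchy FP GP e20.
exists d => // f' g' f'P g'P.
have [N NP] := inv_nat_small d0; have [M MP] := lP _ e20.
pose n := maxn N M.
rewrite (le_trans (normc_dist (B (f n) (g n)) _ _))// (splitr e) lerD//.
  by rewrite normcC ltW// MP// leq_maxr.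
apply: dP => //; apply: approxW (ltW (NP n (leq_maxl _ _))) _; [exact: fP|exact: gP].
Qed.

Lemma ip_uniq F G l l' : in_compl F -> in_compl G ->
  ip_lim F G l -> ip_lim F G l' -> l = l'.
Proof.
move=> FP GP lP l'P; apply: normc_eq_of => e e0.
have e20 : 0 < e / 2 by rewrite divr_gt0.
have [d d0 dP] := lP _ e20; have [d' d'0 d'P] := l'P _ e20.
have m0 : 0 < Num.min d d' by rewrite lt_min d0.
have [f fP] := FP _ m0; have [g gP] := GP _ m0.
rewrite (le_trans (normc_dist (B f g) _ _))// (splitr e) lerD//.
  by apply: dP; [apply: approxW fP|apply: approxW gP]; rewrite ge_min lexx.
by rewrite normcC; apply: d'P; [apply: approxW fP|apply: approxW gP];
  rewrite ge_min lexx orbT.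
Qed.

Lemma ip_limC F G l : ip_lim F G l -> ip_lim G F (conjc l).
Proof.
move=> H e /H[d d0 dP]; exists d => // f g fP gP.
rewrite (psd_herm pB g f) -rmorphB.
have -> : normc (conjc (l - B g f)) = normc (l - B g f).
  by case: (l - B g f) => a b /=; rewrite sqrrN.
exact: dP.
Qed.

Lemma approx_lin F F' k d f f' : 0 <= d -> approx F d f -> approx F' d f' ->
  approx (fun x => k * F x + F' x) ((normc k + 1) * d) (k *: f + f').
Proof.
move=> d0 fP f'P g; rewrite (psdDl pB) (psdZl pB).
have -> : k * F g + F' g - (k * B f g + B f' g) =
  k * (F g - B f g) + (F' g - B f' g) by ring.
rewrite (le_trans (le_normcD _ _))// normcM mulrDl mul1r mulrDl lerD//.
by rewrite -mulrA ler_wpM2l ?normc_ge0.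
Qed.

Lemma in_compl_lin F F' k : in_compl F -> in_compl F' ->
  in_compl (fun x => k * F x + F' x).
Proof.
move=> FP F'P e e0; have k0 : 0 < normc k + 1 by rewrite ltr_pwDr// normc_ge0.
have d0 := divr_gt0 e0 k0.
have [f fP] := FP _ d0; have [f' f'P] := F'P _ d0; exists (k *: f + f').
by have := approx_lin k (ltW d0) fP f'P; rewrite mulrCA divff ?mulr1// gt_eqF.
Qed.

(** The combination has some limit by [ip_ex], so it is enough to compare that limit with
    [k * l + l'] on one choice of approximants. *)
Lemma ip_lim_lin F F' G k l l' : in_compl F -> in_compl F' -> in_compl G ->
  ip_lim F G l -> ip_lim F' G l' ->
  ip_lim (fun x => k * F x + F' x) G (k * l + l').
Proof.
move=> FP F'P GP lP l'P.
have [m mP] := ip_ex (in_compl_lin k FP F'P) GP.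
suff -> : k * l + l' = m by [].
have k0 : 0 < normc k + 1 by rewrite ltr_pwDr// normc_ge0.
apply: normc_eq_of => e e0; pose r := e / (2 * (normc k + 1)).
have r0 : 0 < r by rewrite divr_gt0// mulr_gt0.
have e20 : 0 < e / 2 by rewrite divr_gt0.
have [d1 d10 d1P] := lP _ r0; have [d2 d20 d2P] := l'P _ r0.
have [d3 d30 d3P] := mP _ e20.
pose d := Num.min (Num.min d1 d2) (d3 / (normc k + 1)).
have d0 : 0 < d by rewrite !lt_min d10 d20 divr_gt0.
have [dd1 dd2] : d <= d1 /\ d <= d2 by rewrite !ge_min !lexx !orbT.
have dd3 : d <= d3 / (normc k + 1) by rewrite !ge_min lexx orbT.
have dd3' : (normc k + 1) * d <= d3 by rewrite mulrC -ler_pdivlMr.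
have ddG : d <= d3.
  by rewrite (le_trans _ dd3')// mulrDl mul1r lerDr mulr_ge0 ?normc_ge0// ltW.
have [f fP] := FP _ d0; have [f' f'P] := F'P _ d0; have [g gP] := GP _ d0.
have := d3P _ g (approxW dd3' (approx_lin k (ltW d0) fP f'P)) (approxW ddG gP).
rewrite (psdDl pB) (psdZl pB) => H3.
rewrite (le_trans (normc_dist (k * B f g + B f' g) _ _))// (splitr e) lerD//; last by rewrite normcC.
have -> : k * l + l' - (k * B f g + B f' g) = k * (l - B f g) + (l' - B f' g) by ring.
rewrite (le_trans (le_normcD _ _))// normcM.
have -> : e / 2 = normc k * r + r by rewrite /r; field; rewrite gt_eqF.
rewrite lerD ?ler_wpM2l ?normc_ge0//.
  by apply: d1P; [exact: approxW fP|exact: approxW gP].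
by apply: d2P; [exact: approxW f'P|exact: approxW gP].
Qed.

Lemma approx_B f d : 0 <= d -> approx (B f) d f.
Proof. by move=> d0 g; rewrite subrr normc0 mulr_ge0 ?sn_ge0. Qed.

Lemma in_compl_B f : in_compl (B f).
Proof. by move=> e e0; exists f; apply: approx_B; exact: ltW. Qed.

(** Reproducing property: pairing with the functional of [g] is evaluation at [g]. It ties the inner
    product of the completion to values of functionals. *)
Lemma ip_lim_B F g : in_compl F -> ip_lim F (B g) (F g).
Proof.
move=> FP; have [l lP] := ip_ex FP (in_compl_B g).
suff -> : F g = l by [].
apply: normc_eq_of => e e0; have e20 : 0 < e / 2 by rewrite divr_gt0.
have [d d0 dP] := lP _ e20.
have s0 : 0 < sn g + 1 by rewrite ltr_pwDr// sn_ge0.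
pose r := Num.min d (e / 2 / (sn g + 1)).
have r0 : 0 < r by rewrite lt_min d0 !divr_gt0.
have rd : r <= d by rewrite ge_min lexx.
have [f fP] := FP _ r0.
rewrite (le_trans (normc_dist (B f g) _ _))// (splitr e) lerD//.
  rewrite (le_trans (fP g))// (@le_trans _ _ (r * (sn g + 1)))//.
    by rewrite ler_wpM2l ?ltW// ltrDl.
  by rewrite -ler_pdivlMr// ge_min lexx orbT.
rewrite normcC; apply: dP; first exact: approxW fP.
by apply: approx_B; exact: ltW.
Qed.

Lemma ip_lim_ge0 F l : in_compl F -> ip_lim F F l -> 0 <= l.
Proof.
move=> FP lP; have H e : 0 < e -> `|Im l| <= e /\ - e <= Re l.
  move=> e0; have [d d0 dP] := lP _ e0; have [f fP] := FP _ d0.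
  have := dP _ _ fP fP => lf.
  have := Im_le_normc (l - B f f); have := Re_le_normc (l - B f f).
  rewrite ReB ImB (psd_real pB) subr0.
  have := psdRe_ge0 pB f => r0 /le_trans/(_ lf) + /le_trans/(_ lf) ->.
  by rewrite ler_norml; split=> //; lra.
have i0 : Im l = 0.
  apply/eqP; rewrite -normr_le0; apply/ler_addgt0Pl => e /H[He _].
  by rewrite addr0.
rewrite lecE/= i0 eqxx/=; apply/ler_addgt0Pl => e /H[_ He]; lra.
Qed.

End Completion.

Section CompletionType.
Variable R : realType.
Local Open Scope complex_scope.
Variables (E : lmodType R[i]) (B : E -> E -> R[i]) (pB : psd_form B).

(** The positivity proof is an argument of the type, so that the structures built from it can be
    inferred from the type. *)
Definition completion of psd_form B : Type := {F : E -> R[i] | in_compl B F}.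

Local Notation H := (completion pB).
Implicit Types F G : H.

Definition cfun F : E -> R[i] := sval F.
Coercion cfun : completion >-> Funclass.

Lemma cfunP F : in_compl B F. Proof. exact: (svalP F). Qed.

Lemma completion_eqP F G : (forall g, F g = G g) -> F = G.
Proof.
move=> FG; have : cfun F = cfun G by apply/funext.
case: F G {FG} => [F FP] [G GP] /= E'; case: _ / E' GP => GP.
by congr exist; exact: Prop_irrelevance.
Qed.

HB.instance Definition _ := gen_eqMixin H.
HB.instance Definition _ := gen_choiceMixin H.

Definition clc (k : R[i]) F G : H :=
  exist _ _ (in_compl_lin pB k (cfunP F) (cfunP G)).

Lemma in_compl0 : in_compl B (fun=> 0 : R[i]).
Proof.
move=> e e0; exists 0 => g; rewrite sub0r normcN.
by rewrite (clin0 (psd_linear pB g)) normc0 mulr_ge0 ?sn_ge0// ltW.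
Qed.
Definition czero : H := exist _ _ in_compl0.
Definition cadd F G := clc 1 F G.
Definition cscale k F := clc k F czero.
Definition copp F := cscale (-1) F.

Lemma caddE F G g : cadd F G g = F g + G g.
Proof. by rewrite /= mul1r. Qed.
Lemma cscaleE k F g : cscale k F g = k * F g.
Proof. by rewrite /= addr0. Qed.

Lemma caddA : associative cadd.
Proof. by move=> F G L; apply: completion_eqP => g; rewrite !caddE addrA. Qed.
Lemma caddC : commutative cadd.
Proof. by move=> F G; apply: completion_eqP => g; rewrite !caddE addrC. Qed.
Lemma cadd0 : left_id czero cadd.
Proof. by move=> F; apply: completion_eqP => g; rewrite !caddE add0r. Qed.
Lemma caddN : left_inverse czero copp cadd.
Proof.
by move=> F; apply: completion_eqP => g; rewrite caddE cscaleE mulN1r addNr.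
Qed.

HB.instance Definition _ := GRing.isZmodule.Build H caddA caddC cadd0 caddN.

Lemma cscaleA a b F : cscale a (cscale b F) = cscale (a * b) F.
Proof. by apply: completion_eqP => g; rewrite !cscaleE mulrA. Qed.
Lemma cscale1 : left_id 1 cscale.
Proof. by move=> F; apply: completion_eqP => g; rewrite cscaleE mul1r. Qed.
Lemma cscaleDr : right_distributive cscale +%R.
Proof.
move=> k F G; apply: completion_eqP => g.
by rewrite cscaleE !caddE mulrDr !cscaleE.
Qed.
Lemma cscaleDl F : {morph cscale^~ F : a b / a + b}.
Proof.
move=> a b; apply: completion_eqP => g.
by rewrite cscaleE !caddE mulrDl !cscaleE.
Qed.

HB.instance Definition _ :=
  GRing.Zmodule_isLmodule.Build R[i] H cscaleA cscale1 cscaleDr cscaleDl.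

Definition cip F G : R[i] := sval (cid (ip_ex pB (cfunP F) (cfunP G))).

Lemma cipP F G : ip_lim B F G (cip F G).
Proof. exact: (svalP (cid (ip_ex pB (cfunP F) (cfunP G)))). Qed.

Lemma cip_uniq F G l : ip_lim B F G l -> cip F G = l.
Proof. by move=> lP; exact: (ip_uniq (cfunP F) (cfunP G) (cipP F G) lP). Qed.

Lemma cipC F G : cip G F = conjc (cip F G).
Proof. by apply: cip_uniq; apply: ip_limC; [exact: pB|exact: cipP]. Qed.

Lemma cip_lin k F F' G : cip (k *: F + F') G = k * cip F G + cip F' G.
Proof.
apply: cip_uniq.
have := ip_lim_lin pB k (cfunP F) (cfunP F') (cfunP G) (cipP F G) (cipP F' G).
congr (ip_lim B _ _ _); apply/funext => g.
by rewrite [RHS]caddE [X in _ = X + _]cscaleE.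
Qed.

Lemma cip_psd : psd_form cip.
Proof.
split=> [G k u v|u k v w|u].
- exact: cip_lin.
- by rewrite [LHS]cipC cip_lin [cip u v]cipC [cip u w]cipC rmorphD rmorphM.
- exact: (ip_lim_ge0 pB (cfunP u) (cipP u u)).
Qed.

Definition cemb (f : E) : H := exist _ _ (in_compl_B B f).

Lemma cip_emb F g : cip F (cemb g) = F g.
Proof. by apply: cip_uniq; apply: ip_lim_B => //; exact: cfunP. Qed.

Lemma cip_eq0 F : cip F F = 0 -> F = 0.
Proof.
move=> F0; apply: completion_eqP => g; rewrite -cip_emb.
have := psd_cauchy_schwarz cip_psd F (cemb g); rewrite F0 mul0r => H.
apply: eq0_normc; apply/eqP; rewrite -sqrf_eq0 eq_le H.
by rewrite exprn_ge0 ?normc_ge0.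
Qed.

Definition cnorm F : R[i] := (sn cip F)%:C.

Lemma ler_cnormD F G : cnorm (F + G) <= cnorm F + cnorm G.
Proof. by rewrite -rmorphD/= lecR; exact: (snD cip_psd). Qed.

Lemma cnormZ k F : cnorm (k *: F) = `|k| * cnorm F.
Proof. by rewrite normc_norm -rmorphM; congr _%:C; exact: (snZ cip_psd). Qed.

Lemma cnorm0_eq0 F : cnorm F = 0 -> F = 0.
Proof.
move=> /complexI F0; apply: cip_eq0.
by rewrite (psdE cip_psd) -(sn_sq cip_psd) F0 expr0n.
Qed.

HB.instance Definition _ := Lmodule_isNormed.Build R[i] H ler_cnormD cnormZ cnorm0_eq0.

Lemma nr_cip F : nr F = sn cip F. Proof. by []. Qed.

Lemma nr_cemb f : nr (cemb f) = sn B f.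
Proof. by rewrite nr_cip /sn cip_emb. Qed.

(** The dual estimate passes to the norm: a close approximant [g] of [G] has seminorm at most
    [d + r], and the square of this seminorm differs from the squared norm of [G] by at most [r]. *)
Lemma approx_nr F d f : 0 <= d -> approx B F d f -> nr (F - cemb f) <= d.
Proof.
move=> d0 fP; pose G : H := F - cemb f; rewrite -/G.
have GE g : G g = F g - B f g.
  by rewrite -[LHS]cip_emb (psdBl cip_psd) !cip_emb.
rewrite -(@ler_pXn2r _ 2) ?nnegrE ?nr_ge0// nr_cip (sn_sq cip_psd).
apply/ler_addgt0Pl => e e0.
(* For [r <= 1], [(d + r) ^+ 2 + r] exceeds [d ^+ 2] by at most [K * r]. *)
pose K := 2 * d + 2; have K0 : 0 < K by rewrite /K; lra.
pose r := Num.min 1 (e / K); have r0 : 0 < r by rewrite lt_min ltr01 divr_gt0.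
have r1 : r <= 1 by rewrite ge_min lexx.
have rK : K * r <= e by rewrite mulrC -ler_pdivlMr// ge_min lexx orbT.
have [d1 d10 d1P] := cipP G G r0.
have m0 : 0 < Num.min d1 r by rewrite lt_min d10.
have [g gP] := cfunP G m0.
have mr : Num.min d1 r <= r by rewrite ge_min lexx orbT.
have md : Num.min d1 r <= d1 by rewrite ge_min lexx.
have sg : sn B g <= d + r.
  have [->|s0] := eqVneq (sn B g) 0; first by rewrite addr_ge0// ltW.
  have {}s0 : 0 < sn B g by rewrite lt_def s0 sn_ge0.
  rewrite -(ler_pM2r s0) -expr2 (sn_sq pB) (le_trans (ler_norm _))//.
  rewrite (le_trans (Re_le_normc _))// -[B g g](subrK (G g)).
  rewrite (le_trans (le_normcD _ _))// addrC mulrDl lerD//.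
    by rewrite GE fP.
  by rewrite normcC (le_trans (gP g))// ler_wpM2r ?sn_ge0.
have lg := d1P _ _ (approxW md gP) (approxW md gP).
have : Re (cip G G) <= Re (B g g) + r.
  rewrite -lerBlDl -ReB (le_trans (ler_norm _))//.
  exact: le_trans (Re_le_normc _) _.
rewrite -(sn_sq pB) => H; rewrite (le_trans H)//.
have : sn B g ^+ 2 <= (d + r) ^+ 2.
  by rewrite ler_pXn2r// nnegrE ?sn_ge0// addr_ge0// ltW.
rewrite /K in rK; nra.
Qed.

(** The filter is replaced by a sequence of vectors of [E] with errors 1 / (n + 1). These converge
    pointwise as functionals, and the uniform estimate [LA] puts the limit in the completion. *)
Lemma completion_complete (FF : set_system H) :
  ProperFilter FF -> cauchy FF -> cvg FF.
Proof.
move=> PF /cauchyP cF.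
have i0 (n : nat) : 0 < n.+1%:R^-1 :> R by rewrite invr_gt0.
have i0' (n : nat) : 0 < (n.+1%:R^-1)%:C :> R[i] by rewrite ltcR.
have [F FP] := choice (fun n => cF _ (i0' n)).
have [f fP] := choice (fun n => cfunP (F n) (i0 n)).
have FfP n : nr (F n - cemb (f n)) <= n.+1%:R^-1 by apply: approx_nr => //; exact: ltW.
have FF' m n : nr (F m - F n) <= m.+1%:R^-1 + n.+1%:R^-1.
  have [G [Gm Gn]] := @filter_ex _ FF PF _ (filterI (FP m) (FP n)).
  rewrite (le_trans (nr_dist G _ _))// lerD//.
    by move: Gm; rewrite -ball_normE/= nrE ltcR => /ltW.
  by move: Gn; rewrite -ball_normE/= nrE ltcR nrC => /ltW.
have ff m n : sn B (f m - f n) <= 2 * m.+1%:R^-1 + 2 * n.+1%:R^-1.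
  have -> : sn B (f m - f n) = nr (cemb (f m) - cemb (f n)).
    rewrite -nr_cemb; congr nr; apply: completion_eqP => g.
    by rewrite -[RHS]cip_emb (psdBl cip_psd) !cip_emb [LHS](psdBl pB).
  rewrite (le_trans (nr_dist (F m) _ _))// (nrC _ (F m)).
  have := le_trans (nr_dist (F n) (F m) (cemb (f n))) (lerD (FF' m n) (FfP n)).
  by move: (FfP m); move: (m.+1%:R^-1) (n.+1%:R^-1) => a b; lra.
have sm (e : R) : 0 < e -> exists N, forall n, (N <= n)%N -> 2 * n.+1%:R^-1 < e.
  move=> e0; have [N NP] := inv_nat_small (divr_gt0 e0 (ltr0n R 2)).
  by exists N => n /NP; rewrite ltr_pdivlMr// mulrC.
have lim_ex g : exists l : R[i], forall e : R, 0 < e ->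
    exists N, forall n, (N <= n)%N -> normc (B (f n) g - l) < e.
  apply: cauchy_complex => e e0.
  have s0 : 0 < sn B g + 1 by rewrite ltr_pwDr// sn_ge0.
  have [N NP] := sm (e / (sn B g + 1) / 2) (divr_gt0 (divr_gt0 e0 s0) (ltr0n R 2)).
  exists N => m n /NP Nm /NP Nn.
  rewrite -(psdBl pB) (le_lt_trans (sn_CS pB _ _))//.
  rewrite (@le_lt_trans _ _ (sn B (f m - f n) * (sn B g + 1)))//.
    by rewrite ler_wpM2l ?sn_ge0// lerDl.
  rewrite -ltr_pdivlMr// (le_lt_trans (ff m n))//.
  by rewrite (splitr (e / _)) ltrD.
have [L LP] := choice lim_ex.
have LA n : approx B L (2 * n.+1%:R^-1) (f n).
  move=> g; apply/ler_addgt0Pl => e e0.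
  have e20 : 0 < e / 2 by rewrite divr_gt0.
  have [N1 N1P] := LP g _ e20.
  have s0 : 0 < sn B g + 1 by rewrite ltr_pwDr// sn_ge0.
  have [N2 N2P] := sm (e / 2 / (sn B g + 1)) (divr_gt0 e20 s0).
  pose m := maxn N1 N2.
  have H1 := N1P m (leq_maxl _ _); have H2 := N2P m (leq_maxr _ _).
  have H3 : normc (B (f m) g - B (f n) g) <=
      (2 * m.+1%:R^-1 + 2 * n.+1%:R^-1) * sn B g.
    by rewrite -(psdBl pB) (le_trans (sn_CS pB _ _))// ler_wpM2r ?sn_ge0.
  rewrite ltr_pdivlMr// in H2.
  have H4 : 0 <= 2 * m.+1%:R^-1 :> R by rewrite mulr_ge0.
  have := normc_dist (B (f m) g) (L g) (B (f n) g); rewrite (normcC (L g) (B (f m) g)).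
  rewrite mulrDl in H3; rewrite mulrDr mulr1 in H2.
  by move: (2 * m.+1%:R^-1) (2 * n.+1%:R^-1) H1 H2 H3 H4 => a b; lra.
have LC : in_compl B L.
  move=> e /sm[N /(_ N (leqnn _)) NP]; exists (f N).
  by apply: approxW (LA N); exact: ltW.
pose L' : H := exist _ L LC.
apply/cvg_ex; exists L'; apply/cvg_ballP => _ /complex_gt0[e e0 ->].
have [N /(_ N (leqnn _)) NP] := sm (e / 2) (divr_gt0 e0 (ltr0n R 2)).
apply: filterS (FP N) => G; rewrite -!ball_normE/= !nrE !ltcR => H1.
have H2 : nr (L' - cemb (f N)) <= 2 * N.+1%:R^-1.
  by apply: approx_nr; [rewrite mulr_ge0|exact: LA].
have := FfP N; have := nr_dist (cemb (f N)) L' G.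
have := nr_dist (F N) (cemb (f N)) G; rewrite (nrC (cemb (f N)) (F N)).
by move: NP H2 H1; move: (N.+1%:R^-1) (i0 N) => a; lra.
Qed.

HB.instance Definition _ := Uniform_isComplete.Build H completion_complete.

Lemma cip_bilinear : bilinear_for ( *%R : R[i] -> R[i] -> R[i]) (Num.conj \; *%R) cip.
Proof.
split=> [G k u v|u k v w]; first exact: cip_lin.
by rewrite (psd_antilinear cip_psd).
Qed.

HB.instance Definition _ := bilinear_isBilinear.Build R[i] H H R[i]
  (GRing.Scale.Law.clone _ _ ( *%R ) _)
  (GRing.Scale.Law.clone _ _ ((Num.conj : R[i] -> R[i]) \; *%R ) _)
  cip cip_bilinear.

Lemma cip_herm (F G : H) : cip F G = (-1) ^+ false * Num.conj (cip G F).
Proof. by rewrite expr0 mul1r cipC. Qed.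

HB.instance Definition _ := @isHermitianSesquilinear.Build R[i] H false
  (@Num.conj R[i]) cip cip_herm.

Lemma cip_gt0 (F : H) : F != 0 -> 0 < cip F F.
Proof.
move=> F0; rewrite lt_def (psd_ge0 cip_psd) andbT.
by apply: contra_neq F0; exact: cip_eq0.
Qed.

HB.instance Definition _ := isDotProduct.Build R[i] H cip cip_gt0.

Lemma cnormE (F : H) : `|F| ^+ 2 = cip F F.
Proof. by rewrite (psdE cip_psd) -(sn_sq cip_psd) rmorphXn. Qed.

HB.instance Definition _ := isHilbert.Build R[i] H cnormE.

Definition completion_hilbert : hilbertType R[i] := H.

End CompletionType.

(** * Extension of adjointable operators to the completion *)

Section AdjointableOperators.
Variable R : realType.
Local Open Scope complex_scope.
Variables (E : lmodType R[i]) (B : E -> E -> R[i]) (pB : psd_form B).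
Local Notation H := (completion_hilbert pB).

(** The adjoint and its bound belong to the data: the operator will act on functionals through its
    adjoint, and the dual operator has to be of the same kind. *)
Record adj_op := AdjOp {
  aop : E -> E ;
  aadj : E -> E ;
  aopP : forall f g, B (aop f) g = B f (aadj g) ;
  aconst : R ;
  aconst_ge0 : 0 <= aconst ;
  aop_bound : forall f, sn B (aop f) <= aconst * sn B f ;
  aadj_bound : forall f, sn B (aadj f) <= aconst * sn B f }.

Lemma aadjP (T : adj_op) f g : B (aadj T f) g = B f (aop T g).
Proof. by rewrite (psd_herm pB g) -aopP (psd_herm pB f (aop T g)) conjcK. Qed.

Definition adj_dual (T : adj_op) : adj_op :=
  AdjOp (aadjP T) (aconst_ge0 T) (aadj_bound T) (aop_bound T).

Lemma approx_aop (T : adj_op) (F : E -> R[i]) d f : approx B F d f ->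
  approx B (F \o aadj T) (d * aconst T) (aop T f).
Proof.
move=> fP g; rewrite aopP (le_trans (fP _))// -mulrA.
(* The sign of [d] is free: a negative [d] forces all seminorms to vanish. *)
have [->|s0] := eqVneq (sn B (aadj T g)) 0.
  have := fP (aadj T g); have [s|s] := eqVneq (sn B g) 0; first by rewrite s !mulr0.
  have [d0|d0] := leP 0 d; first by rewrite mulr0 !mulr_ge0 ?aconst_ge0 ?sn_ge0.
  have := fP g; have sg : 0 < sn B g by rewrite lt_def s sn_ge0.
  move=> /(le_trans (normc_ge0 _)); rewrite pmulr_lge0// leNgt d0//.
have {}s0 : 0 < sn B (aadj T g) by rewrite lt_def s0 sn_ge0.
have d0 : 0 <= d.
  by have := le_trans (normc_ge0 _) (fP (aadj T g)); rewrite pmulr_lge0.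
by rewrite ler_wpM2l// aadj_bound.
Qed.

Lemma in_compl_aop (T : adj_op) (F : E -> R[i]) : in_compl B F -> in_compl B (F \o aadj T).
Proof.
move=> FP e e0; have c0 : 0 < aconst T + 1 by rewrite ltr_pwDr// aconst_ge0.
have [f fP] := FP _ (divr_gt0 e0 c0); exists (aop T f).
apply: approxW (approx_aop T fP).
by rewrite mulrAC ler_pdivrMr// ler_pM2l// lerDl.
Qed.

(* An adjointable operator acts on the antidual by composition with its
   adjoint. *)
Definition clift (T : adj_op) (F : H) : H := exist _ _ (in_compl_aop T (cfunP F)).

Definition ceval (F : H) : E -> R[i] := cfun (F : completion pB).

Lemma cliftE T F g : ceval (clift T F) g = ceval F (aadj T g). Proof. by []. Qed.

Lemma completion_addE (F G : H) g : ceval (F + G) g = ceval F g + ceval G g.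
Proof. exact: caddE. Qed.

Lemma completion_scaleE k (F : H) g : ceval (k *: F) g = k * ceval F g.
Proof. exact: cscaleE. Qed.

Lemma completion_fun_eq (F G : H) : (forall g, ceval F g = ceval G g) -> F = G.
Proof. exact: completion_eqP. Qed.

Lemma clift_linear T : linear (clift T).
Proof.
move=> k F G; apply: completion_fun_eq => g.
by rewrite !(cliftE, completion_addE, completion_scaleE).
Qed.

Lemma clift_bound T (F : H) : nr (clift T F) <= aconst T * nr F.
Proof.
apply/ler_addgt0Pl => e e0; have c0 := aconst_ge0 T.
pose d := e / (2 * (aconst T + 1)).
have c1 : 0 < aconst T + 1 by rewrite ltr_pwDr.
have d0 : 0 < d by rewrite divr_gt0// mulr_gt0.
have [f fP] := cfunP F d0.
have H1 : nr (F - cemb pB f) <= d by apply: approx_nr => //; exact: ltW.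
have H2 : nr (clift T F - cemb pB (aop T f)) <= d * aconst T.
  by apply: approx_nr; [rewrite mulr_ge0// ltW|exact: approx_aop].
have H3 : nr (cemb pB (aop T f)) <= aconst T * nr (cemb pB f).
  by rewrite !nr_cemb aop_bound.
have H4 : nr (cemb pB f) <= nr F + d.
  rewrite -[cemb pB f](subrK F) addrC (le_trans (nrD _ _))// lerD2l.
  by rewrite nrC.
have H5 : nr (clift T F) <= d * aconst T + aconst T * nr (cemb pB f).
  rewrite -[clift T F](subrK (cemb pB (aop T f))) (le_trans (nrD _ _))//.
  exact: lerD.
have dE : 2 * (aconst T + 1) * d = e by rewrite /d mulrC divfK// gt_eqF// mulr_gt0.
rewrite (le_trans H5)// -dE.
have : aconst T * nr (cemb pB f) <= aconst T * (nr F + d) by rewrite ler_wpM2l.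
by rewrite mulrDr; move: (aconst T * nr _) => X; nra.
Qed.

Lemma clift_bounded T : bounded_op (clift T).
Proof.
split; first exact: clift_linear.
by exists (aconst T)%:C => F; rewrite !nrE -rmorphM lecR clift_bound.
Qed.

Lemma clift_adjoint T : is_adjoint (clift T) (clift (adj_dual T)).
Proof.
move=> F G; apply: normc_eq_of => e e0; have e20 : 0 < e / 2 by rewrite divr_gt0.
have [d1 d10 d1P] := cipP (clift T F) G e20.
have [d2 d20 d2P] := cipP F (clift (adj_dual T) G) e20.
have c1 : 0 < aconst T + 1 by rewrite ltr_pwDr// aconst_ge0.
pose d := Num.min d1 d2 / (aconst T + 1).
have m0 : 0 < Num.min d1 d2 by rewrite lt_min d10.
have d0 : 0 < d by rewrite divr_gt0.
have dc : d * aconst T <= Num.min d1 d2.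
  by rewrite /d mulrAC ler_pdivrMr// ler_pM2l// lerDl.
have dd : d <= Num.min d1 d2.
  by rewrite /d ler_pdivrMr// mulrDr mulr1 lerDr mulr_ge0 ?aconst_ge0 ?ltW.
have [m1 m2] : Num.min d1 d2 <= d1 /\ Num.min d1 d2 <= d2.
  by rewrite !ge_min !lexx orbT.
have [f fP] := cfunP F d0; have [g gP] := cfunP G d0.
have H1 := d1P _ _ (approxW (le_trans dc m1) (approx_aop T fP)) (approxW (le_trans dd m1) gP).
have H2 := d2P _ _ (approxW (le_trans dd m2) fP)
  (approxW (le_trans dc m2) (approx_aop (adj_dual T) gP)).
rewrite (le_trans (normc_dist (B (aop T f) g) _ _))// (splitr e) lerD//.
by rewrite aopP normcC.
Qed.

Lemma clift_emb T f : clift T (cemb pB f) = cemb pB (aop T f).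
Proof. by apply: completion_fun_eq => g; rewrite cliftE /ceval/= aopP. Qed.

Lemma inner_emb (F : H) f : inner F (cemb pB f) = ceval F f.
Proof. exact: cip_emb. Qed.

End AdjointableOperators.

(** * The Fock representation of a state *)

Section FinitelySupported.
Variable R : realType.
Local Open Scope complex_scope.
Variables (I : eqType) (A : lmodType R[i]).

Definition finsupp (f : I -> A) := exists s : seq I, forall x, x \notin s -> f x = 0.

Definition ffsupp : Type := {f : I -> A | finsupp f}.
Definition ffun_of (f : ffsupp) : I -> A := sval f.
Coercion ffun_of : ffsupp >-> Funclass.
Implicit Types f g : ffsupp.

Lemma ffsupp_eqP f g : (forall x, f x = g x) -> f = g.
Proof.
move=> fg; have : ffun_of f = ffun_of g by apply/funext.
case: f g {fg} => [f fP] [g gP] /= E'; case: _ / E' gP => gP.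
by congr exist; exact: Prop_irrelevance.
Qed.

HB.instance Definition _ := gen_eqMixin ffsupp.
HB.instance Definition _ := gen_choiceMixin ffsupp.

Lemma finsupp0 : finsupp (fun=> 0 : A). Proof. by exists [::]. Qed.

Lemma finsuppD f g : finsupp (fun x => f x + g x).
Proof.
have [[s sP] [t tP]] := (svalP f, svalP g).
exists (s ++ t) => x; rewrite mem_cat negb_or => /andP[/sP fx /tP gx].
by rewrite [f x]fx [g x]gx addr0.
Qed.

Lemma finsuppZ (k : R[i]) f : finsupp (fun x => k *: f x).
Proof. by have [s sP] := svalP f; exists s => x /sP fx; rewrite [f x]fx scaler0. Qed.

Definition ff0 : ffsupp := exist _ _ finsupp0.
Definition ffD f g : ffsupp := exist _ _ (finsuppD f g).
Definition ffZ k f : ffsupp := exist _ _ (finsuppZ k f).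
Definition ffN f := ffZ (-1) f.

Lemma ffDA : associative ffD.
Proof. by move=> f g h; apply: ffsupp_eqP => x /=; rewrite addrA. Qed.
Lemma ffDC : commutative ffD.
Proof. by move=> f g; apply: ffsupp_eqP => x /=; rewrite addrC. Qed.
Lemma ffD0 : left_id ff0 ffD.
Proof. by move=> f; apply: ffsupp_eqP => x /=; rewrite add0r. Qed.
Lemma ffDN : left_inverse ff0 ffN ffD.
Proof. by move=> f; apply: ffsupp_eqP => x /=; rewrite scaleN1r addNr. Qed.

HB.instance Definition _ := GRing.isZmodule.Build ffsupp ffDA ffDC ffD0 ffDN.

Lemma ffZA a b f : ffZ a (ffZ b f) = ffZ (a * b) f.
Proof. by apply: ffsupp_eqP => x /=; rewrite scalerA. Qed.
Lemma ffZ1 : left_id 1 ffZ.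
Proof. by move=> f; apply: ffsupp_eqP => x /=; rewrite scale1r. Qed.
Lemma ffZDr : right_distributive ffZ +%R.
Proof. by move=> k f g; apply: ffsupp_eqP => x /=; rewrite scalerDr. Qed.
Lemma ffZDl f : {morph ffZ^~ f : a b / a + b}.
Proof. by move=> a b; apply: ffsupp_eqP => x /=; rewrite scalerDl. Qed.

HB.instance Definition _ := GRing.Zmodule_isLmodule.Build R[i] ffsupp ffZA ffZ1 ffZDr ffZDl.

Lemma ff_addE f g x : ffun_of (f + g) x = f x + g x. Proof. by []. Qed.
Lemma ff_scaleE k f x : ffun_of (k *: f) x = k *: f x. Proof. by []. Qed.

Variables (b : A -> A -> R[i]) (pb : psd_form b).

Definition fsupp f : seq I := undup (sval (cid (svalP f))).

Lemma fsuppP f x : x \notin fsupp f -> f x = 0.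
Proof. by rewrite mem_undup; exact: (svalP (cid (svalP f))). Qed.

Lemma fsupp_uniq f : uniq (fsupp f). Proof. exact: undup_uniq. Qed.

(** The chosen list [fsupp f] is arbitrary; [fform_sum] evaluates the form on any duplicate-free
    list outside which the first argument vanishes. *)
Definition fform f g : R[i] := \sum_(x <- fsupp f) b (f x) (g x).

Lemma b0l u : b 0 u = 0. Proof. exact: (clin0 (psd_linear pb u)). Qed.

Lemma sum_support (s t : seq I) (F : I -> R[i]) : uniq s -> uniq t ->
  (forall x, F x != 0 -> x \in s) -> (forall x, F x != 0 -> x \in t) ->
  \sum_(x <- s) F x = \sum_(x <- t) F x.
Proof.
move=> us ut sP tP.
rewrite [LHS](bigID (fun x => F x != 0)) [RHS](bigID (fun x => F x != 0))/=.
rewrite [X in _ + X]big1 ?[X in _ = _ + X]big1; [|by move=> x /negPn/eqP..].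
rewrite !addr0 -big_filter -[RHS]big_filter; apply: perm_big.
apply: uniq_perm; rewrite ?filter_uniq// => x; rewrite !mem_filter.
by case Fx : (F x != 0) => //=; rewrite sP ?tP// Fx.
Qed.

Lemma fform_sum f g (s : seq I) : uniq s -> (forall x, x \notin s -> f x = 0) ->
  fform f g = \sum_(x <- s) b (f x) (g x).
Proof.
move=> us sP; apply: sum_support => //; first exact: fsupp_uniq.
  by move=> x; apply: contraNT => /fsuppP ->; rewrite b0l.
by move=> x; apply: contraNT => /sP ->; rewrite b0l.
Qed.

Lemma fsupp2 f g : exists s, [/\ uniq s, forall x, x \notin s -> f x = 0 &
  forall x, x \notin s -> g x = 0].
Proof.
exists (undup (fsupp f ++ fsupp g)); split; first exact: undup_uniq.
  by move=> x; rewrite mem_undup mem_cat negb_or => /andP[/fsuppP].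
by move=> x; rewrite mem_undup mem_cat negb_or => /andP[_ /fsuppP].
Qed.

Lemma fform_psd : psd_form fform.
Proof.
split=> [g k u v|f k u v|f].
- have [s [us fs gs]] := fsupp2 u v.
  rewrite !(@fform_sum _ _ s)//; last by move=> x xs; rewrite ff_addE ff_scaleE fs// gs// scaler0 addr0.
  rewrite mulr_sumr -big_split/=; apply: eq_bigr => x _.
  exact: (psd_linear pb).
- rewrite /fform mulr_sumr -big_split/=; apply: eq_bigr => x _.
  exact: (psd_antilinear pb).
- by rewrite /fform sumr_ge0// => x _; exact: psd_ge0.
Qed.

End FinitelySupported.

(** * The order of Z_+^n *)

Section ZplusOrder.
Variable n : nat.
Local Notation Zp := (Zplus n).
Implicit Types x y : Zp.

Definition Zle (x y : Zp) := [forall i, x i <= y i]%N.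
Definition Zsub (x y : Zp) : Zp := [ffun i => (x i - y i)%N].

Lemma ZleP x y : reflect (forall i, x i <= y i)%N (Zle x y).
Proof. exact: forallP. Qed.

Lemma ZaddE (x y : Zp) i : (x + y) i = (x i + y i)%N.
Proof. by rewrite ffunE. Qed.

Lemma ZsubK x y : Zle y x -> Zsub x y + y = x.
Proof.
by move=> /ZleP yx; apply/ffunP => i; rewrite ZaddE ffunE subnK.
Qed.

Lemma ZaddK x y : Zsub (x + y) y = x.
Proof. by apply/ffunP => i; rewrite ffunE ZaddE addnK. Qed.

Lemma Zle_add x y : Zle y (x + y).
Proof. by apply/ZleP => i; rewrite ZaddE leq_addl. Qed.

Lemma Zaddr_inj (y : Zp) : injective (fun x : Zp => x + y).
Proof. by move=> u v /(congr1 (fun z => Zsub z y)); rewrite !ZaddK. Qed.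

End ZplusOrder.

(** * Shifts and diagonal operators on finitely supported functions *)

Section DiagonalShift.
Variable R : realType.
Local Open Scope complex_scope.
Variables (n : nat) (A : lmodType R[i]) (b : A -> A -> R[i]) (pb : psd_form b).
Local Notation Zp := (Zplus n).
Local Notation E := (ffsupp Zp A).
Local Notation B := (@fform R Zp A b).
Let pB : psd_form B := fform_psd _ pb.
Implicit Types (f g : E) (x y : Zp) (u v : A).

(** The value is 0 outside y + Z_+^n, where the truncated subtraction [Zsub] would be
    meaningless. *)
Definition up (y : Zp) (f : Zp -> A) (x : Zp) : A := if Zle y x then f (Zsub x y) else 0.

Lemma up_finsupp y (f : E) : finsupp (up y f).
Proof.
exists (map (fun x => x + y) (fsupp f)) => x; rewrite /up; case: ifP => // yx.
move=> H; apply: fsuppP; apply: contraNN H => /(map_f (fun x => x + y)).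
by rewrite ZsubK.
Qed.

Lemma down_finsupp (y : Zp) (f : E) : finsupp (fun x => f (x + y)).
Proof.
exists (map (fun x => Zsub x y) (fsupp f)) => x H; apply: fsuppP.
by apply: contraNN H => /(map_f (fun x => Zsub x y)); rewrite ZaddK.
Qed.

Definition shift_up y (f : E) : E := exist _ _ (up_finsupp y f).
Definition shift_down y (f : E) : E := exist _ _ (down_finsupp y f).

Lemma shift_adj y f g : B (shift_up y f) g = B f (shift_down y g).
Proof.
rewrite (@fform_sum _ _ _ _ pb _ _ (map (fun x => x + y) (fsupp f))); last first.
- move=> x /=; rewrite /up; case: ifP => // yx.
  move=> H; apply: fsuppP; apply: contraNN H => /(map_f (fun x => x + y)).
  by rewrite ZsubK.
- by rewrite map_inj_uniq ?fsupp_uniq//; exact: Zaddr_inj.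
rewrite big_map; apply: eq_bigr => x _ /=.
by rewrite /up Zle_add ZaddK.
Qed.

Lemma shift_downK y f : shift_down y (shift_up y f) = f.
Proof. by apply: ffsupp_eqP => x /=; rewrite /up Zle_add ZaddK. Qed.

Lemma shift_up_bound y f : sn B (shift_up y f) <= 1 * sn B f.
Proof. by rewrite mul1r /sn shift_adj shift_downK. Qed.

Lemma shift_down_bound y f : sn B (shift_down y f) <= 1 * sn B f.
Proof.
have [->|s0] := eqVneq (sn B (shift_down y f)) 0; first by rewrite mul1r sn_ge0.
have {}s0 : 0 < sn B (shift_down y f) by rewrite lt_def s0 sn_ge0.
rewrite -(ler_pM2r s0) -expr2 (sn_sq pB) -shift_adj.
rewrite (le_trans (ler_norm _))// (le_trans (Re_le_normc _))//.
rewrite (le_trans (sn_CS pB _ _))// mulrC mul1r ler_wpM2l ?sn_ge0//.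
by rewrite -[leRHS]mul1r shift_up_bound.
Qed.

Definition shift_op y : adj_op B :=
  AdjOp (shift_adj y) ler01 (shift_up_bound y) (shift_down_bound y).

Variables (D D' : Zp -> A -> A) (C : R).
Hypothesis C0 : 0 <= C.
Hypothesis D00 : forall x, D x 0 = 0.
Hypothesis D'00 : forall x, D' x 0 = 0.
Hypothesis DP : forall x u v, b (D x u) v = b u (D' x v).
Hypothesis DC : forall x u, b (D x u) (D x u) <= (C ^+ 2)%:C * b u u.
Hypothesis D'C : forall x u, b (D' x u) (D' x u) <= (C ^+ 2)%:C * b u u.

Lemma diag_finsupp (F : Zp -> A -> A) (f : E) : (forall x, F x 0 = 0) ->
  finsupp (fun x => F x (f x)).
Proof. by move=> F0; exists (fsupp f) => x /fsuppP ->. Qed.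

Definition diag_fun (f : E) : E := exist _ _ (diag_finsupp f D00).
Definition diag_dual (f : E) : E := exist _ _ (diag_finsupp f D'00).

Lemma diag_adj f g : B (diag_fun f) g = B f (diag_dual g).
Proof.
rewrite (@fform_sum _ _ _ _ pb _ _ (fsupp f)) ?fsupp_uniq//; last first.
  by move=> x /fsuppP /= ->.
by apply: eq_bigr => x _ /=; rewrite DP.
Qed.

Lemma diag_bound_gen (F : Zp -> A -> A) (F0 : forall x, F x 0 = 0) (f : E) :
  (forall x u, b (F x u) (F x u) <= (C ^+ 2)%:C * b u u) ->
  sn B (exist _ _ (diag_finsupp f F0) : E) <= C * sn B f.
Proof.
move=> FC; rewrite -(@ler_pXn2r _ 2) ?nnegrE ?mulr_ge0 ?sn_ge0//.
rewrite exprMn !(sn_sq pB).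
set Ff : E := exist _ _ _.
suff : B Ff Ff <= (C ^+ 2)%:C * B f f.
  by rewrite (psdE pB) [B f f](psdE pB) -rmorphM lecR.
rewrite (@fform_sum _ _ _ _ pb _ _ (fsupp f)) ?fsupp_uniq//; last first.
  by move=> x /fsuppP /= ->.
by rewrite /fform mulr_sumr; apply: ler_sum => x _ /=; exact: FC.
Qed.

Definition diag_op : adj_op B :=
  AdjOp diag_adj C0 (fun f => diag_bound_gen D00 f DC) (fun f => diag_bound_gen D'00 f D'C).

End DiagonalShift.

Section StarHom.
Variable R : realType.
Variables (A B : cstarAlgType R[i]) (f : A -> B) (hf : star_hom f).

Lemma star_hom_lin k a b : f (k *: a + b) = k *: f a + f b.
Proof. by have [lf _ _] := hf; rewrite lf. Qed.
Lemma star_homM a b : f (a ** b) = f a ** f b.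
Proof. by have [_ -> _] := hf. Qed.
Lemma star_homS a : f (star a) = star (f a).
Proof. by have [_ _ ->] := hf. Qed.

Lemma star_homD a b : f (a + b) = f a + f b.
Proof. by have := star_hom_lin 1 a b; rewrite !scale1r. Qed.

Lemma star_hom0 : f 0 = 0.
Proof. by apply: (addrI (f 0)); rewrite -star_homD !addr0. Qed.

Lemma star_rep_comp (H : hilbertType R[i]) (rho : B -> H -> H) :
  star_rep rho -> star_rep (fun a => rho (f a)).
Proof.
move=> [rb rl rM ra]; split => [a|u k a b|a b|a].
- exact: rb.
- by rewrite star_hom_lin rl.
- by rewrite star_homM rM.
- by rewrite star_homS; exact: ra.
Qed.

End StarHom.

Section FockPair.
Variable R : realType.
Local Open Scope complex_scope.
Variables (n : nat) (A : cstarAlgType R[i]) (alpha : Zplus n -> A -> A).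
Hypothesis halpha : unital_dynamical_system alpha.
Variables (tau : A -> R[i]) (htau : state tau).
Local Notation Zp := (Zplus n).
Local Notation E := (ffsupp Zp A).

Let alphaH x : star_hom (alpha x). Proof. by have [] := halpha. Qed.
Let alpha1 x : alpha x cone = cone. Proof. by have [] := halpha. Qed.
Let alphaD x y a : alpha (x + y) a = alpha x (alpha y a).
Proof. by have [_ _ _ ->] := halpha. Qed.
Let ctau : clin tau := state_clin htau.
Let ptau : positive tau := state_positive htau.

Definition gns_form (u v : A) : R[i] := tau (star v ** u).

Lemma gns_psd : psd_form gns_form.
Proof. exact: positive_psd. Qed.

Definition fock_form : E -> E -> R[i] := fform gns_form.
Lemma fock_psd : psd_form fock_form. Proof. exact: fform_psd gns_psd. Qed.

Definition fock := completion_hilbert fock_psd.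

(** The multiplication at index [x] is twisted by [alpha x]: translation by [y] then turns [a] into
    [alpha y a], which is the covariance relation. *)
Definition fock_diag a (x : Zp) (u : A) : A := alpha x a ** u.

Lemma fock_diag0 a x : fock_diag a x 0 = 0. Proof. exact: cmul0r. Qed.

Lemma fock_diag_adj a x u v :
  gns_form (fock_diag a x u) v = gns_form u (fock_diag (star a) x v).
Proof. by rewrite /gns_form /fock_diag starM (star_homS (alphaH x)) starK cmulA. Qed.

(** The functional c |-> tau(u^* alpha_x(c) u) is positive with value [gns_form u u] at [cone]; its
    bound is used at [star a ** a]. *)
Lemma fock_diag_bound a x u : gns_form (fock_diag a x u) (fock_diag a x u) <=
  (nr a ^+ 2)%:C * gns_form u u.
Proof.
pose f c := tau (star u ** (alpha x c ** u)).
have cf : clin f.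
  move=> k c d; rewrite /f (star_hom_lin (alphaH x)) cmulDl cmulZl cmulDr cmulZr.
  exact: ctau.
have pf : positive f.
  move=> c; rewrite /f (star_homM (alphaH x)) (star_homS (alphaH x)).
  by rewrite -cmulA (cmulA (star u)) -starM ptau.
have -> : gns_form (fock_diag a x u) (fock_diag a x u) = f (star a ** a).
  by rewrite /gns_form /fock_diag /f starM (star_homM (alphaH x)) (star_homS (alphaH x)) !cmulA.
have -> : gns_form u u = f cone by rewrite /gns_form /f alpha1 cmul1l.
have [f1E f10] := positive_one pf; have [-> _] := complex_ge0 (pf a).
rewrite f1E -rmorphM lecR mulrC -nr_starM.
rewrite (le_trans (ler_norm _))// (le_trans (Re_le_normc _))//.
exact: positive_bound.
Qed.

Lemma nr_star_sq a x u : gns_form (fock_diag (star a) x u) (fock_diag (star a) x u) <=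
  (nr a ^+ 2)%:C * gns_form u u.
Proof. by rewrite -(nr_star a) fock_diag_bound. Qed.

Definition fock_aop (a : A) : adj_op fock_form :=
  diag_op gns_psd (nr_ge0 a) (fock_diag0 a) (fock_diag0 (star a)) (fock_diag_adj a)
    (fock_diag_bound a) (nr_star_sq a).

Definition fock_shift (y : Zp) : adj_op fock_form := shift_op gns_psd y.

Definition fock_pi (a : A) : fock -> fock := @clift _ _ _ fock_psd (fock_aop a).
Definition fock_V (y : Zp) : fock -> fock := @clift _ _ _ fock_psd (fock_shift y).

Lemma fock_piE a F g : ceval (fock_pi a F) g = ceval F (aadj (fock_aop a) g).
Proof. by []. Qed.

Lemma fock_VE y F g : ceval (fock_V y F) g = ceval F (shift_down y g).
Proof. by []. Qed.

Lemma ceval_lin (F : fock) (k : R[i]) (f g h : E) :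
  (forall x, h x = k *: f x + g x) -> ceval F h = conjc k * ceval F f + ceval F g.
Proof.
move=> hE; have -> : h = k *: f + g by apply: ffsupp_eqP => x; rewrite hE.
exact: (@compl_antilinear _ _ _ fock_psd _ _ _ _ (cfunP F)).
Qed.

Lemma ceval_eq (F : fock) (f g : E) : (forall x, f x = g x) -> ceval F f = ceval F g.
Proof. by move=> /ffsupp_eqP ->. Qed.

Lemma fock_star_rep : star_rep fock_pi.
Proof.
split=> [a|F k a b|a b|a].
- exact: clift_bounded.
- apply: completion_fun_eq => g; rewrite completion_addE completion_scaleE.
  rewrite ?(fock_piE, fock_VE, cliftE) -[k]conjcK; apply: ceval_lin => x /=.
  rewrite /fock_diag conjcK starD starZ_c (star_hom_lin (alphaH x)).
  by rewrite cmulDl cmulZl.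
- apply/funext => F; apply: completion_fun_eq => g; rewrite /= ?(fock_piE, fock_VE, cliftE).
  apply: ceval_eq => x /=; rewrite /fock_diag starM (star_homM (alphaH x)).
  by rewrite cmulA.
- have -> : fock_pi (star a) = @clift _ _ _ fock_psd (@adj_dual _ _ _ fock_psd (fock_aop a)).
    apply/funext => F; apply: completion_fun_eq => g.
    rewrite fock_piE cliftE; by apply: ceval_eq => x /=; rewrite /fock_diag starK.
  exact: clift_adjoint.
Qed.

Lemma fock_isometry y : isometry_op (fock_V y).
Proof.
split; first exact: clift_linear.
move=> F; rewrite !nrE; congr _%:C; apply/eqP.
rewrite -(@eqrXn2 _ 2) ?nr_ge0//; apply/eqP/complexI.
rewrite -[LHS]inner_nr -[RHS]inner_nr.
rewrite (@clift_adjoint _ _ _ fock_psd (fock_shift y) F (fock_V y F)).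
congr (inner F _); apply: completion_fun_eq => g.
by rewrite cliftE fock_VE; apply: ceval_eq => x; rewrite shift_downK.
Qed.

Lemma Zgen_le (i : 'I_n) (x : Zp) : Zle (Zgen i) x = (0 < x i)%N.
Proof.
apply/ZleP/idP => [/(_ i)|xi j]; first by rewrite ffunE eqxx.
by rewrite ffunE; case: eqP => // ->.
Qed.

(** Vectors of the Fock space are functionals, on which each operator acts through its adjoint; the
    algebraic relations thus become pointwise identities between finitely supported functions. *)
Lemma fock_nica : nica_covariant_pair alpha fock_pi fock_V.
Proof.
split.
- exact: fock_star_rep.
- exact: fock_isometry.
- split=> [|x y]; apply/funext => F; apply: completion_fun_eq => g;
    rewrite /= ?(fock_piE, fock_VE, cliftE); apply: ceval_eq => z /=; first by rewrite addr0.
  by rewrite addrAC addrA.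
- move=> i j ij; exists (@clift _ _ _ fock_psd (@adj_dual _ _ _ fock_psd (fock_shift (Zgen j)))).
    exact: clift_adjoint.
  apply/funext => F; apply: completion_fun_eq => g; rewrite /= ?(fock_piE, fock_VE, cliftE).
  apply: ceval_eq => z /=; rewrite /up !Zgen_le /= ZaddE ffunE.
  rewrite eq_sym (negbTE ij) addn0; case: ifP => // zj; congr (ffun_of g).
  apply/ffunP => k; rewrite ZaddE [Zsub z _ k]ffunE [RHS]ffunE ZaddE !ffunE.
  have [->|kj] := eqVneq k j; first by rewrite eq_sym (negbTE ij) !addn0.
  by rewrite !subn0.
- move=> a i; apply/funext => F; apply: completion_fun_eq => g; rewrite /= ?(fock_piE, fock_VE, cliftE).
  by apply: ceval_eq => z /=; rewrite /fock_diag alphaD (star_homS (alphaH _)).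
Qed.

End FockPair.

(** * Relations in the Toeplitz-Nica-Pimsner algebra *)

Section ZplusInduction.
Variable n : nat.

Lemma Zplus_ind (P : Zplus n -> Prop) : P 0 ->
  (forall x i, P x -> P (x + Zgen i)) -> forall x, P x.
Proof.
move=> P0 PS x; move: {2}(\sum_i x i)%N (erefl (\sum_i x i)%N) => m.
elim: m x => [|m IH] x xm.
  suff -> : x = 0 by [].
  apply/ffunP => i; rewrite ffunE; apply/eqP.
  by move: xm => /eqP; rewrite sum_nat_eq0 => /forallP/(_ i).
have /existsP[i xi] : [exists i, 0 < x i]%N.
  apply: contraT; rewrite negb_exists => /forallP H.
  by move: xm; rewrite big1// => i _; apply/eqP; rewrite -leqn0 leqNgt H.
have gx : Zle (Zgen i) x by rewrite Zgen_le.
rewrite -(ZsubK gx); apply: PS; apply: IH.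
have : (\sum_j x j = \sum_j (Zsub x (Zgen i) j) + \sum_j Zgen i j)%N.
  rewrite -big_split/=; apply: eq_bigr => j _.
  by rewrite -{1}(ZsubK gx) ZaddE.
rewrite xm (bigD1 i)//= [X in (_ + X)%N](bigD1 i)//= !ffunE eqxx.
rewrite [X in (_ + (1 + X))%N]big1 => [|j /negbTE ji]; last by rewrite ffunE ji.
by rewrite addn0 addn1 => -[<-].
Qed.

End ZplusInduction.

(** * Norm density with real tolerances *)

Section ApproxSets.
Variable R : realType.
Local Open Scope complex_scope.

Lemma closed_nr (V : normedModType R[i]) (B : set V) :
  (forall v, (forall e : R, 0 < e -> exists2 b, B b & nr (v - b) < e) -> B v) ->
  closed B.
Proof.
move=> H v cv; apply: H => e e0.
have [|b [Bb bv]] := cv (ball v e%:C); first by apply: nbhsx_ballx; rewrite ltcR.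
by exists b => //; move: bv; rewrite -ball_normE/= nrE ltcR.
Qed.

Lemma dense_nr (V : normedModType R[i]) (B : set V) :
  dense B <-> forall v (e : R), 0 < e -> exists2 b, B b & nr (v - b) < e.
Proof.
split=> [dB v e e0|H O [v Ov] oO].
  have e0' : 0 < e%:C by rewrite ltcR.
  have [||b [bv Bb]] := dB (ball v e%:C)^°; last first.
  - exists b => //; have := interior_subset bv.
    by rewrite -ball_normE/= nrE ltcR.
  - exact: open_interior.
  - by exists v; apply: nbhsx_ballx.
have /nbhs_ballP[_ /complex_gt0[e e0 ->] eO] : nbhs v O by apply: open_nbhs_nbhs.
have [b Bb bv] := H v e e0; exists b; split => //; apply: eO.
by rewrite -ball_normE/= nrE ltcR.
Qed.

Variable N : cstarAlgType R[i].

Definition approx_closure (B : set N) : set N :=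
  [set v | forall e : R, 0 < e -> exists2 b, B b & nr (v - b) < e].

Lemma approx_closure_closed (B : set N) : closed (approx_closure B).
Proof.
apply: closed_nr => v H e e0; have e20 : 0 < e / 2 by rewrite divr_gt0.
have [b Bb vb] := H _ e20; have [c Bc bc] := Bb _ e20.
exists c => //; rewrite (le_lt_trans (nr_dist b _ _))// (splitr e).
exact: ltrD.
Qed.

Lemma approx_closure_sub (B : set N) : B `<=` approx_closure B.
Proof. by move=> v Bv e e0; exists v => //; rewrite subrr nr0. Qed.

Lemma approx_closure_star (B : set N) : star_subalgebra B ->
  star_subalgebra (approx_closure B).
Proof.
move=> [B0 BD BZ BM BS]; split.
- exact: approx_closure_sub.
- move=> a b aB bB e e0; have e20 : 0 < e / 2 by rewrite divr_gt0.
  have [a' a'B aa] := aB _ e20; have [b' b'B bb] := bB _ e20.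
  exists (a' + b'); first exact: BD.
  by rewrite opprD addrACA (le_lt_trans (nrD _ _))// (splitr e) ltrD.
- move=> k a aB e e0; have k0 : 0 < normc k + 1 by rewrite ltr_pwDr// normc_ge0.
  have [a' a'B aa] := aB _ (divr_gt0 e0 k0); exists (k *: a'); first exact: BZ.
  rewrite -scalerBr nrZ (@le_lt_trans _ _ ((normc k + 1) * nr (a - a')))//.
    by rewrite ler_wpM2r ?nr_ge0// lerDl.
  by rewrite mulrC -ltr_pdivlMr.
- move=> a b aB bB e e0.
  pose K := nr a + nr b + 1; have K0 : 0 < K.
    by have := nr_ge0 a; have := nr_ge0 b; rewrite /K; lra.
  pose d := Num.min 1 (e / (2 * K)); have d0 : 0 < d.
    by rewrite lt_min ltr01 divr_gt0// mulr_gt0.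
  have dK : d * (2 * K) <= e by rewrite -ler_pdivlMr ?mulr_gt0// ge_min lexx orbT.
  have d1 : d <= 1 by rewrite ge_min lexx.
  have [a' a'B aa] := aB _ d0; have [b' b'B bb] := bB _ d0.
  exists (a' ** b'); first exact: BM.
  have -> : a ** b - a' ** b' = a ** (b - b') + (a - a') ** b'.
    by rewrite cmulBl cmulBr addrA subrK.
  rewrite (le_lt_trans (nrD _ _))//.
  have H1 := nrM a (b - b'); have H2 := nrM (a - a') b'.
  have b'1 : nr b' <= nr b + 1.
    rewrite -[b'](subrK b) addrC (le_trans (nrD _ _))// lerD2l nrC.
    exact: (le_trans (ltW bb)).
  have := nr_ge0 a; have := nr_ge0 b; have := nr_ge0 b'.
  have := nr_ge0 (a - a'); have := nr_ge0 (b - b'); rewrite /K in dK.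
  move: bb aa H1 H2 b'1 dK d0.
  move: (nr (_ ** _)) (nr (_ ** _)) (nr (a - a')) (nr (b - b')) (nr a) (nr b) (nr b').
  move=> x1 x2 x3 x4 x5 x6 x7; nra.
- move=> a aB e e0; have [a' a'B aa] := aB e e0.
  by exists (star a'); [exact: BS|rewrite -starB nr_star].
Qed.

End ApproxSets.

Section Toeplitz.
Variable R : realType.
Local Open Scope complex_scope.
Variables (n : nat) (A : cstarAlgType R[i]) (alpha : Zplus n -> A -> A).
Hypothesis halpha : unital_dynamical_system alpha.
Variables (N : cstarAlgType R[i]) (w : Zplus n -> A -> N).
Hypothesis hN : toeplitz_nica_pimsner alpha w.
Local Notation Zp := (Zplus n).
Implicit Types (x y : Zp) (a : A) (b v : N).

Definition tiota a : N := w 0 a.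
Definition tV x : N := w x cone.

Let alphaH x : star_hom (alpha x). Proof. by have [] := halpha. Qed.
Let alpha1 x : alpha x cone = cone. Proof. by have [] := halpha. Qed.
Let alpha0 a : alpha 0 a = a. Proof. by have [_ _ -> _] := halpha. Qed.
Let alphaD x y a : alpha (x + y) a = alpha x (alpha y a).
Proof. by have [_ _ _ ->] := halpha. Qed.

(** The approximable elements form a closed subalgebra that contains the generators, so generation
    as a closed algebra yields density. *)
Lemma tnp_ind (B : set N) : star_subalgebra B -> (forall x a, B (w x a)) ->
  forall v (e : R), 0 < e -> exists2 b, B b & nr (v - b) < e.
Proof.
move=> sB wB v.
have H : approx_closure B = setT.
  apply: (tnp_generated hN (approx_closure_star sB)).
    exact: approx_closure_closed.
  by move=> x a; exact: approx_closure_sub.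
by have : approx_closure B v by rewrite H.
Qed.

Lemma pair_cov (H : hilbertType R[i]) (pi : A -> H -> H) (V : Zp -> H -> H) :
  nica_covariant_pair alpha pi V -> forall x a u, pi a (V x u) = V x (pi (alpha x a) u).
Proof.
move=> [_ _ [V0 VD] _ cov] x; elim/Zplus_ind: x => [|x i IH] a u.
  by rewrite V0 alpha0.
have := congr1 (fun f => f u) (cov (alpha x a) i) => /= E.
by rewrite VD /= IH E addrC alphaD.
Qed.

(** The realizing representation preserves norms, so an identity in [N] can be checked there;
    quantifying over all pairs hides which pair it is. *)
Lemma tnp_eq b b' : (forall (H : hilbertType R[i]) (pi : A -> H -> H)
    (V : Zp -> H -> H) (rho : N -> H -> H),
    nica_covariant_pair alpha pi V -> star_rep rho ->
    (forall x a u, rho (w x a) u = V x (pi a u)) -> forall u, rho b u = rho b' u) ->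
  b = b'.
Proof.
have [H [pi [V [rho [pV rr on rw]]]]] := tnp_realized hN.
move=> /(_ H pi V rho pV rr); have rw' x a u : rho (w x a) u = V x (pi a u) by rewrite rw.
move=> /(_ rw') E; apply/subr0_eq/eqP; rewrite -normr_le0.
have [_ _ ->//] := on (b - b') => u.
by rewrite repB// E subrr normr0 mul0r.
Qed.

Lemma tnp_bound b (M : R) : 0 <= M -> (forall (H : hilbertType R[i]) (pi : A -> H -> H)
    (V : Zp -> H -> H) (rho : N -> H -> H),
    nica_covariant_pair alpha pi V -> star_rep rho ->
    (forall x a u, rho (w x a) u = V x (pi a u)) -> forall u, nr (rho b u) <= M * nr u) ->
  nr b <= M.
Proof.
have [H [pi [V [rho [pV rr on rw]]]]] := tnp_realized hN.
move=> M0 /(_ H pi V rho pV rr); have rw' x a u : rho (w x a) u = V x (pi a u) by rewrite rw.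
move=> /(_ rw') E; rewrite -nr_le.
have [_ _ ->//] := on b; first by rewrite ler0c.
by move=> u; rewrite !nrE -rmorphM lecR.
Qed.

Lemma tiota_lin k a a' : tiota (k *: a + a') = k *: tiota a + tiota a'.
Proof.
apply: tnp_eq => H pi V rho pV rr rw u.
rewrite (rep_linearA rr u) /= !rw.
have [rp _ [-> _] _ _] := pV; exact: (rep_linearA rp u).
Qed.

Lemma tiotaM a a' : tiota (a ** a') = tiota a ** tiota a'.
Proof.
apply: tnp_eq => H pi V rho pV rr rw u; rewrite (rep_mul rr) !rw.
by have [rp _ [-> _] _ _] := pV; rewrite (rep_mul rp).
Qed.

Lemma tiotaS a : tiota (star a) = star (tiota a).
Proof.
apply: tnp_eq => H pi V rho pV rr rw u.
apply: inner_extr => v; rewrite -(rep_star rr) !rw.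
by have [rp _ [-> _] _ _] := pV; rewrite (rep_star rp).
Qed.

Lemma tnp_wE x a : w x a = tV x ** tiota a.
Proof.
apply: tnp_eq => H pi V rho pV rr rw u; rewrite (rep_mul rr) !rw.
by have [rp _ [-> _] _ _] := pV; rewrite -(rep_mul rp) cmul1l.
Qed.

Lemma tiota_tV x a : tiota a ** tV x = tV x ** tiota (alpha x a).
Proof.
rewrite -tnp_wE; apply: tnp_eq => H pi V rho pV rr rw u; rewrite (rep_mul rr) !rw.
have cv := pair_cov pV; have [rp _ [-> _] _ _] := pV.
by rewrite cv -(rep_mul rp) cmul1r.
Qed.

(** Representations may be degenerate, so the unit of [N] is not identified by its action. Instead,
    the elements on which [tiota cone] acts as a two-sided unit form a subalgebra containing the
    generators; it is dense, so it approximates [cone]. *)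
Lemma tiota1 : tiota cone = cone.
Proof.
pose B : set N := [set v | tiota cone ** v = v /\ v ** tiota cone = v].
have s1 : star (tiota cone) = tiota cone by rewrite -tiotaS star1.
have sB : star_subalgebra B.
  split.
  - by split; rewrite ?cmul0l ?cmul0r.
  - by move=> a b [a1 a2] [b1 b2]; split; rewrite ?cmulDl ?cmulDr ?a1 ?b1 ?a2 ?b2.
  - by move=> k a [a1 a2]; split; rewrite ?cmulZl ?cmulZr ?a1 ?a2.
  - by move=> a b [a1 a2] [b1 b2]; split; [rewrite cmulA a1|rewrite -cmulA b2].
  - by move=> a [a1 a2]; split; [rewrite -{1}s1 -starM a2|rewrite -{1}s1 -starM a1].
have wB x a : B (w x a).
  split; rewrite tnp_wE; last by rewrite -cmulA -tiotaM cmul1r.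
  by rewrite cmulA tiota_tV alpha1 -cmulA -tiotaM cmul1l.
apply: eq_of_nr => e e0.
pose K := nr (tiota cone) + 1.
have K0 : 0 < K by rewrite ltr_pwDr// nr_ge0.
have [b [b1 b2] bc] := tnp_ind sB wB cone (divr_gt0 e0 K0).
have -> : tiota cone - cone = tiota cone ** (cone - b) - (cone - b).
  by rewrite cmulBr cmul1r b1 opprB addrA subrK.
rewrite (le_trans (nrB _ _))// (@le_trans _ _ (K * nr (cone - b)))//.
  by rewrite mulrDl mul1r lerD2r nrM.
by rewrite mulrC -ler_pdivlMr// ltW.
Qed.

Lemma tV0 : tV 0 = cone. Proof. exact: tiota1. Qed.

Lemma tVD x y : tV (x + y) = tV x ** tV y.
Proof.
apply: tnp_eq => H pi V rho pV rr rw u; rewrite (rep_mul rr) !rw.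
have cv := pair_cov pV; have [rp _ [_ ->] _ _] := pV.
by rewrite cv alpha1 -(rep_mul rp) cmul1l.
Qed.

(** In a pair, [tV x] acts as [V x \o pi cone] with [pi cone] only a projection, so the product is
    first recognized as [tiota cone]. *)
Lemma tV_isom x : star (tV x) ** tV x = cone.
Proof.
rewrite -tiota1; apply: tnp_eq => H pi V rho pV rr rw u.
apply: inner_ext => v; rewrite (rep_mul rr) (rep_star rr) starK !rw.
have [rp Vi [V0 _] _ _] := pV; rewrite (isometry_inner (Vi x)) V0.
by rewrite -[in RHS](cmul1l (cone : A)) (rep_mul rp) [RHS](rep_star rp) star1.
Qed.

(** The adjoint [S] of V_j commutes with the projection [pi cone] because V_j does, so the Nica
    relation survives the truncation by [pi cone]. *)
Lemma tV_star_comm (i j : 'I_n) : i != j ->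
  star (tV (Zgen j)) ** tV (Zgen i) = tV (Zgen i) ** star (tV (Zgen j)).
Proof.
move=> ij; apply: tnp_eq => H pi V rho pV rr rw u.
have cv x (v : H) : pi cone (V x v) = V x (pi cone v) by rewrite (pair_cov pV) alpha1.
have [rp Vi _ nica _] := pV; have [S VS VSC] := nica i j ij.
have SV := is_adjointC VS.
have Pa (v v' : H) : inner (pi cone v) v' = inner v (pi cone v').
  by rewrite (rep_star rp) star1.
have PP (v : H) : pi cone (pi cone v) = pi cone v by rewrite -(rep_mul rp) cmul1l.
have C (v : H) : V (Zgen i) (S v) = S (V (Zgen i) v) := congr1 (fun f => f v) VSC.
have PS (v : H) : pi cone (S v) = S (pi cone v).
  by apply: inner_ext => v'; rewrite Pa SV -cv -Pa -SV.
have St (v : H) : rho (star (tV (Zgen j))) v = S (pi cone v).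
  by apply: inner_ext => v'; rewrite (rep_star rr) starK rw SV Pa cv.
by rewrite !(rep_mul rr) St !rw St cv PP PS PP -C.
Qed.

End Toeplitz.

(** * Monomials, and functionals with the KMS commutation rules *)

Section Monomials.
Variable R : realType.
Local Open Scope complex_scope.
Variables (n : nat) (A : cstarAlgType R[i]) (alpha : Zplus n -> A -> A).
Hypothesis halpha : unital_dynamical_system alpha.
Variables (N : cstarAlgType R[i]) (w : Zplus n -> A -> N).
Hypothesis hN : toeplitz_nica_pimsner alpha w.
Local Notation Zp := (Zplus n).
Local Notation tiota := (tiota w).
Local Notation tV := (tV w).
Local Notation mono := (tnp_monomial w).
Implicit Types (x y : Zp) (a : A) (b v : N) (i j : 'I_n).

Let alphaD x y a : alpha (x + y) a = alpha x (alpha y a).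
Proof. by have [_ _ _ ->] := halpha. Qed.
Let alphaH x : star_hom (alpha x). Proof. by have [] := halpha. Qed.

Lemma monoE x a y : mono x a y = tV x ** tiota a ** star (tV y).
Proof. by rewrite /tnp_monomial (tnp_wE hN). Qed.

Lemma tV_comm x y : tV x ** tV y = tV y ** tV x.
Proof. by rewrite -!(tVD halpha hN) addrC. Qed.

Lemma starV_tiota x a : star (tV x) ** tiota a = tiota (alpha x a) ** star (tV x).
Proof.
have := congr1 star (tiota_tV halpha hN x (star a)).
by rewrite !starM -!(tiotaS hN) (star_homS (alphaH x)) !starK.
Qed.

Lemma starV_tV i x : x i = 0%N ->
  star (tV (Zgen i)) ** tV x = tV x ** star (tV (Zgen i)).
Proof.
elim/Zplus_ind: x => [_|x j IH]; first by rewrite (tV0 halpha hN) cmul1l cmul1r.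
rewrite ZaddE ffunE => /eqP; rewrite addn_eq0 => /andP[/eqP /IH {}IH].
rewrite eqb0 eq_sym => ji; rewrite (tVD halpha hN) cmulA IH -!cmulA.
by rewrite (tV_star_comm halpha hN)// eq_sym.
Qed.

Lemma starV_tV_gen i x : x i = 0%N ->
  star (tV x) ** tV (Zgen i) = tV (Zgen i) ** star (tV x).
Proof. by move=> /starV_tV/(congr1 star); rewrite !starM starK. Qed.

(** If [x i > 0] the starred generator cancels a factor of V_x; otherwise it passes through V_x by
    Nica covariance, through [a] by covariance, and is absorbed on the right. *)
Lemma starV_mono i x a y :
  exists x' a' y', star (tV (Zgen i)) ** mono x a y = mono x' a' y'.
Proof.
have [xi|xi] := posnP (x i); last first.
  have gx : Zle (Zgen i) x by rewrite Zgen_le.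
  exists (Zsub x (Zgen i)), a, y; rewrite !monoE -{1}(ZsubK gx).
  by rewrite (tVD halpha hN) tV_comm !cmulA (tV_isom halpha hN) cmul1l.
exists x, (alpha (Zgen i) a), (y + Zgen i); rewrite !monoE !cmulA starV_tV//.
rewrite -(cmulA (tV x)) starV_tiota (tVD halpha hN) starM !cmulA.
by [].
Qed.

(** Sums without scalars suffice, since a scalar is absorbed in the coefficient [a] of a
    monomial. *)
Inductive mspan : N -> Prop :=
| mspan0 : mspan 0
| mspanD x a y v : mspan v -> mspan (mono x a y + v).

Lemma mspan_add u v : mspan u -> mspan v -> mspan (u + v).
Proof.
by move=> su sv; elim: su => [|x a y u' _ IH]; rewrite ?add0r// -addrA; exact: mspanD.
Qed.

Lemma mspan_mono x a y : mspan (mono x a y).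
Proof. by rewrite -[mono _ _ _]addr0; apply: mspanD; exact: mspan0. Qed.

Lemma mspan_lin (f : N -> N) : {morph f : u v / u + v} -> f 0 = 0 ->
  (forall x a y, mspan (f (mono x a y))) -> forall v, mspan v -> mspan (f v).
Proof.
move=> fD f0 fm v; elim=> [|x a y u _ IH]; first by rewrite f0; exact: mspan0.
by rewrite fD; exact: mspan_add.
Qed.

Lemma tiotaZ k a : tiota (k *: a) = k *: tiota a.
Proof.
have l := tiota_lin hN.
have z : tiota 0 = 0 by have := l (-1) 0 0; rewrite !scaleN1r !addNr.
by have := l k a 0; rewrite z !addr0.
Qed.

(** Stability under products is checked for left multiplication by each factor of a monomial, the
    starred factor one generator at a time. *)
Lemma mspan_star_subalgebra : star_subalgebra mspan.
Proof.
have mulP : forall u, (forall x a y, mspan (u ** mono x a y)) ->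
    forall v, mspan v -> mspan (u ** v).
  move=> u um v; apply: mspan_lin => //; last exact: cmul0r.
  by move=> b c; rewrite cmulDr.
have ML u v : (forall c, mspan c -> mspan (u ** c)) -> (forall c, mspan c -> mspan (v ** c)) ->
    forall c, mspan c -> mspan ((u ** v) ** c).
  by move=> um vm c cm; rewrite -cmulA; apply: um; exact: vm.
have MV x : forall c, mspan c -> mspan (tV x ** c).
  apply: mulP => x' a y; suff -> : tV x ** mono x' a y = mono (x + x') a y by exact: mspan_mono.
  by rewrite !monoE (tVD halpha hN) !cmulA.
have MA a : forall c, mspan c -> mspan (tiota a ** c).
  apply: mulP => x a' y.
  suff -> : tiota a ** mono x a' y = mono x (alpha x a ** a') y by exact: mspan_mono.
  by rewrite !monoE (tiotaM hN) !cmulA (tiota_tV halpha hN).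
have MS x : forall c, mspan c -> mspan (star (tV x) ** c).
  elim/Zplus_ind: x => [|x i IH]; first by move=> c; rewrite (tV0 halpha hN) star1 cmul1l.
  rewrite (tVD halpha hN) starM; apply: ML => //; apply: mulP => x' a y.
  by have [? [? [? ->]]] := starV_mono i x' a y; exact: mspan_mono.
have MM x a y : forall c, mspan c -> mspan (mono x a y ** c).
  by rewrite monoE; exact: (ML _ _ (ML _ _ (MV x) (MA a)) (MS y)).
split.
- exact: mspan0.
- exact: mspan_add.
- move=> k; apply: mspan_lin => [u v||x a y]; first exact: scalerDr.
    exact: scaler0.
  suff -> : k *: mono x a y = mono x (k *: a) y by exact: mspan_mono.
  by rewrite !monoE tiotaZ cmulZr cmulZl.
- move=> u v su sv; elim: su => [|x a y u' _ IH]; first by rewrite cmul0l; exact: mspan0.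
  by rewrite cmulDl; apply: mspan_add => //; exact: MM.
- apply: mspan_lin => [u v||x a y]; [exact: starD|exact: star0|].
  suff -> : star (mono x a y) = mono y (star a) x by exact: mspan_mono.
  by rewrite !monoE !starM starK (tiotaS hN) cmulA.
Qed.

Lemma mspan_dense v (e : R) : 0 < e -> exists2 b, mspan b & nr (v - b) < e.
Proof.
apply: (tnp_ind hN mspan_star_subalgebra) => x a.
suff -> : w x a = mono x a 0 by exact: mspan_mono.
by rewrite monoE (tV0 halpha hN) star1 cmul1r (tnp_wE hN).
Qed.

(** In every pair, [alpha x] followed by [pi] is a representation, hence contractive. The bound is
    uniform in [x], as [contraction_zero] requires. *)
Lemma nr_tiota_alpha x a : nr (tiota (alpha x a)) <= nr a.
Proof.
apply: (tnp_bound hN); first exact: nr_ge0.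
move=> H pi V rho pV rr rw u; rewrite rw.
have [rp _ [-> _] _ _] := pV.
exact: (rep_bound (star_rep_comp (alphaH x) rp)).
Qed.

(** Iterating [m] times bounds [F c] by [q ^+ m] times a constant that is uniform along the orbit of
    [c]. *)
Lemma contraction_zero (F : A -> R[i]) (q : R) i (M : R) : 0 <= q < 1 ->
  (forall c, F c = q%:C * F (alpha (Zgen i) c)) ->
  (forall x c, normc (F (alpha x c)) <= M * nr c) -> forall c, F c = 0.
Proof.
move=> /andP[q0 q1] Fq FM c.
have H m : exists x, F c = (q ^+ m)%:C * F (alpha x c).
  elim: m => [|m [x IH]].
    by exists 0; have [_ _ -> _] := halpha; rewrite expr0 mul1r.
  by exists (Zgen i + x); rewrite IH Fq mulrA -rmorphM -exprSr alphaD.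
apply: eq0_normc; apply/eqP; rewrite eq_le normc_ge0 andbT.
have : (fun m => q ^+ m * (M * nr c)) @ \oo --> (0 : R).
  rewrite -(mul0r (M * nr c)); apply: cvgMl; apply: cvg_expr.
  by rewrite ger0_norm.
move=> ql; apply/ler_addgt0Pl => e e0; rewrite addr0.
have /cvgrPdist_lt/(_ _ e0)[m _ /(_ m (leqnn _))] := ql.
rewrite /= sub0r normrN => H2; have [x Fx] := H m.
rewrite Fx normcM normc_real ger0_norm ?exprn_ge0//.
apply: le_trans (ltW H2); rewrite (le_trans _ (ler_norm _))//.
by rewrite ler_wpM2l ?exprn_ge0.
Qed.

(** Positivity is left out so that differences of states belong to the class. Hence [kc_S], which
    for a positive functional follows from [kc_V] by conjugation, is a field of its own. *)
Record kms_class (q : 'I_n -> R) (D : N -> R[i]) : Prop := {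
  kc_lin : clin D ;
  kc_bound : exists2 M, 0 <= M & forall v, normc (D v) <= M * nr v ;
  kc_V : forall i b, D (tV (Zgen i) ** b) = (q i)%:C * D (b ** tV (Zgen i)) ;
  kc_S : forall i b, D (b ** star (tV (Zgen i))) =
     (q i)%:C * D (star (tV (Zgen i)) ** b) ;
  kc_A : forall a b, D (tiota a ** b) = D (b ** tiota a) }.

Definition tproj i : N := cone - tV (Zgen i) ** star (tV (Zgen i)).

(* In the Fock representation, [tprojs (enum 'I_n)] is the projection onto the
   component of index 0. *)
Definition tprojs (s : seq 'I_n) : N := foldr (fun i v => v ** tproj i) cone s.

Lemma tproj_star i : star (tproj i) = tproj i.
Proof. by rewrite /tproj starB star1 starM starK. Qed.

Lemma tproj_idem i : tproj i ** tproj i = tproj i.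
Proof.
rewrite {1}/tproj cmulBl cmul1l /tproj cmulBr cmul1r !cmulA.
rewrite -(cmulA (tV _) (star _) (tV _)) (tV_isom halpha hN) cmul1r subrr.
by rewrite subr0.
Qed.

Lemma tproj_tiota i a : tproj i ** tiota a = tiota a ** tproj i.
Proof.
rewrite /tproj cmulBl cmulBr cmul1l cmul1r -cmulA starV_tiota cmulA.
by rewrite -(tiota_tV halpha hN) cmulA.
Qed.

Lemma tproj_tV i j : i != j -> tproj j ** tV (Zgen i) = tV (Zgen i) ** tproj j.
Proof.
move=> ij; rewrite /tproj cmulBl cmulBr cmul1l cmul1r -cmulA.
by rewrite (tV_star_comm halpha hN)// !cmulA tV_comm.
Qed.

Lemma tproj_starV i j : i != j ->
  tproj j ** star (tV (Zgen i)) = star (tV (Zgen i)) ** tproj j.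
Proof.
by move=> /tproj_tV/(congr1 star); rewrite !starM tproj_star.
Qed.

Lemma tprojs_tV i s : i \notin s ->
  tprojs s ** tV (Zgen i) = tV (Zgen i) ** tprojs s.
Proof.
elim: s => [|j s IH] /=; first by rewrite cmul1l cmul1r.
rewrite in_cons negb_or => /andP[ij /IH {}IH].
by rewrite -cmulA tproj_tV// !cmulA IH.
Qed.

Lemma tproj_comm i j : tproj i ** tproj j = tproj j ** tproj i.
Proof.
have [->//|ij] := eqVneq i j.
rewrite [tproj i]/tproj cmulBl cmulBr cmul1l cmul1r -cmulA -tproj_starV//.
by rewrite !cmulA tproj_tV.
Qed.

Lemma tproj_tprojs i s : tproj i ** tprojs s = tprojs s ** tproj i.
Proof.
elim: s => [|j s IH] /=; first by rewrite cmul1l cmul1r.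
by rewrite cmulA IH -!cmulA tproj_comm.
Qed.

Lemma tprojs_star s : star (tprojs s) = tprojs s.
Proof.
elim: s => [|j s IH] /=; first exact: star1.
by rewrite starM IH tproj_star tproj_tprojs.
Qed.

Lemma tprojs_idem s : tprojs s ** tprojs s = tprojs s.
Proof.
elim: s => [|j s IH] /=; first exact: cmul1l.
by rewrite cmulA -(cmulA (tprojs s)) tproj_tprojs cmulA IH -cmulA tproj_idem.
Qed.

Lemma tprojs_tiota a s : tprojs s ** tiota a = tiota a ** tprojs s.
Proof.
elim: s => [|j s IH] /=; first by rewrite cmul1l cmul1r.
by rewrite -cmulA tproj_tiota cmulA IH cmulA.
Qed.

Section KmsClass.
Variables (q : 'I_n -> R) (D : N -> R[i]) (kD : kms_class q D).
Hypothesis q01 : forall i, 0 < q i < 1.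
Let q01' i : 0 <= q i < 1. Proof. by have /andP[/ltW -> ->] := q01 i. Qed.

Lemma peel i s a : i \notin s -> D (tiota a ** tprojs (i :: s)) =
  D (tiota a ** tprojs s) - (q i)%:C * D (tiota (alpha (Zgen i) a) ** tprojs s).
Proof.
move=> si; rewrite [tprojs (i :: s)]/= {1}/tproj !cmulBr cmul1r (clinB (kc_lin kD)).
congr (_ - _).
have -> : tiota a ** (tprojs s ** (tV (Zgen i) ** star (tV (Zgen i)))) =
    tV (Zgen i) ** (tiota (alpha (Zgen i) a) ** tprojs s ** star (tV (Zgen i))).
  by rewrite (cmulA (tprojs s)) tprojs_tV// !cmulA (tiota_tV halpha hN).
by rewrite (kc_V kD) -!cmulA (tV_isom halpha hN) cmul1r.
Qed.

(** As [alpha] is unital, each factor [tproj i] multiplies the value by [1 - q i]; for a state this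
    computes the normalizing constant psi(P). *)
Lemma peel_one s : uniq s -> D (tprojs s) = (\prod_(i <- s) (1 - q i))%:C * D cone.
Proof.
elim: s => [_|i s IH /andP[si us]]; first by rewrite big_nil mul1r.
have := peel cone si; have [_ -> _ _] := halpha.
rewrite (tiota1 halpha hN) !cmul1l IH// => ->.
by rewrite big_cons rmorphM rmorphB rmorph1; ring.
Qed.

Lemma peel_zero s : uniq s -> (forall a, D (tiota a ** tprojs s) = 0) ->
  forall a, D (tiota a) = 0.
Proof.
have [M M0 DM] := kc_bound kD.
elim: s => [_ H a|i s IH /andP[si us] H]; first by rewrite -(H a) cmul1r.
apply: IH => //; apply: (@contraction_zero _ (q i) i (M * nr (tprojs s))) => //.
  by move=> c; apply/eqP; rewrite -subr_eq0 -peel// H.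
move=> x c; rewrite (le_trans (DM _))// -mulrA ler_wpM2l// mulrC.
by rewrite (le_trans (nrM _ _))// ler_wpM2r ?nr_ge0// nr_tiota_alpha.
Qed.

(** A generator V_i of the left factor is cycled to the right. If [y i > 0] it cancels against the
    right factor, and the induction on [x] applies; if [y i = 0] it returns to the left past [a],
    which leaves the contraction equation in [a]. Once [x = 0], a starred generator of the right
    factor is cycled in the same way. *)
Lemma class_mono0 : (forall a, D (tiota a) = 0) -> forall x y a, D (mono x a y) = 0.
Proof.
have [M M0 DM] := kc_bound kD.
move=> D0; elim/Zplus_ind => [|x i IH] y a; last first.
  have [yi|yi] := posnP (y i); last first.
    have gy : Zle (Zgen i) y by rewrite Zgen_le.
    rewrite monoE -(ZsubK gy) !(tVD halpha hN) (tV_comm (Zsub _ _)) (tV_comm x) starM.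
    rewrite -!cmulA (kc_V kD) -!cmulA (tV_isom halpha hN) cmul1r !cmulA -monoE.
    by rewrite IH mulr0.
  apply: (@contraction_zero (fun a => D (mono (x + Zgen i) a y)) (q i) i
    (M * nr (tV (x + Zgen i)) * nr (star (tV y)))) => //.
    move=> c; rewrite !monoE {1}(tVD halpha hN) (tV_comm x) -!cmulA (kc_V kD).
    congr (_ * D _); rewrite -!cmulA starV_tV_gen// (cmulA (tiota c)) (tiota_tV halpha hN).
    by rewrite (tVD halpha hN) -!cmulA.
  move=> z c; rewrite monoE (le_trans (DM _))// -!mulrA ler_wpM2l//.
  rewrite (le_trans (nrM _ _))// [leRHS]mulrCA mulrC ler_wpM2l ?nr_ge0//.
  by rewrite (le_trans (nrM _ _))// ler_wpM2l ?nr_ge0// nr_tiota_alpha.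
elim/Zplus_ind: y a => [|y i _] a.
  by rewrite monoE (tV0 halpha hN) star1 cmul1l cmul1r.
apply: (@contraction_zero (fun a => D (mono 0 a (y + Zgen i))) (q i) i
    (M * nr (star (tV (y + Zgen i))))) => //.
  move=> c; rewrite !monoE (tV0 halpha hN) !cmul1l {1}(tVD halpha hN) (tV_comm y) starM.
  rewrite cmulA (kc_S kD); congr (_ * D _).
  by rewrite cmulA starV_tiota -cmulA -starM -(tVD halpha hN).
move=> z c; rewrite monoE (tV0 halpha hN) cmul1l (le_trans (DM _))// -mulrA ler_wpM2l//.
rewrite (le_trans (nrM _ _))// mulrC ler_wpM2l ?nr_ge0//.
exact: nr_tiota_alpha.
Qed.

Lemma class_zero s : uniq s -> (forall a, D (tiota a ** tprojs s) = 0) ->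
  forall v, D v = 0.
Proof.
move=> us H v; have [M M0 DM] := kc_bound kD.
have Dm := class_mono0 (peel_zero us H).
have Ds u : mspan u -> D u = 0.
  elim=> [|x a y u' _ IH]; first exact: (clin0 (kc_lin kD)).
  by rewrite (clinD (kc_lin kD)) Dm IH addr0.
apply: eq0_normc; apply/eqP; rewrite eq_le normc_ge0 andbT.
apply/ler_addgt0Pl => e e0; rewrite addr0.
have M1 : 0 < M + 1 by rewrite ltr_wpDl.
have [b bs vb] := mspan_dense v (divr_gt0 e0 M1).
rewrite -[v](subrK b) (clinD (kc_lin kD)) (Ds b bs) addr0 (le_trans (DM _))//.
rewrite (@le_trans _ _ ((M + 1) * nr (v - b)))//.
  by rewrite ler_wpM2r ?nr_ge0// lerDl.
by rewrite mulrC -ler_pdivlMr// ltW.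
Qed.

End KmsClass.

End Monomials.

(** * The KMS functional of a tracial state *)

Section WeightedSum.
Variable R : realType.
Local Open Scope complex_scope.
Variables (n : nat) (q : 'I_n -> R).
Hypothesis q01 : forall i, 0 < q i < 1.
Local Notation Zp := (Zplus n).
Implicit Types (x y : Zp) (G : Zp -> R[i]) (s : seq Zp) (C e : R) (N : nat).

Definition qx x : R := \prod_i q i ^+ x i.

Lemma qx_ge0 x : 0 <= qx x.
Proof. by apply: prodr_ge0 => i _; rewrite exprn_ge0//; have /andP[/ltW] := q01 i. Qed.

Lemma qxD x y : qx (x + y) = qx x * qx y.
Proof. by rewrite /qx -big_split/=; apply: eq_bigr => i _; rewrite ZaddE exprD. Qed.

Lemma qx0 : qx 0 = 1.
Proof. by rewrite /qx big1// => i _; rewrite ffunE. Qed.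

Lemma qx_gen i : qx (Zgen i) = q i.
Proof.
rewrite /qx (bigD1 i)//= ffunE eqxx expr1 big1 ?mulr1// => j ji.
by rewrite ffunE (negbTE ji).
Qed.

(** Enumerated through finite functions, so that [bigA_distr_bigA] turns the mass of a box into a
    product of geometric sums. *)
Definition box N : seq Zp :=
  [seq [ffun i => nat_of_ord ((f : {ffun 'I_n -> 'I_N}) i)]
  | f <- enum {: {ffun 'I_n -> 'I_N}}].

Lemma box_uniq N : uniq (box N).
Proof.
rewrite map_inj_uniq ?enum_uniq// => f g /ffunP fg; apply/ffunP => i.
by apply: val_inj; have := fg i; rewrite !ffunE.
Qed.

Lemma mem_box N x : (x \in box N) = [forall i, x i < N]%N.
Proof.
apply/mapP/forallP => [[f _ ->] i|H]; first by rewrite ffunE.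
exists [ffun i => Ordinal (H i)]; first by rewrite mem_enum.
by apply/ffunP => i; rewrite !ffunE.
Qed.

Lemma box_sub M N : (M <= N)%N -> {subset box M <= box N}.
Proof.
move=> MN x; rewrite !mem_box => /forallP H; apply/forallP => i.
exact: leq_trans (H i) MN.
Qed.

Lemma sub_box s : exists N, {subset s <= box N}.
Proof.
elim: s => [|x s [N NP]]; first by exists 0%N.
exists (maxn N (\max_i x i).+1) => y; rewrite in_cons => /orP[/eqP ->|/NP ys].
  rewrite mem_box; apply/forallP => i; rewrite leq_max; apply/orP; right.
  by rewrite ltnS (leq_bigmax i).
by apply: box_sub ys; rewrite leq_maxl.
Qed.

Lemma box_mass N : \sum_(x <- box N) qx x = \prod_i \sum_(j < N) q i ^+ j.
Proof.
rewrite bigA_distr_bigA big_map big_enum/=; apply: eq_bigr => f _.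
by rewrite /qx; apply: eq_bigr => i _; rewrite ffunE.
Qed.

Definition mass s : R := \sum_(x <- s) qx x.

Lemma mass_sub s (t : seq Zp) : uniq s -> {subset s <= t} -> uniq t -> mass s <= mass t.
Proof.
move=> us st ut; rewrite /mass [leRHS](bigID (mem s))/= -[X in _ <= X + _]big_filter.
have P : perm_eq [seq i <- t | i \in s] s.
  apply: uniq_perm; rewrite ?filter_uniq// => x; rewrite mem_filter.
  by apply: andb_idr; exact: st.
by rewrite (perm_big _ P)/= lerDl sumr_ge0// => x _; exact: qx_ge0.
Qed.

Lemma box_mass_bound N : mass (box N) <= \prod_i (1 - q i)^-1.
Proof.
rewrite /mass box_mass; apply: ler_prod => i _.
have /andP[q0 q1] := q01 i; rewrite sumr_ge0//=; last first.
  by move=> j _; rewrite exprn_ge0// ltW.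
have q1' : 0 < 1 - q i by rewrite subr_gt0.
rewrite -[leRHS]mul1r ler_pdivlMr// -(big_mkord xpredT (fun j => q i ^+ j)).
have -> : (\sum_(0 <= j < N) q i ^+ j) * (1 - q i) = 1 - q i ^+ N.
  elim: N => [|N IH]; first by rewrite big_geq// expr0 mul0r subrr.
  by rewrite big_nat_recr//= mulrDl IH exprSr; ring.
by rewrite gerBl exprn_ge0// ltW.
Qed.

Definition wmass : R := sup (range (fun N => mass (box N))).

Lemma wmass_has_sup : has_sup (range (fun N => mass (box N))).
Proof.
split; first by exists (mass (box 0)), 0%N.
by exists (\prod_i (1 - q i)^-1) => _ [N _ <-]; exact: box_mass_bound.
Qed.

Lemma mass_le_wmass s : uniq s -> mass s <= wmass.
Proof.
move=> us; have [N sN] := sub_box s.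
rewrite (le_trans (mass_sub us sN (box_uniq N)))//.
by apply: ub_le_sup; [case: wmass_has_sup|exists N].
Qed.

Lemma mass_cvg e : 0 < e -> exists N0, forall N, (N0 <= N)%N ->
  0 <= wmass - mass (box N) < e.
Proof.
move=> e0; have [_ [N _ <-] H] := sup_adherent e0 wmass_has_sup.
exists N => M NM; rewrite subr_ge0 mass_le_wmass ?box_uniq//=.
rewrite ltrBlDr -ltrBlDl (lt_le_trans H)//.
by apply: mass_sub; [exact: box_uniq|exact: box_sub|exact: box_uniq].
Qed.

Lemma wmass_ge1 : 1 <= wmass.
Proof.
have := @mass_le_wmass [:: 0] isT.
by rewrite /mass big_seq1 qx0.
Qed.

Definition psum s G : R[i] := \sum_(x <- s) (qx x)%:C * G x.

(** The list [s] need not be a box: the translate of a box occurs in [is_wsum_shift]. *)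
Lemma psum_tail N s G C : uniq s -> {subset box N <= s} ->
  (forall x, normc (G x) <= C) ->
  normc (psum s G - psum (box N) G) <= C * (wmass - mass (box N)).
Proof.
move=> us bs GC.
have P : perm_eq s (box N ++ [seq x <- s | x \notin box N]).
  apply: uniq_perm => //.
    rewrite cat_uniq box_uniq filter_uniq// andbT; apply/hasPn => x.
    by rewrite mem_filter => /andP[].
  move=> x; rewrite mem_cat mem_filter.
  by case xb: (x \in box N) => //=; rewrite bs.
rewrite /psum (perm_big _ P)/= big_cat/= addrAC subrr add0r.
have M : mass [seq x <- s | x \notin box N] <= wmass - mass (box N).
  rewrite lerBrDl /mass -big_cat/= -(perm_big _ P)/=; exact: mass_le_wmass.
have C0 : 0 <= C := le_trans (normc_ge0 _) (GC 0).
rewrite (le_trans _ (ler_wpM2l C0 M))// /mass mulr_sumr.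
elim: [seq _ <- _ | _] => [|x t IH]; first by rewrite !big_nil normc0.
rewrite !big_cons (le_trans (le_normcD _ _))// lerD// normcM normc_real.
by rewrite ger0_norm ?qx_ge0// mulrC ler_wpM2r ?qx_ge0.
Qed.

Definition is_wsum G (l : R[i]) := forall e, 0 < e -> exists N0, forall N,
  (N0 <= N)%N -> normc (psum (box N) G - l) < e.

Definition cbounded G := exists C, forall x, normc (G x) <= C.

Lemma wsum_ex G : cbounded G -> exists l, is_wsum G l.
Proof.
move=> [C GC]; have C0 : 0 <= C := le_trans (normc_ge0 _) (GC 0).
apply: cauchy_complex => e e0; pose d := e / (2 * (C + 1)).
have C1 : 0 < C + 1 by rewrite ltr_wpDl.
have d0 : 0 < d by rewrite divr_gt0// mulr_gt0.
have dE : 2 * (C + 1) * d = e by rewrite /d mulrC divfK// gt_eqF// mulr_gt0.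
have [N0 NP] := mass_cvg d0; exists N0.
have H N : (N0 <= N)%N -> normc (psum (box N) G - psum (box N0) G) <= C * d.
  move=> NN; rewrite (le_trans (psum_tail (box_uniq _) (box_sub NN) GC))//.
  by rewrite ler_wpM2l// ltW//; have /andP[] := NP N0 (leqnn _).
move=> m k /H Hm /H Hk; rewrite (le_lt_trans (normc_dist (psum (box N0) G) _ _))//.
rewrite (normcC (psum (box N0) G)) (le_lt_trans (lerD Hm Hk))// -dE; nra.
Qed.

Lemma is_wsum_uniq G l l' : is_wsum G l -> is_wsum G l' -> l = l'.
Proof.
move=> H H'; apply: normc_eq_of => e e0; have e20 : 0 < e / 2 by rewrite divr_gt0.
have [N NP] := H _ e20; have [N' N'P] := H' _ e20.
rewrite (le_trans (normc_dist (psum (box (maxn N N')) G) _ _))// (splitr e) lerD//.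
  by rewrite normcC ltW// NP// leq_maxl.
by rewrite ltW// N'P// leq_maxr.
Qed.

Lemma psum_lin s k G G' :
  psum s (fun x => k * G x + G' x) = k * psum s G + psum s G'.
Proof.
rewrite /psum mulr_sumr -big_split/=; apply: eq_bigr => x _.
by rewrite mulrDr mulrCA.
Qed.

Lemma is_wsum_lin k G G' l l' : is_wsum G l -> is_wsum G' l' ->
  is_wsum (fun x => k * G x + G' x) (k * l + l').
Proof.
move=> H H' e e0; have k0 : 0 < normc k + 1 by rewrite ltr_pwDr// normc_ge0.
have e20 : 0 < e / 2 by rewrite divr_gt0.
have [N1 N1P] := H _ (divr_gt0 e20 k0); have [N2 N2P] := H' _ e20.
exists (maxn N1 N2) => N; rewrite geq_max => /andP[/N1P h1 /N2P h2].
have -> : psum (box N) (fun x => k * G x + G' x) - (k * l + l') =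
  k * (psum (box N) G - l) + (psum (box N) G' - l') by rewrite psum_lin; ring.
rewrite (le_lt_trans (le_normcD _ _))// (splitr e) ler_ltD// normcM.
rewrite (@le_trans _ _ ((normc k + 1) * normc (psum (box N) G - l)))//.
  by rewrite ler_wpM2r ?normc_ge0// lerDl.
by rewrite mulrC -ler_pdivlMr// ltW.
Qed.

Lemma is_wsum_ge0 G l : (forall x, 0 <= G x) -> is_wsum G l -> 0 <= l.
Proof.
move=> G0 H; have P N : 0 <= psum (box N) G.
  by rewrite /psum sumr_ge0// => x _; rewrite mulr_ge0// ler0c qx_ge0.
have K e : 0 < e -> `|Im l| <= e /\ - e <= Re l.
  move=> /H[N /(_ N (leqnn _)) NP]; have [E E0] := complex_ge0 (P N).
  have := Im_le_normc (psum (box N) G - l); have := Re_le_normc (psum (box N) G - l).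
  rewrite ReB ImB [in Im (psum _ _)]E/= sub0r normrN.
  move=> /le_lt_trans/(_ NP) + /le_lt_trans/(_ NP)/ltW ->.
  by rewrite ltr_norml; split=> //; lra.
have i0 : Im l = 0.
  apply/eqP; rewrite -normr_le0; apply/ler_addgt0Pl => e /K[He _].
  by rewrite addr0.
rewrite lecE/= i0 eqxx/=; apply/ler_addgt0Pl => e /K[_ He]; lra.
Qed.

(** The error depends on [G] through [C] only; this is the uniformity in [tau] behind weak-*
    continuity. *)
Lemma is_wsum_tail N G C l : (forall x, normc (G x) <= C) -> is_wsum G l ->
  normc (psum (box N) G - l) <= C * (wmass - mass (box N)).
Proof.
move=> GC H; apply/ler_addgt0Pl => e e0; have [M MP] := H e e0.
pose K := maxn N M.
rewrite (le_trans (normc_dist (psum (box K) G) _ _))// addrC lerD//.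
  by rewrite ltW// MP// leq_maxr.
rewrite normcC; apply: psum_tail => //; first exact: box_uniq.
by apply: box_sub; rewrite leq_maxl.
Qed.

Lemma is_wsum_cst1 : is_wsum (fun=> 1) wmass%:C.
Proof.
move=> e e0; have [N0 NP] := mass_cvg e0; exists N0 => N /NP /andP[H1 H2].
have -> : psum (box N) (fun=> 1) = (mass (box N))%:C.
  by rewrite /psum /mass rmorph_sum; apply: eq_bigr => x _; rewrite mulr1.
by rewrite -rmorphB normc_real distrC ger0_norm.
Qed.

Lemma is_wsum_delta G : (forall x, x != 0 -> G x = 0) -> is_wsum G (G 0).
Proof.
move=> G0 e e0; exists 1%N => N N1; rewrite /psum (bigD1_seq 0)/= ?box_uniq//.
  rewrite big1 => [|x x0]; last by rewrite G0// mulr0.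
  by rewrite qx0 mul1r addr0 subrr normc0.
by rewrite mem_box; apply/forallP => i; rewrite ffunE.
Qed.

Definition wshift y G x : R[i] := if Zle y x then G (Zsub x y) else 0.

Lemma is_wsum_shift y G l : cbounded G -> is_wsum G l ->
  is_wsum (wshift y G) ((qx y)%:C * l).
Proof.
move=> [C GC] H; have C0 : 0 <= C := le_trans (normc_ge0 _) (GC 0).
have SC x : normc (wshift y G x) <= C.
  by rewrite /wshift; case: ifP => _; rewrite ?normc0.
have K N : normc (psum (box N) (wshift y G) - (qx y)%:C * psum (box N) G) <=
    C * (wmass - mass (box N)).
  (* The translated box, padded with the indices of the box that are not above [y]; there
     [wshift y G] is 0, and [s] now contains the box. *)
  pose s := [seq x <- box N | ~~ Zle y x] ++ [seq x + y | x <- box N].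
  have <- : psum s (wshift y G) = (qx y)%:C * psum (box N) G.
    rewrite /psum big_cat/= big_filter big1 => [|x yx]; last first.
      by rewrite /wshift (negbTE yx) mulr0.
    rewrite add0r big_map mulr_sumr; apply: eq_bigr => x _.
    by rewrite /wshift Zle_add ZaddK qxD rmorphM mulrA [_%:C * _%:C]mulrC.
  rewrite normcC; apply: psum_tail => //.
    rewrite cat_uniq filter_uniq ?box_uniq//= map_inj_uniq ?box_uniq ?andbT; last first.
      exact: Zaddr_inj.
    apply/hasPn => _ /mapP[x _ ->]; rewrite mem_filter negb_and negbK.
    by rewrite Zle_add.
  move=> x xN; rewrite mem_cat mem_filter xN andbT.
  case yx: (Zle y x) => //=; apply/mapP; exists (Zsub x y); last by rewrite ZsubK.
  move: xN; rewrite !mem_box => /forallP xN; apply/forallP => i.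
  by rewrite ffunE (leq_ltn_trans (leq_subr _ _)).
move=> e e0; have e20 : 0 < e / 2 by rewrite divr_gt0.
have C1 : 0 < C + 1 by rewrite ltr_wpDl.
have q1 : 0 < qx y + 1 by rewrite ltr_wpDl ?qx_ge0.
have [N1 N1P] := mass_cvg (divr_gt0 e20 C1).
have [N2 N2P] := H _ (divr_gt0 e20 q1).
exists (maxn N1 N2) => N; rewrite geq_max => /andP[/N1P/andP[h0 h1] /N2P h2].
rewrite (le_lt_trans (normc_dist ((qx y)%:C * psum (box N) G) _ _))// (splitr e).
rewrite ler_ltD//.
  rewrite (le_trans (K N))// (@le_trans _ _ ((C + 1) * (wmass - mass (box N))))//.
    by rewrite ler_wpM2r// lerDl.
  by rewrite mulrC -ler_pdivlMr// ltW.
rewrite -mulrBr normcM normc_real ger0_norm ?qx_ge0//.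
rewrite (@le_lt_trans _ _ ((qx y + 1) * normc (psum (box N) G - l)))//.
  by rewrite ler_wpM2r ?normc_ge0// lerDl.
by rewrite mulrC -ltr_pdivlMr.
Qed.

End WeightedSum.

(** * The weighted sum of vector functionals on the Fock space *)

Section FockFunctional.
Variable R : realType.
Local Open Scope complex_scope.
Variables (n : nat) (A : cstarAlgType R[i]) (alpha : Zplus n -> A -> A).
Hypothesis halpha : unital_dynamical_system alpha.
Variables (N : cstarAlgType R[i]) (w : Zplus n -> A -> N).
Hypothesis hN : toeplitz_nica_pimsner alpha w.
Local Notation Zp := (Zplus n).
Local Notation tiota := (tiota w).
Local Notation tV := (tV w).
Local Notation mono := (tnp_monomial w).
Local Notation E := (ffsupp Zp A).
Implicit Types (x y z : Zp) (a : A) (b v : N) (i j : 'I_n).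

Let alphaD x y a : alpha (x + y) a = alpha x (alpha y a).
Proof. by have [_ _ _ ->] := halpha. Qed.
Let alphaH x : star_hom (alpha x). Proof. by have [] := halpha. Qed.
Let alpha1 x : alpha x cone = cone. Proof. by have [] := halpha. Qed.
Let alpha0 a : alpha 0 a = a. Proof. by have [_ _ -> _] := halpha. Qed.

Section Vectors.
Variables (tau : A -> R[i]) (htau : state tau).

Definition delta_fun z x : A := if x == z then cone else 0.
Lemma delta_finsupp z : finsupp (delta_fun z).
Proof. by exists [:: z] => x; rewrite inE /delta_fun => /negbTE ->. Qed.
Definition delta z : E := exist _ _ (delta_finsupp z).

Local Notation fock := (fock n htau).
Local Notation cemb := (cemb (fock_psd n htau)).

Lemma state_alpha_bound z a : normc (tau (alpha z a)) <= nr a.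
Proof.
have cf : clin (fun a => tau (alpha z a)).
  by move=> k u v; rewrite (star_hom_lin (alphaH z)) (state_clin htau).
have pf : positive (fun a => tau (alpha z a)).
  move=> u; rewrite (star_homM (alphaH z)) (star_homS (alphaH z)).
  exact: state_positive.
have := positive_bound cf pf a.
by rewrite alpha1 (state_one htau) mul1r.
Qed.

Variable Phi : N -> fock -> fock.
Hypothesis rPhi : star_rep Phi.
Hypothesis PhiE : forall x a, Phi (w x a) = fock_V x \o fock_pi halpha a :> (fock -> fock).

Lemma fock_pi_one (F : fock) : fock_pi halpha cone F = F.
Proof.
apply: completion_fun_eq => g; rewrite fock_piE; apply: ceval_eq => x /=.
by rewrite /fock_diag star1 alpha1 cmul1l.
Qed.

Lemma Phi_tiota a (f : E) : Phi (tiota a) (cemb f) = cemb (aop (fock_aop halpha htau a) f).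
Proof.
rewrite PhiE; transitivity (fock_pi halpha a (cemb f)); last exact: clift_emb.
apply: completion_fun_eq => g; rewrite fock_VE.
by apply: ceval_eq => x /=; rewrite addr0.
Qed.

Lemma Phi_starV y (f : E) : Phi (star (tV y)) (cemb f) = cemb (shift_down y f).
Proof.
apply: inner_ext => F; rewrite (rep_star rPhi) starK PhiE /= fock_pi_one.
rewrite [RHS]innerC inner_emb [LHS]innerC; congr conjc.
by rewrite (inner_emb (fock_V y F)) fock_VE.
Qed.

Definition vec_fun z b : R[i] := inner (Phi b (cemb (delta z))) (cemb (delta z)).

Lemma nr_delta z : nr (cemb (delta z)) = 1.
Proof.
rewrite nr_cemb /sn /fock_form (@fform_sum _ _ _ _ (gns_psd htau) _ _ [:: z])//; last first.
  by move=> x; rewrite inE /= /delta_fun => /negbTE ->.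
rewrite big_seq1 /= /delta_fun eqxx /gns_form star1 cmul1l (state_one htau).
by rewrite sqrtr1.
Qed.

Lemma vec_fun_clin z : clin (vec_fun z).
Proof. exact: (rep_clin rPhi). Qed.

Lemma vec_fun_positive z : positive (vec_fun z).
Proof. exact: (rep_positive rPhi). Qed.

Lemma vec_fun_bound z b : normc (vec_fun z b) <= nr b.
Proof.
rewrite (le_trans (inner_CS _ _))// nr_delta mulr1.
by rewrite (le_trans (rep_bound rPhi _ _))// nr_delta mulr1.
Qed.

(** The adjoints of V_y and V_x send e_z to e_(z-y) and e_(z-x), or to 0. The diagonal action of [a]
    keeps the index, so only [x = y] contributes, with the value tau(alpha_(z-y)(a)). *)
Lemma vec_fun_mono z x a y : vec_fun z (mono x a y) =
  if x == y then wshift y (fun z => tau (alpha z a)) z else 0.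
Proof.
rewrite /vec_fun (monoE hN) !(rep_mul rPhi) Phi_starV Phi_tiota.
rewrite (rep_star rPhi) Phi_starV inner_emb.
rewrite -[ceval _ _]/(fock_form tau _ _) /fock_form /wshift.
set f := aop _ _; set g := shift_down _ _.
have b00 u : gns_form tau u 0 = 0.
  by rewrite /gns_form star0 cmul0l (clin0 (state_clin htau)).
have [yz|yz] := boolP (Zle y z); last first.
  rewrite (@fform_sum _ _ _ _ (gns_psd htau) _ _ [::])//; first by rewrite big_nil if_same.
  move=> u _; rewrite /f/= /delta_fun; case: eqP => [E'|_]; last exact: cmul0r.
  by case/negP: yz; rewrite -E' Zle_add.
rewrite (@fform_sum _ _ _ _ (gns_psd htau) _ _ [:: Zsub z y])//; last first.
  move=> u; rewrite inE /f/= /delta_fun.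
  have [<-|_ _] := eqVneq (u + y) z; last exact: cmul0r.
  by rewrite ZaddK eqxx.
rewrite big_seq1 /f /g /= /delta_fun ZsubK// eqxx.
have -> : (Zsub z y + x == z) = (x == y).
  rewrite -{2}(ZsubK yz) [LHS]eq_sym [RHS]eq_sym ![Zsub z y + _]addrC.
  by rewrite (inj_eq (@Zaddr_inj _ _)).
case: eqP => // _.
by rewrite /gns_form /fock_diag star1 cmul1l cmul1r.
Qed.

End Vectors.

Variable q : 'I_n -> R.
Hypothesis q01 : forall i, 0 < q i < 1.

(** The relation for V_i is conjugated: a positive functional is hermitian, and [q i] is real. *)
Lemma positive_kc_S (D : N -> R[i]) : clin D -> positive D ->
  (forall i b, D (tV (Zgen i) ** b) = (q i)%:C * D (b ** tV (Zgen i))) ->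
  forall i b, D (b ** star (tV (Zgen i))) = (q i)%:C * D (star (tV (Zgen i)) ** b).
Proof.
move=> cD pD H i b.
have := H i (star b); rewrite -[tV _ ** star b]starK starM starK => E'.
have := congr1 conjc E'; rewrite (positive_star cD pD) conjcK => ->.
rewrite rmorphM/= -[(conjc _)](positive_star cD pD) starM starK.
by rewrite oppr0.
Qed.

Lemma clin_mono_eq (D1 D2 : N -> R[i]) (M : R) : clin D1 -> clin D2 -> 0 <= M ->
  (forall v, normc (D1 v) <= M * nr v) -> (forall v, normc (D2 v) <= M * nr v) ->
  (forall x a y, D1 (mono x a y) = D2 (mono x a y)) -> forall v, D1 v = D2 v.
Proof.
move=> c1 c2 M0 b1 b2 H v.
have Hs u : mspan w u -> D1 u = D2 u.
  by elim=> [|x a y u' _ IH]; rewrite ?(clin0 c1) ?(clin0 c2) ?(clinD c1) ?(clinD c2) ?H ?IH.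
apply: normc_eq_of => e e0; have M1 : 0 < 2 * M + 1 by rewrite ltr_wpDl ?mulr_ge0.
have [b bs vb] := mspan_dense halpha hN v (divr_gt0 e0 M1).
have -> : D1 v - D2 v = D1 (v - b) - D2 (v - b).
  by rewrite (clinB c1) (clinB c2) (Hs b bs); ring.
rewrite (le_trans (le_normcD _ _))// normcN (le_trans (lerD (b1 _) (b2 _)))//.
have : nr (v - b) * (2 * M + 1) <= e by rewrite -ler_pdivlMr// ltW.
by have := nr_ge0 (v - b); nra.
Qed.

Lemma fock_functional (tau : A -> R[i]) : tracial_state tau -> exists psi : N -> R[i],
  [/\ state psi, kms_class w q psi,
    forall x a y, psi (mono x a y) = if x == y then (qx q x)%:C * psi (tiota a) else 0,
    forall a, is_wsum q (fun z => tau (alpha z a)) ((wmass q)%:C * psi (tiota a)) &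
    forall a, (wmass q)%:C * psi (tiota a ** tprojs w (enum 'I_n)) = tau a].
Proof.
move=> [htau ttau].
have [Phi rPhi PhiE] := tnp_universal hN (fock_nica halpha htau).
pose g b z := vec_fun Phi z b.
have gb b : cbounded (g b) by exists (nr b) => z; exact: vec_fun_bound rPhi z b.
pose S b : R[i] := sval (cid (wsum_ex q01 (gb b))).
have SP b : is_wsum q (g b) (S b) by exact: (svalP (cid (wsum_ex q01 (gb b)))).
have W1 := wmass_ge1 q01; set W := wmass q in W1 *.
have W0 : 0 < W by rewrite (lt_le_trans ltr01).
have Wn0 : W%:C != 0 by rewrite eq_complex/= gt_eqF.
pose psi b := (W%:C)^-1 * S b.
have WpsiE b : W%:C * psi b = S b by rewrite /psi mulrA divff ?mul1r.
have psiP b : is_wsum q (g b) (W%:C * psi b) by rewrite WpsiE.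
have psi_uniq b l : is_wsum q (g b) (W%:C * l) -> psi b = l.
  by move=> H; apply: (mulfI Wn0); apply: is_wsum_uniq (psiP b) H.
have cpsi : clin psi.
  move=> k u v; apply: psi_uniq; rewrite mulrDr mulrCA.
  have := is_wsum_lin k (psiP u) (psiP v); congr is_wsum.
  by apply/funext => z; rewrite /g (vec_fun_clin rPhi z).
have ppsi : positive psi.
  move=> a; rewrite /psi mulr_ge0//; first by rewrite invr_ge0 ler0c ltW.
  by apply: is_wsum_ge0 (SP _) => // z; exact: (vec_fun_positive rPhi z).
have mono1 : cone = mono 0 cone 0.
  by rewrite (monoE hN) (tV0 halpha hN) (tiota1 halpha hN) star1 !cmul1l.
have psi1 : psi cone = 1.
  apply: psi_uniq; rewrite mulr1; have := is_wsum_cst1 q01; congr is_wsum.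
  apply/funext => z; rewrite /g mono1 (vec_fun_mono rPhi PhiE) eqxx /wshift.
  rewrite alpha1 (state_one htau).
  by rewrite (_ : Zle _ _ = true)//; apply/ZleP => i; rewrite ffunE.
have spsi : state psi by exact: positive_state.
have psib v : normc (psi v) <= nr v.
  by have := positive_bound cpsi ppsi v; rewrite psi1 mul1r.
have tiota_mono a : tiota a = mono 0 a 0.
  by rewrite (monoE hN) (tV0 halpha hN) star1 cmul1l cmul1r.
have psiT a : is_wsum q (fun z => tau (alpha z a)) (W%:C * psi (tiota a)).
  have := psiP (tiota a); congr is_wsum; apply/funext => z.
  rewrite /g tiota_mono (vec_fun_mono rPhi PhiE) eqxx /wshift.
  rewrite (_ : Zle _ _ = true); last by apply/ZleP => i; rewrite ffunE.
  by congr (tau (alpha _ _)); apply/ffunP => i; rewrite !ffunE subn0.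
have tb a : cbounded (fun z => tau (alpha z a)).
  by exists (nr a) => z; exact: state_alpha_bound.
(* Translating the index by [x] multiplies a weighted sum by [qx q x]. *)
have psim x a y : psi (mono x a y) = if x == y then (qx q x)%:C * psi (tiota a) else 0.
  apply: psi_uniq; rewrite (_ : g _ = fun z => if x == y then
      wshift y (fun z => tau (alpha z a)) z else 0); last first.
    by apply/funext => z; rewrite /g (vec_fun_mono rPhi PhiE).
  case: eqP => [->|_]; last by rewrite mulr0; exact: (@is_wsum_delta _ _ _ (fun=> 0)).
  by rewrite mulrCA; apply: is_wsum_shift.
have psiTT a c : psi (tiota (a ** c)) = psi (tiota (c ** a)).
  apply: (mulfI Wn0); apply: is_wsum_uniq (psiT _) _.
  have := psiT (c ** a); congr is_wsum; apply/funext => z.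
  by rewrite !(star_homM (alphaH z)) ttau.
have bnd (u : N) : forall v, normc (psi (u ** v)) <= nr u * nr v.
  by move=> v; rewrite (le_trans (psib _))// nrM.
have bnd' (u : N) : forall v, normc (psi (v ** u)) <= nr u * nr v.
  by move=> v; rewrite (le_trans (psib _))// mulrC nrM.
have clinM (u : N) : clin (fun v => psi (u ** v)).
  by move=> k v v'; rewrite cmulDr cmulZr cpsi.
have clinM' (u : N) : clin (fun v => psi (v ** u)).
  by move=> k v v'; rewrite cmulDl cmulZl cpsi.
have kV i b : psi (tV (Zgen i) ** b) = (q i)%:C * psi (b ** tV (Zgen i)).
  have /andP[qi0 qi1] := q01 i.
  apply: (@clin_mono_eq (fun b => psi (tV (Zgen i) ** b))
    (fun b => (q i)%:C * psi (b ** tV (Zgen i))) (nr (tV (Zgen i)))) => //.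
  - by move=> k u v; rewrite clinM' mulrDr mulrCA.
  - exact: nr_ge0.
  - move=> v; rewrite normcM normc_real (ger0_norm (ltW qi0)) (le_trans _ (bnd' _ _))//.
    by rewrite ler_piMl ?normc_ge0// ltW.
  move=> x a y.
  have -> : tV (Zgen i) ** mono x a y = mono (Zgen i + x) a y.
    by rewrite !(monoE hN) (tVD halpha hN) !cmulA.
  have [yi|yi] := posnP (y i); last first.
    have gy : Zle (Zgen i) y by rewrite Zgen_le.
    have -> : mono x a y ** tV (Zgen i) = mono x a (Zsub y (Zgen i)).
      rewrite !(monoE hN) -{1}(ZsubK gy) (tVD halpha hN) (tV_comm halpha hN) starM.
      by rewrite -!cmulA (tV_isom halpha hN) cmul1r.
    rewrite !psim -{1}(ZsubK gy) [Zgen i + x]addrC (inj_eq (@Zaddr_inj _ _)).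
    by case: eqP => _; rewrite ?mulr0// qxD qx_gen rmorphM mulrA [_%:C * _%:C]mulrC.
  (* When [y i = 0] both sides vanish: [Zgen i + x] is positive at [i], so it differs from [y]. *)
  have -> : mono x a y ** tV (Zgen i) = mono (Zgen i + x) (alpha (Zgen i) a) y.
    rewrite !(monoE hN) -!cmulA (starV_tV_gen halpha hN)// (cmulA (tiota a)).
    by rewrite (tiota_tV halpha hN) (tVD halpha hN) (tV_comm halpha hN) !cmulA.
  rewrite !psim; case: eqP => [E'|_]; last by rewrite mulr0.
  by move: yi; rewrite -E' ZaddE ffunE eqxx.
have kA c b : psi (tiota c ** b) = psi (b ** tiota c).
  apply: (@clin_mono_eq (fun b => psi (tiota c ** b)) (fun b => psi (b ** tiota c))
    (nr (tiota c))) => //; first exact: nr_ge0.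
  move=> x a y.
  have -> : tiota c ** mono x a y = mono x (alpha x c ** a) y.
    by rewrite !(monoE hN) (tiotaM hN) !cmulA (tiota_tV halpha hN).
  have -> : mono x a y ** tiota c = mono x (a ** alpha y c) y.
    by rewrite !(monoE hN) (tiotaM hN) -!cmulA (starV_tiota halpha hN).
  by rewrite !psim; case: eqP => // ->; rewrite psiTT.
have kc : kms_class w q psi.
  split=> //; last exact: positive_kc_S.
  by exists 1 => // v; rewrite mul1r.
exists psi; split => // a.
(* Multiplication by [tproj i] discards the indices with [z i > 0]: the weighted sum of [G s a] is
   [W%:C * psi (tiota a ** tprojs w s)], and for the full list only the index 0 remains. *)
pose G s a z := if all (fun i => z i == 0%N) s then tau (alpha z a) else 0.
have Gb s c : cbounded (G s c).
  exists (nr c) => z; rewrite /G; case: ifP => _; first exact: state_alpha_bound.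
  by rewrite normc0 nr_ge0.
have Gstep (i : 'I_n) (s : seq 'I_n) c z : i \notin s ->
    -1 * wshift (Zgen i) (G s (alpha (Zgen i) c)) z + G s c z = G (i :: s) c z.
  move=> si; rewrite /G /= /wshift Zgen_le.
  case: posnP => zi; first by rewrite mulr0 add0r.
  have -> : all (fun j => Zsub z (Zgen i) j == 0%N) s = all (fun j => z j == 0%N) s.
    apply: eq_in_all => j js; rewrite [Zsub z _ j]ffunE [Zgen i j]ffunE.
    have -> : (j == i) = false by apply: contraNF si => /eqP <-.
    by rewrite subn0.
  have gz : Zle (Zgen i) z by rewrite Zgen_le.
  by rewrite -alphaD ZsubK//= mulN1r addNr.
have GP (s : seq 'I_n) : uniq s ->
    forall c, is_wsum q (G s c) (W%:C * psi (tiota c ** tprojs w s)).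
  elim: s => [_ c|i s IH /andP[si us] c]; first by rewrite cmul1r; exact: psiT.
  rewrite (peel halpha hN kc c si) mulrBr addrC -mulN1r.
  have := is_wsum_lin (-1) (@is_wsum_shift _ _ _ q01 (Zgen i) _ _ (Gb s _)
    (IH us (alpha (Zgen i) c))) (IH us c).
  rewrite qx_gen (mulrCA (W%:C) (q i)%:C); congr is_wsum; apply/funext => z.
  exact: Gstep.
have H := GP _ (enum_uniq 'I_n) a.
apply: is_wsum_uniq H _.
have <- : G (enum 'I_n) a 0 = tau a.
  rewrite /G (_ : all _ _ = true) ?alpha0//.
  by apply/allP => i _; rewrite ffunE.
apply: is_wsum_delta => z z0; rewrite /G; case: ifP => // /allP H'.
case/eqP: z0; apply/ffunP => i; rewrite ffunE; apply/eqP/H'.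
by rewrite mem_enum.
Qed.

End FockFunctional.

(** * The KMS condition and the gauge flow *)

Section ComplexExponential.
Variable R : realType.
Local Open Scope complex_scope.
Implicit Types (s t mu e : R) (z : R[i]).

Lemma expiD s t : expi (s + t) = expi s * expi t.
Proof. by rewrite /expi cosD sinD; simpc; congr (_ +i* _); rewrite addrC. Qed.

Lemma expi0 : expi 0 = 1 :> R[i].
Proof. by rewrite /expi cos0 sin0. Qed.

Lemma normc_expi s : normc (expi s) = 1.
Proof. by rewrite normcE2/= cos2Dsin2 sqrtr1. Qed.

Lemma norm_expi s : `|expi s| = 1.
Proof. by rewrite normc_norm normc_expi. Qed.

Lemma expi_neq0 s : expi s != 0.
Proof. by apply/eqP => /(congr1 (@normc R)); rewrite normc_expi normc0 => /eqP; rewrite oner_eq0. Qed.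

Lemma expiN s : expi (- s) = (expi s)^-1.
Proof.
apply: (mulfI (expi_neq0 s)); rewrite -expiD subrr expi0 mulfV//.
exact: expi_neq0.
Qed.

Lemma expi_exprz s (m : int) : expi s ^ m = expi (s * m%:~R).
Proof.
have nat_case (k : nat) : expi s ^+ k = expi (s * k%:R).
  elim: k => [|k IH]; first by rewrite mulr0 expi0.
  by rewrite exprS IH -expiD -natr1 mulrDr mulr1 addrC.
case: m => k; first exact: nat_case.
rewrite NegzE -exprnN rmorphN mulrN expiN; congr (_^-1).
exact: nat_case.
Qed.

Lemma expi_prod (I : Type) (r : seq I) (F : I -> R) :
  \prod_(i <- r) expi (F i) = expi (\sum_(i <- r) F i).
Proof. by symmetry; apply: (big_morph (@expi R) expiD expi0). Qed.

(* exp(i mu z) *)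
Definition cexpi mu z : R[i] := (expR (- (mu * Im z)))%:C * expi (mu * Re z).

Lemma cexpiD mu z w : cexpi mu (z + w) = cexpi mu z * cexpi mu w.
Proof.
by rewrite /cexpi ReD ImD !mulrDr opprD expRD expiD rmorphM mulrACA.
Qed.

Lemma cexpi_real mu t : cexpi mu t%:C = expi (mu * t).
Proof. by rewrite /cexpi/= mulr0 oppr0 expR0 mul1r. Qed.

Lemma cexpi_imag mu t : cexpi mu (0 +i* t) = (expR (- (mu * t)))%:C.
Proof. by rewrite /cexpi/= mulr0 expi0 mulr1. Qed.

Lemma normc_cexpi mu z : normc (cexpi mu z) = expR (- (mu * Im z)).
Proof. by rewrite /cexpi normcM normc_expi mulr1 normc_real ger0_norm ?expR_ge0. Qed.

Lemma derive_at0 (f : R -> R) (d : R) : is_derive (0 : R) (1 : R) f d -> forall e, 0 < e ->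
  exists2 dl, 0 < dl & forall h, `|h| < dl -> `|f h - f 0 - d * h| <= e * `|h|.
Proof.
move=> [df fd] e e0; have /cvgrPdist_lt/(_ e e0)[dl /= dl0 dlP] := df.
exists dl => // h hd; have [->|h0] := eqVneq h 0.
  by rewrite mulr0 subr0 subrr normr0 mulr0.
have := dlP h; rewrite /= sub0r normrN => /(_ hd h0) /=.
rewrite -[lim _]/('D_1 f 0) fd scaler1 addr0 => H.
have -> : f h - f 0 - d * h = - ((d - h^-1 *: (f h - f 0)) * h).
  by rewrite /GRing.scale/=; field.
by rewrite normrN normrM ler_wpM2r// ltW.
Qed.

(** The derivative i mu is assembled from the first-order expansions at 0 of [expR], [sin] and
    [cos]; by [cexpiD] the origin is the only point to treat. *)
Lemma cexpi_cdiff0 mu : cdiff (cexpi mu) 0.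
Proof.
exists (0 +i* mu) => e e0.
pose m := `|mu| + 1; have m0 : 0 < m by rewrite ltr_pwDr.
have ce : cexpi mu 0 = 1 by rewrite -[0]/(0%:C) cexpi_real mulr0 expi0.
(* The error terms add up to eight times [r * |x|] and once [r * |y|], where |x| and |y| are at most
   [m] times the modulus of the increment. *)
pose r := Num.min 1 (e / (9 * m)); have r0 : 0 < r by rewrite lt_min ltr01 divr_gt0// mulr_gt0.
have r1 : r <= 1 by rewrite ge_min lexx.
have rm : r * (9 * m) <= e by rewrite -ler_pdivlMr ?mulr_gt0// ge_min lexx orbT.
have de : is_derive (0 : R) (1 : R) (@expR R) 1.
  by rewrite -[X in is_derive _ _ _ X]expR0; exact: is_derive_expR.
have ds : is_derive (0 : R) (1 : R) (@sin R) 1.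
  by rewrite -[X in is_derive _ _ _ X]cos0; exact: is_derive_sin.
have dc : is_derive (0 : R) (1 : R) (@cos R) 0.
  by have := is_derive_cos (0 : R); rewrite sin0 oppr0.
have [d1 d10 H1] := derive_at0 de r0.
have [d2 d20 H2] := derive_at0 ds r0.
have [d3 d30 H3] := derive_at0 dc r0.
pose d := Num.min (Num.min d1 d2) (Num.min d3 (r / m)).
have d0 : 0 < d by rewrite !lt_min d10 d20 d30 divr_gt0.
exists (d / m) => [|w]; first by rewrite divr_gt0.
rewrite subr0 ltr_pdivlMr// => wd; rewrite ce.
case: w wd => a b wd.
have ha : `|a| <= normc (a +i* b) := Re_le_normc (a +i* b).
have hb : `|b| <= normc (a +i* b) := Im_le_normc (a +i* b).
set W := normc _ in wd ha hb *.
pose x := mu * a; pose y := - (mu * b).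
have hm : `|mu| <= m by rewrite lerDl.
have hx : `|x| <= W * m by rewrite normrM mulrC ler_pM.
have hy : `|y| <= W * m by rewrite normrN normrM mulrC ler_pM.
have xd : `|x| < d by apply: le_lt_trans wd.
have yd : `|y| < d by apply: le_lt_trans wd.
move: xd yd; rewrite !lt_min => /andP[/andP[_ x2] /andP[x3 _]] /andP[/andP[y1 _] /andP[_ yr]].
have := H1 y y1; have := H2 x x2; have := H3 x x3.
rewrite expR0 sin0 cos0 !mul1r mul0r !subr0 => c3 c2 c1.
have ym : `|y| <= r.
  rewrite (le_trans (ltW yr))// ler_pdivrMr// /m mulrDr mulr1 lerDr.
  by rewrite mulr_ge0// ltW.
have ey : expR y <= 3.
  by have := ler_norm (expR y - 1 - y); have := ler_norm y; nra.
have ey0 := expR_ge0 y.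
rewrite (le_trans (normc_le_ReIm _))// /cexpi /expi -/x -/y.
have -> : Re ((expR y)%:C * (cos x +i* sin x) - 1 - (0 +i* mu) * (a +i* b)) =
  expR y * (cos x - 1) + (expR y - 1 - y) by rewrite /= /y; ring.
have -> : Im ((expR y)%:C * (cos x +i* sin x) - 1 - (0 +i* mu) * (a +i* b)) =
  expR y * (sin x - x) + (expR y - 1 - y) * x + y * x by rewrite /= /x; ring.
have W0 : 0 <= W := normc_ge0 _.
have t1 : `|expR y * (cos x - 1) + (expR y - 1 - y)| <= 3 * (r * `|x|) + r * `|y|.
  rewrite (le_trans (ler_normD _ _))// lerD// normrM (ger0_norm ey0) ler_pM//.
have t2 : `|expR y * (sin x - x) + (expR y - 1 - y) * x + y * x| <=
    3 * (r * `|x|) + r * `|x| + r * `|x|.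
  rewrite (le_trans (ler_normD _ _))// lerD//.
    rewrite (le_trans (ler_normD _ _))// lerD//.
      by rewrite normrM (ger0_norm ey0) ler_pM.
    rewrite normrM ler_wpM2r// (le_trans c1)//.
    by rewrite ler_piMr ?(ltW r0)// (le_trans ym).
  by rewrite normrM ler_wpM2r.
rewrite (le_trans (lerD t1 t2))//.
have hx' : r * `|x| <= r * (W * m) by rewrite ler_wpM2l// ltW.
have hy' : r * `|y| <= r * (W * m) by rewrite ler_wpM2l// ltW.
have : r * (9 * m) * W <= e * W by rewrite ler_wpM2r.
move: (r * `|x|) (r * `|y|) hx' hy' => X Y; lra.
Qed.

Lemma cexpi_cdiff mu z : cdiff (cexpi mu) z.
Proof.
apply: (@cdiff_ext _ (fun w => cexpi mu z * cexpi mu (- z + 1 * w))).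
  by exists 1 => // w _; rewrite -cexpiD mul1r addrA subrr add0r.
apply: cdiffM; first exact: cdiff_cst.
apply: cdiff_affine_comp; rewrite mul1r addNr; exact: cexpi_cdiff0.
Qed.

End ComplexExponential.

Section VectorDerivative.
Variable R : realType.
Local Open Scope complex_scope.
Variable V : normedModType R[i].
Implicit Types (f g : R[i] -> V) (z w : R[i]) (v : V) (e : R).

Lemma vdiff_scale (h : R[i] -> R[i]) v z : cdiff h z -> vdiff (fun w => h w *: v) z.
Proof.
move=> [k kP]; exists (k *: v) => e e0.
have v0 : 0 < nr v + 1 by rewrite ltr_pwDr// nr_ge0.
have [d d0 dP] := kP _ (divr_gt0 e0 v0); exists d => // w /dP H.
rewrite -scalerBl scalerA -scalerBl nrZ [_ * k]mulrC.
rewrite (le_trans (ler_wpM2r (nr_ge0 _) H))// mulrAC ler_wpM2r ?normc_ge0//.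
by rewrite mulrAC ler_pdivrMr// ler_pM2l// lerDl.
Qed.

Lemma vdiff_add f g z : vdiff f z -> vdiff g z -> vdiff (fun w => f w + g w) z.
Proof.
by move=> /vdiffP ? /vdiffP ?; apply/vdiffP; exact: derivableD.
Qed.

Lemma vdiff_cst v z : vdiff (fun=> v) z.
Proof. by apply/vdiffP; exact: derivable_cst. Qed.

Lemma vdiff_shift f t z : vdiff f (z + t) -> vdiff (fun w => f (w + t)) z.
Proof.
move=> [k kP]; exists k => e /kP[d d0 dP]; exists d => // w wz.
by have := dP (w + t); rewrite opprD addrACA subrr addr0; apply.
Qed.

Lemma vdiff_functional f (L : V -> R[i]) (M : R) z : clin L ->
  (forall v, normc (L v) <= M * nr v) -> vdiff f z -> cdiff (fun w => L (f w)) z.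
Proof.
move=> cL LM [k kP]; exists (L k) => e e0.
have M1 : 0 < `|M| + 1 by rewrite ltr_pwDr.
have [d d0 dP] := kP _ (divr_gt0 e0 M1); exists d => // w /dP H.
rewrite mulrC -(clinZ cL) -!(clinB cL) (le_trans (LM _))//.
rewrite (@le_trans _ _ ((`|M| + 1) * nr (f w - f z - (w - z) *: k)))//.
  by rewrite ler_wpM2r ?nr_ge0// (le_trans (ler_norm _))// lerDl.
by rewrite (le_trans (ler_wpM2l (ltW M1) H))// mulrA mulrCA divff ?mulr1// gt_eqF.
Qed.

(** A bound on one vertical segment is enough for a strip, since the contractive flow moves it along
    the real direction. *)
Lemma vdiff_vline_bound f (c d : R) : c <= d -> (forall z, vdiff f z) ->
  exists2 M, 0 <= M & forall y, c <= y <= d -> nr (f (0 +i* y)) <= M.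
Proof.
move=> cd df; pose g y := nr (f (0 +i* y)).
have cg : {within `[c, d], continuous g}.
  apply: continuous_subspaceT => y; apply/cvgrPdist_lt => e e0.
  have [dl dl0 dlP] := vdiff_cont (df (0 +i* y)) e0.
  exists dl => // x xy; rewrite /= in xy.
  have H : nr (f (0 +i* x) - f (0 +i* y)) < e.
    by apply: dlP; rewrite (le_lt_trans (normc_vline _ _ _))// distrC.
  rewrite (le_lt_trans _ H)// /g ler_norml.
  have := nrD (f (0 +i* x) - f (0 +i* y)) (f (0 +i* y)); rewrite subrK.
  have := nrD (f (0 +i* y) - f (0 +i* x)) (f (0 +i* x)); rewrite subrK nrC.
  lra.
have [x _ xP] := EVT_max cd cg.
by exists (g x) => [|y ycd]; [exact: nr_ge0|apply: xP; rewrite in_itv].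
Qed.

End VectorDerivative.

(** * Transfer of the KMS condition to eigenvectors of the flow *)

Section KMSEigenvectors.
Variable R : realType.
Local Open Scope complex_scope.
Variables (N : cstarAlgType R[i]) (sigma : R -> N -> N).
Hypothesis sigma_lin : forall t k u v, sigma t (k *: u + v) = k *: sigma t u + sigma t v.
Hypothesis sigma_nr : forall t v, nr (sigma t v) <= nr v.
Hypothesis sigmaD : forall s t v, sigma (s + t) v = sigma s (sigma t v).
Variables (beta : R) (psi : N -> R[i]).
Implicit Types (a b v : N) (t y e mu : R) (f : R[i] -> N).

Lemma entire_vdiff f : entire f -> forall z, vdiff f z.
Proof. by move=> ef z; apply/vdiffP; exact: ef. Qed.

Section Functional.
Hypothesis spsi : state psi.
Let cpsi := state_clin spsi.

Lemma state_bound v : normc (psi v) <= nr v.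
Proof.
by have := positive_bound cpsi (state_positive spsi) v; rewrite (state_one spsi) mul1r.
Qed.

Lemma mul_functional b : clin (fun v => psi (b ** v)) /\
  forall v, normc (psi (b ** v)) <= nr b * nr v.
Proof.
split=> [k u v|v]; first by rewrite cmulDr cmulZr cpsi.
by rewrite (le_trans (state_bound _))// nrM.
Qed.

(** The identity theorem for the scalar functions obtained through v |-> psi(b v): it transfers the
    KMS identity from one extension of [a] to any other. *)
Lemma extension_unique a f g : analytic_extension sigma a f ->
  analytic_extension sigma a g -> forall b z, psi (b ** f z) = psi (b ** g z).
Proof.
move=> [ef fs] [eg gs] b z; have [cb bb] := mul_functional b.
apply/eqP; rewrite -subr_eq0 -mulN1r; apply/eqP.
apply: (@entire_eq0 R (fun z => psi (b ** f z) + -1 * psi (b ** g z))) => [w|t].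
  apply: cdiffD; last apply: cdiffM; last 2 first.
  - exact: cdiff_cst.
  - exact: vdiff_functional cb bb (entire_vdiff eg w).
  exact: vdiff_functional cb bb (entire_vdiff ef w).
by rewrite fs gs mulN1r subrr.
Qed.

(** The group law sigma_(z+t) = sigma_t sigma_z for complex z, seen through psi: both sides are
    entire in z and agree for real z. *)
Lemma extension_translate a f b z t : analytic_extension sigma a f ->
  psi (b ** f (z + t%:C)) = psi (b ** sigma t (f z)).
Proof.
move=> [ef fs]; have [cb bb] := mul_functional b.
apply/eqP; rewrite -subr_eq0 -mulN1r; apply/eqP.
apply: (@entire_eq0 R (fun z => psi (b ** f (z + t%:C)) + -1 * psi (b ** sigma t (f z))))
  => [w|s].
  apply: cdiffD; last apply: cdiffM; last 2 first.
  - exact: cdiff_cst.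
  - apply: (@vdiff_functional _ _ f (fun v => psi (b ** sigma t v)) (nr b)).
    + by move=> k u v; rewrite sigma_lin cb.
    + by move=> v; rewrite (le_trans (bb _))// ler_wpM2l ?nr_ge0.
    + exact: entire_vdiff.
  apply: (vdiff_functional cb bb); apply: vdiff_shift; exact: entire_vdiff.
by rewrite -rmorphD !fs [s + t]addrC sigmaD mulN1r subrr.
Qed.

Lemma extension_shift a f t : analytic_extension sigma a f ->
  analytic_extension sigma (sigma t a) (fun z => f (z + t%:C)).
Proof.
move=> [ef fs]; split=> [z|s]; last by rewrite -rmorphD fs sigmaD.
apply/vdiffP; apply: vdiff_shift; exact: entire_vdiff.
Qed.

End Functional.

Lemma KMS_eigenvector : KMS_state sigma beta psi -> forall mu v,
  (forall t, sigma t v = expi (mu * t) *: v) ->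
  forall b, psi (v ** b) = (expR (- (mu * beta)))%:C * psi (b ** v).
Proof.
move=> [spsi [B [[sB dB] Bs Ba BK]]] mu v sv b.
have cpsi := state_clin spsi.
(* By continuity the second factor may be any element of [N]. *)
have BK' a f c : B a -> analytic_extension sigma a f ->
    psi (a ** c) = psi (c ** f (0 +i* beta)).
  move=> aB af; apply: normc_eq_of => e e0.
  pose K := nr a + nr (f (0 +i* beta)) + 1.
  have K0 : 0 < K by rewrite ltr_pwDr// addr_ge0 ?nr_ge0.
  have [c' c'B cc] := (dense_nr B).1 dB c _ (divr_gt0 e0 K0).
  have -> : psi (a ** c) - psi (c ** f (0 +i* beta)) =
      psi (a ** (c - c')) - psi ((c - c') ** f (0 +i* beta)).
    rewrite cmulBr cmulBl !(clinB cpsi) (BK a c' f)//; ring.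
  rewrite (le_trans (le_normcD _ _))// normcN.
  rewrite (le_trans (lerD (state_bound spsi _) (state_bound spsi _)))//.
  rewrite (le_trans (lerD (nrM _ _) (nrM _ _)))//.
  have : nr (c - c') * K <= e by rewrite -ler_pdivlMr// ltW.
  have := nr_ge0 (c - c'); rewrite /K; nra.
pose E := expR (mu * beta); have E0 : 0 < E := expR_gt0 _.
suff H : psi (b ** v) = E%:C * psi (v ** b).
  by rewrite H mulrA -rmorphM expRN mulVf ?mul1r// gt_eqF.
apply: normc_eq_of => e e0.
(* The conclusion of [strip_average] for the error [(E + 1) * (nr b + 1) * d] on both lines is then
   exactly [e]. *)
pose K := 4 * (E + 1) * (nr b + 1).
have nb := nr_ge0 b; have K0 : 0 < K by rewrite !mulr_gt0// ltr_wpDl// ltW.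
pose d := e / K; have d0 : 0 < d by rewrite divr_gt0.
have dK : K * d = e by rewrite /d mulrC divfK// gt_eqF.
have [a aB va] := (dense_nr B).1 dB v _ d0.
have [f af] := Ba a aB; have [ef fs] := af.
have [cb bb] := mul_functional spsi b.
pose G z := cexpi (- mu) z * psi (b ** f z).
have dG z : cdiff G z.
  apply: cdiffM; first exact: cexpi_cdiff.
  exact: vdiff_functional cb bb (entire_vdiff ef z).
have svN t : expi (- mu * t) *: sigma t v = v.
  by rewrite sv scalerA -expiD mulNr addNr expi0 scale1r.
have sB' t u u' : sigma t (u - u') = sigma t u - sigma t u'.
  have := sigma_lin t (-1) u' u; rewrite !scaleN1r addrC => ->.
  by rewrite addrC.
have av t : nr (expi (- mu * t) *: sigma t a - v) <= d.
  rewrite -[X in _ - X](svN t) -scalerBr nrZ normc_expi mul1r -sB' (le_trans (sigma_nr _ _))//.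
  by rewrite nrC ltW.
have L0 t : normc (G (t +i* 0) - psi (b ** v)) <= (E + 1) * (nr b + 1) * d.
  rewrite /G -[t +i* 0]/(t%:C) fs cexpi_real -(clinZ cpsi) -cmulZr -(clinB cpsi) -cmulBr.
  rewrite (le_trans (state_bound spsi _))// (le_trans (nrM _ _))//.
  rewrite (le_trans (ler_wpM2l nb (av t)))//; rewrite ler_wpM2r ?ltW//; nra.
have L1 t : normc (G (t +i* beta) - E%:C * psi (v ** b)) <= (E + 1) * (nr b + 1) * d.
  have ztE : t +i* beta = 0 +i* beta + t%:C by simpc.
  (* The KMS condition is applied to [sigma t a], which stays in [B] and has the translated function
     as its extension. *)
  have -> : G (t +i* beta) = E%:C * psi ((expi (- mu * t) *: sigma t a) ** b).
    rewrite /G ztE cexpiD cexpi_imag cexpi_real mulNr opprK -/E.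
    rewrite -(BK' _ _ b (Bs t a aB) (extension_shift t af)).
    by rewrite cmulZl (clinZ cpsi) mulrA.
  rewrite -mulrBr normcM normc_real (ger0_norm (ltW E0)) -(clinB cpsi) -cmulBl.
  rewrite -mulrA; apply: ler_pM; [exact: ltW|exact: normc_ge0|by rewrite lerDl|].
  rewrite (le_trans (state_bound spsi _))// (le_trans (nrM _ _))// mulrC.
  by rewrite ler_pM ?nr_ge0// lerDl.
(* Contractivity of the flow reduces the bound on a horizontal strip to the vertical segment at real
   part 0. *)
have bnd c c' : c <= c' -> exists2 M, 0 <= M &
    forall t y, c <= y <= c' -> normc (G (t +i* y)) <= M.
  move=> cc; have [M M0 MP] := vdiff_vline_bound cc (entire_vdiff ef).
  exists (expR (`|mu| * (`|c| + `|c'|)) * (nr b * M)).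
    by rewrite !mulr_ge0 ?expR_ge0.
  move=> t y ycc; rewrite /G normcM normc_cexpi ler_pM ?expR_ge0 ?normc_ge0//.
    rewrite ler_expR/= mulNr opprK (le_trans (ler_norm _))// normrM ler_wpM2l//.
    have := ler_norm c; have := ler_norm (- c); have := ler_norm c'; have := ler_norm (- c').
    rewrite !normrN ler_norml; lra.
  have -> : t +i* y = 0 +i* y + t%:C by simpc.
  rewrite (extension_translate spsi b _ _ af) (le_trans (bb _))// ler_wpM2l//.
  by rewrite (le_trans (sigma_nr _ _))// MP.
have KE : 4 * ((E + 1) * (nr b + 1) * d) = e by rewrite -dK /K; ring.
(* For negative [beta] the strip lies below the real line, and the two lines exchange their
   roles. *)
rewrite -KE; have [b0|b0] := leP 0 beta.
  have [M M0 MP] := bnd _ _ b0; exact: (strip_average b0 M0 dG L0 L1 MP).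
have [M M0 MP] := bnd _ _ (ltW b0); rewrite normcC.
exact: (strip_average (ltW b0) M0 dG L1 L0 MP).
Qed.

End KMSEigenvectors.

(** * The gauge flow and its monomial eigenvectors *)

Section GaugeFlow.
Variable R : realType.
Local Open Scope complex_scope.
Variables (n : nat) (A : cstarAlgType R[i]) (alpha : Zplus n -> A -> A).
Hypothesis halpha : unital_dynamical_system alpha.
Variables (N : cstarAlgType R[i]) (w : Zplus n -> A -> N).
Hypothesis hN : toeplitz_nica_pimsner alpha w.
Variable gamma : ('I_n -> R[i]) -> N -> N.
Hypothesis hgamma : gauge_action w gamma.
Variable lambda : 'I_n -> R.
Local Notation Zp := (Zplus n).
Local Notation tiota := (tiota w).
Local Notation tV := (tV w).
Local Notation mono := (tnp_monomial w).
Local Notation sg := (gauge_flow gamma lambda).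
Implicit Types (x y : Zp) (a : A) (b v : N) (i : 'I_n) (s t : R).

Lemma flow_torus t : torus (fun k => expi (lambda k * t)).
Proof. by move=> k; exact: norm_expi. Qed.

Lemma flow_hom t : star_hom (sg t).
Proof. by have [H _ _ _] := hgamma; have [] := H _ (flow_torus t). Qed.

Lemma flowD s t v : sg (s + t) v = sg s (sg t v).
Proof.
have [_ _ H _] := hgamma.
have := congr1 (fun f => f v) (H _ _ (flow_torus s) (flow_torus t)).
rewrite /gauge_flow /= => <-; congr (gamma _ v); by apply/funext => k; rewrite mulrDr expiD.
Qed.

Lemma flow_nr t v : nr (sg t v) <= nr v.
Proof.
apply: (tnp_bound hN); first exact: nr_ge0.
move=> H pi V rho _ rr _ u.
exact: (rep_bound (star_rep_comp (flow_hom t) rr)).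
Qed.

Definition flow_weight x y : R := \sum_k lambda k * ((x k)%:R - (y k)%:R).

Lemma flow_mono t x a y :
  sg t (mono x a y) = expi (flow_weight x y * t) *: mono x a y.
Proof.
have [_ _ _ H] := hgamma; rewrite [LHS](H _ _ _ _ (flow_torus t)); congr (_ *: _).
rewrite (eq_bigr (fun k => expi (lambda k * ((x k)%:R - (y k)%:R) * t))) => [|k _].
  by rewrite expi_prod mulr_suml.
by rewrite expi_exprz rmorphB/= !pmulrn mulrAC.
Qed.

Lemma flow_tiota t a : sg t (tiota a) = tiota a.
Proof.
have -> : tiota a = mono 0 a 0.
  by rewrite (monoE hN) (tV0 halpha hN) star1 cmul1l cmul1r.
rewrite flow_mono /flow_weight big1 => [|k _]; last by rewrite subrr mulr0.
by rewrite mul0r expi0 scale1r.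
Qed.

Lemma flow_tV t i : sg t (tV (Zgen i)) = expi (lambda i * t) *: tV (Zgen i).
Proof.
have -> : tV (Zgen i) = mono (Zgen i) cone 0.
  by rewrite (monoE hN) (tV0 halpha hN) (tiota1 halpha hN) star1 !cmul1r.
rewrite flow_mono /flow_weight (bigD1 i)//= big1 => [|k ki]; last first.
  by rewrite !ffunE (negbTE ki) subrr mulr0.
by rewrite !ffunE eqxx subr0 mulr1 addr0.
Qed.

Variable beta : R.
Hypothesis hbeta : forall k : 'I_n, 0 < lambda k * beta.

Definition gibbs i : R := expR (- (lambda i * beta)).

Lemma gibbs01 i : 0 < gibbs i < 1.
Proof. by rewrite expR_gt0 -expR0 ltr_expR oppr_lt0 hbeta. Qed.

Lemma qx_gibbs x : qx gibbs x = expR (- (flow_weight x 0 * beta)).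
Proof.
rewrite /flow_weight mulr_suml -sumrN expR_sum; apply: eq_bigr => i _.
by rewrite -expRM_natr ffunE subr0 mulNr mulrAC.
Qed.

Lemma gibbs_weight x y :
  expR (- (flow_weight x y * beta)) * qx gibbs y = qx gibbs x.
Proof.
rewrite !qx_gibbs -expRD; congr expR; rewrite -opprD -mulrDl; congr (- (_ * _)).
rewrite -big_split/=; apply: eq_bigr => i _.
by rewrite -mulrDr !ffunE !subr0 subrK.
Qed.

Lemma KMS_kms_class psi : KMS_state sg beta psi -> kms_class w gibbs psi.
Proof.
move=> kpsi; have [spsi _] := kpsi.
have cpsi := state_clin spsi; have ppsi := state_positive spsi.
have lin t k u v : sg t (k *: u + v) = k *: sg t u + sg t v.
  exact: (star_hom_lin (flow_hom t)).
have eig := KMS_eigenvector lin flow_nr flowD kpsi.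
have kV i b : psi (tV (Zgen i) ** b) = (gibbs i)%:C * psi (b ** tV (Zgen i)).
  by apply: eig => t; exact: flow_tV.
split=> //.
- by exists 1 => // v; rewrite mul1r; exact: state_bound.
- exact: positive_kc_S.
move=> a b; rewrite (eig 0) ?mul0r ?oppr0 ?expR0 ?mul1r// => t.
by rewrite mul0r expi0 scale1r flow_tiota.
Qed.

Section ClassToKMS.
Variables (psi : N -> R[i]) (kpsi : kms_class w gibbs psi).

Lemma class_tV x b : psi (tV x ** b) = (qx gibbs x)%:C * psi (b ** tV x).
Proof.
elim/Zplus_ind: x b => [|x i IH] b.
  by rewrite (tV0 halpha hN) cmul1l cmul1r qx0 mul1r.
rewrite (tVD halpha hN) -cmulA IH -cmulA (kc_V kpsi) qxD qx_gen rmorphM mulrA.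
by rewrite -cmulA.
Qed.

Lemma class_starV y b :
  psi (b ** star (tV y)) = (qx gibbs y)%:C * psi (star (tV y) ** b).
Proof.
elim/Zplus_ind: y b => [|y i IH] b.
  by rewrite (tV0 halpha hN) star1 cmul1l cmul1r qx0 mul1r.
rewrite addrC (tVD halpha hN) starM cmulA (kc_S kpsi) cmulA IH qxD qx_gen rmorphM mulrA.
by rewrite -cmulA.
Qed.

(** Both sides are brought to one value by cycling: V_x on the left side, the adjoint of V_y on the
    right side, and finally [a]. The factors agree by [gibbs_weight]. *)
Lemma class_mono x a y b : psi (mono x a y ** b) =
  (expR (- (flow_weight x y * beta)))%:C * psi (b ** mono x a y).
Proof.
rewrite (monoE hN) -!cmulA class_tV !cmulA class_starV mulrA -rmorphM.
by rewrite gibbs_weight -!cmulA (kc_A kpsi) !cmulA.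
Qed.

(** Finite sums of eigenvectors have an explicit entire extension. Existence suffices, because
    [extension_unique] carries the identity over to every other extension. *)
Lemma mspan_extension v : mspan w v -> exists f, analytic_extension sg v f /\
  forall b, psi (v ** b) = psi (b ** f (0 +i* beta)).
Proof.
have cpsi := kc_lin kpsi.
elim=> [|x a y u _ [f [[ef fs] fK]]].
  exists (fun=> 0); split; first split=> [z|t].
  - by apply/vdiffP; exact: vdiff_cst.
  - by rewrite (star_hom0 (flow_hom t)).
  by move=> b; rewrite cmul0l cmul0r.
exists (fun z => cexpi (flow_weight x y) z *: mono x a y + f z); split; first split.
- move=> z; apply/vdiffP; apply: vdiff_add; last exact: entire_vdiff.
  by apply: vdiff_scale; exact: cexpi_cdiff.
- by move=> t; rewrite fs cexpi_real -flow_mono (star_homD (flow_hom t)).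
move=> b; rewrite cmulDl cmulDr !(clinD cpsi) fK class_mono cexpi_imag.
by rewrite cmulZr (clinZ cpsi).
Qed.

Lemma kms_class_KMS : state psi -> KMS_state sg beta psi.
Proof.
move=> spsi; split=> //; exists (mspan w); split.
- split; first exact: (mspan_star_subalgebra halpha hN).
  by apply/dense_nr => v e; exact: (mspan_dense halpha hN).
- have [_ _ mZ _ _] := mspan_star_subalgebra halpha hN.
  move=> t; apply: mspan_lin => [u v||x a y].
  + exact: (star_homD (flow_hom t)).
  + exact: (star_hom0 (flow_hom t)).
  + by rewrite flow_mono; apply: mZ; exact: mspan_mono.
- by move=> a /mspan_extension[f [ff _]]; exists f.
move=> a b f /mspan_extension[g [gg gK]] _ ff.
by rewrite gK; exact: (extension_unique spsi gg ff).
Qed.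

End ClassToKMS.

End GaugeFlow.

(** * The correspondence and the topologies of pointwise convergence *)

Lemma ptws_near (K : numClosedFieldType) (U : topologicalType) (f : {ptws U -> K})
  (a : U) (e : K) : 0 < e -> nbhs f [set g : {ptws U -> K} | `|f a - g a| < e].
Proof.
move=> e0; have [H _] := @pointwise_cvgP U K (nbhs f) f _.
have B : nbhs (f a) [set z : K | `|f a - z| < e].
  by apply/(@nbhs_normP K K); exists e.
exact: (H (fun _ => id) a _ B).
Qed.

Lemma ptws_cvg (K : numClosedFieldType) (U : topologicalType)
    (F : set_system {ptws U -> K}) (f : {ptws U -> K}) : Filter F ->
  (forall a (e : K), 0 < e -> F [set g : {ptws U -> K} | `|f a - g a| < e]) -> F --> f.
Proof.
move=> FF H; have [_] := @pointwise_cvgP U K F f FF; apply=> a.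
move=> B /(@nbhs_normP K K)[e e0 eB].
have H' := filterS (fun g (h : `|f a - g a| < e) => eB (g a) h) (H a e e0).
exact: H'.
Qed.

Section Correspondence.
Variable R : realType.
Local Open Scope complex_scope.
Variables (n : nat) (A : cstarAlgType R[i]) (alpha : Zplus n -> A -> A).
Hypothesis halpha : unital_dynamical_system alpha.
Variables (N : cstarAlgType R[i]) (w : Zplus n -> A -> N).
Hypothesis hN : toeplitz_nica_pimsner alpha w.
Variable q : 'I_n -> R.
Hypothesis q01 : forall i, 0 < q i < 1.
Local Notation tiota := (tiota w).
Local Notation tV := (tV w).
Local Notation mono := (tnp_monomial w).
Implicit Types (x y : Zplus n) (a : A) (b v : N) (i : 'I_n) (e : R).
Implicit Types (psi : N -> R[i]) (tau : A -> R[i]).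

Let P : N := tprojs w (enum 'I_n).
Let c : R := \prod_(i <- enum 'I_n) (1 - q i).
Let W : R := wmass q.

Let P_tiota a : P ** tiota a = tiota a ** P.
Proof. exact: (tprojs_tiota halpha hN). Qed.

Let P_star : star P = P. Proof. exact: (tprojs_star halpha hN). Qed.

Let P_idem : P ** P = P. Proof. exact: (tprojs_idem halpha hN). Qed.

Let P_one psi : state psi -> kms_class w q psi -> psi P = c%:C.
Proof.
by move=> sp kp; rewrite (peel_one halpha hN kp) ?enum_uniq// (state_one sp) mulr1.
Qed.

Let c0 : c%:C != 0.
Proof.
rewrite eq_complex/= eqxx andbT /c prodf_seq_neq0; apply/allP => i _ /=.
by rewrite gt_eqF// subr_gt0; have /andP[] := q01 i.
Qed.

Let W0 : 0 < W.
Proof. by rewrite (lt_le_trans ltr01)// wmass_ge1. Qed.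

(** Complex coefficients cover both the differences needed for uniqueness and the convex
    combinations needed for affineness. *)
Lemma kms_class_comb k l psi1 psi2 : kms_class w q psi1 -> kms_class w q psi2 ->
  kms_class w q (fun b => k * psi1 b + l * psi2 b).
Proof.
move=> [l1 [M1 M10 b1] V1 S1 A1] [l2 [M2 M20 b2] V2 S2 A2]; split.
- by move=> k' u v; rewrite l1 l2; ring.
- exists (normc k * M1 + normc l * M2).
    by rewrite addr_ge0// mulr_ge0// normc_ge0.
  move=> v; rewrite (le_trans (le_normcD _ _))// mulrDl !normcM -!mulrA.
  by rewrite lerD// ler_wpM2l ?normc_ge0.
- by move=> i b; rewrite V1 V2; ring.
- by move=> i b; rewrite S1 S2; ring.
- by move=> a b; rewrite A1 A2.
Qed.

Lemma kms_class_eq psi1 psi2 : kms_class w q psi1 -> kms_class w q psi2 ->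
  (forall a, psi1 (tiota a ** P) = psi2 (tiota a ** P)) -> psi1 = psi2.
Proof.
move=> k1 k2 E; apply/funext => v; apply/eqP; rewrite -subr_eq0; apply/eqP.
have k12 := kms_class_comb 1 (-1) k1 k2.
have := class_zero halpha hN k12 q01 (enum_uniq 'I_n) _ v.
by rewrite mul1r mulN1r; apply => a; rewrite mul1r mulN1r E subrr.
Qed.

Definition kms_trace psi a : R[i] := (c%:C)^-1 * psi (tiota a ** P).

Lemma kms_trace_tracial psi : state psi -> kms_class w q psi ->
  tracial_state (kms_trace psi).
Proof.
move=> spsi kpsi; have cpsi := state_clin spsi; split; last first.
  move=> a b; rewrite /kms_trace !(tiotaM hN); congr (_ * _).
  by rewrite -[in LHS]cmulA (kc_A kpsi a) -[in LHS]cmulA P_tiota cmulA.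
have cc : 0 <= (c%:C)^-1 :> R[i].
  rewrite invr_ge0 ler0c prodr_ge0// => i _.
  by rewrite subr_ge0 ltW//; have /andP[] := q01 i.
apply: positive_state.
- move=> k u v; rewrite /kms_trace (tiota_lin hN) cmulDl cmulZl cpsi; ring.
- move=> a; rewrite /kms_trace mulr_ge0// (tiotaM hN) (tiotaS hN).
  have -> : star (tiota a) ** tiota a ** P = star (tiota a ** P) ** (tiota a ** P).
    rewrite starM P_star -(tiotaS hN) P_tiota -!cmulA; congr (_ ** _).
    by rewrite !cmulA P_tiota -cmulA P_idem.
  exact: (state_positive spsi).
rewrite /kms_trace (tiota1 halpha hN) cmul1l P_one//.
by rewrite mulVf.
Qed.

(** The functional is picked by choice, with the default 0 off the tracial states. By [kms_traceK]
    the choice is forced. *)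
Definition trace_kms tau : N -> R[i] :=
  match pselect (tracial_state tau) with
  | left h => sval (cid (fock_functional halpha hN q01 h))
  | right _ => fun=> 0
  end.

Lemma trace_kmsP tau : tracial_state tau -> [/\ state (trace_kms tau),
  kms_class w q (trace_kms tau),
  forall x a y, trace_kms tau (mono x a y) =
    if x == y then (qx q x)%:C * trace_kms tau (tiota a) else 0,
  forall a, is_wsum q (fun z => tau (alpha z a)) (W%:C * trace_kms tau (tiota a)) &
  forall a, W%:C * trace_kms tau (tiota a ** P) = tau a].
Proof.
rewrite /trace_kms; case: pselect => // h _.
exact: (svalP (cid (fock_functional halpha hN q01 h))).
Qed.

Lemma trace_kmsK tau : tracial_state tau -> kms_trace (trace_kms tau) = tau.
Proof.
move=> htau; have [spsi kpsi _ _ H] := trace_kmsP htau.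
apply/funext => a; rewrite /kms_trace -(H a); congr (_ * _).
apply: (mulfI c0); rewrite mulfV//.
(* Evaluation at [cone] gives [c * W = 1], because psi(P) is [c] by peeling. *)
have := H cone; rewrite (tiota1 halpha hN) cmul1l (state_one htau.1).
by rewrite P_one// mulrC => ->.
Qed.

Lemma kms_traceK psi : state psi -> kms_class w q psi -> trace_kms (kms_trace psi) = psi.
Proof.
move=> spsi kpsi; have ht := kms_trace_tracial spsi kpsi.
have [_ k' _ _ _] := trace_kmsP ht.
apply: kms_class_eq => // a; have := congr1 (fun f => f a) (trace_kmsK ht).
by rewrite /kms_trace => /(mulfI (invr_neq0 c0)).
Qed.

(** The inverse map [kms_trace] is affine by its formula; as the right-hand side is again a state of
    the class, [kms_traceK] carries affineness over. *)
Lemma trace_kms_affine (s : R[i]) tau1 tau2 : 0 <= s <= 1 ->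
  tracial_state tau1 -> tracial_state tau2 ->
  trace_kms (fun a => s * tau1 a + (1 - s) * tau2 a) =
  (fun b => s * trace_kms tau1 b + (1 - s) * trace_kms tau2 b).
Proof.
move=> s01 h1 h2.
have [s1 k1 _ _ _] := trace_kmsP h1; have [s2 k2 _ _ _] := trace_kmsP h2.
rewrite -[RHS]kms_traceK; last 2 first.
- exact: state_convex.
- exact: kms_class_comb.
congr trace_kms; apply/funext => a.
rewrite -[in LHS](trace_kmsK h1) -[in LHS](trace_kmsK h2) /kms_trace; ring.
Qed.

Local Notation C := (R[i] : numClosedFieldType).

Section Continuity.
Local Notation T := [set tau : A -> C | tracial_state tau].
Variable tau0 : {ptws A -> C}.
Hypothesis htau0 : tracial_state tau0.
Let near_tau0 : set_system {ptws A -> C} :=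
  within (T : set {ptws A -> C}) (nbhs tau0).

Let near_tau0W Q : nbhs tau0 Q -> near_tau0 Q.
Proof. by move=> H; apply: filterS H => tau Qtau _. Qed.

Let near_tau0F : Filter near_tau0 := within_filter _ _.

Let cvgT (F : (A -> R[i]) -> R[i]) := forall e, 0 < e ->
  near_tau0 [set tau | normc (F tau - F tau0) < e].

Lemma eval_cvg a : cvgT (fun tau => tau a).
Proof.
move=> e e0; apply: near_tau0W.
have /(ptws_near tau0 a) : 0 < e%:C :> C by rewrite ltcR.
by apply: filterS => tau; rewrite /= normc_norm ltcR normcC.
Qed.

(** A uniform limit on the tracial states of functions continuous at [tau0]; the estimate is used at
    [tau0] as well, since it is tracial. *)
Lemma approx_cvg F :
  (forall e, 0 < e -> exists2 G, cvgT G &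
    forall tau, tracial_state tau -> normc (F tau - G tau) <= e) ->
  cvgT F.
Proof.
move=> H e e0; have e30 : 0 < e / 3 by rewrite divr_gt0.
have [G cG FG] := H _ e30.
have /(filterI (withinT _ _)) := cG _ e30; apply: filterS => tau [/FG h1 /= h2].
have := normc_dist (G tau) (F tau) (F tau0).
have := normc_dist (G tau0) (G tau) (F tau0).
by have := FG _ htau0; rewrite (normcC (F tau0)); lra.
Qed.

Lemma lincomb_cvg k F G : cvgT F -> cvgT G -> cvgT (fun tau => k * F tau + G tau).
Proof.
move=> cF cG e e0; have k0 : 0 < normc k + 1 by rewrite ltr_wpDl ?normc_ge0.
have e20 : 0 < e / 2 by rewrite divr_gt0.
apply: (filterS _ (filterI (cF _ (divr_gt0 e20 k0)) (cG _ e20))) => tau [/= h1 h2].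
have -> : k * F tau + G tau - (k * F tau0 + G tau0) =
  k * (F tau - F tau0) + (G tau - G tau0) by ring.
rewrite (le_lt_trans (le_normcD _ _))// (splitr e) ler_ltD// normcM.
rewrite (@le_trans _ _ ((normc k + 1) * normc (F tau - F tau0)))//.
  by rewrite ler_wpM2r ?normc_ge0// lerDl.
by rewrite mulrC -ler_pdivlMr// ltW.
Qed.

Lemma cst_cvg k : cvgT (fun=> k).
Proof. by move=> e e0; apply: (filterS _ (@filterT _ near_tau0 _)) => tau _ /=; rewrite subrr normc0. Qed.

Lemma psum_cvg s a : cvgT (fun tau => psum q s (fun z => tau (alpha z a))).
Proof.
elim: s => [|x s IH].
  have -> : (fun tau : A -> R[i] => psum q [::] (fun z => tau (alpha z a))) = fun=> 0.
    by apply/funext => tau; rewrite /psum big_nil.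
  exact: cst_cvg.
have -> : (fun tau : A -> R[i] => psum q (x :: s) (fun z => tau (alpha z a))) =
    fun tau => (qx q x)%:C * tau (alpha x a) + psum q s (fun z => tau (alpha z a)).
  by apply/funext => tau; rewrite /psum big_cons.
exact: (lincomb_cvg _ (@eval_cvg _) IH).
Qed.

(** Three stages, each uniform over tracial states: box sums of the values tau(alpha_z(a)) for
    [tiota a], the monomial formula for [mspan], and density with contractivity of states for
    arbitrary [b]. *)
Lemma trace_kms_cvg b : cvgT (fun tau => trace_kms tau b).
Proof.
have cvg_tiota a : cvgT (fun tau => trace_kms tau (tiota a)).
  apply: approx_cvg => e e0.
  have a1 : 0 < nr a + 1 by rewrite ltr_wpDl ?nr_ge0.
  (* The tail outside the box is at most [nr a * (W - mass q (box n m))] for every tracial state, so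
     [m] depends on [a] and [e] only. *)
  have [m mP] := mass_cvg q01 (divr_gt0 (mulr_gt0 W0 e0) a1).
  have /andP[m0 m1] := mP m (leqnn _).
  exists (fun tau =>
      (W%:C)^-1 * psum q (box n m) (fun z => tau (alpha z a))).
    have := lincomb_cvg (W%:C)^-1 (@psum_cvg (box n m) a) (@cst_cvg 0).
    by congr cvgT; apply/funext => tau; rewrite addr0.
  move=> tau htau; have [_ _ _ H _] := trace_kmsP htau.
  have bd z : normc (tau (alpha z a)) <= nr a.
    exact: (state_alpha_bound halpha htau.1).
  have K := is_wsum_tail q01 m bd (H a); rewrite normcC in K.
  have -> : trace_kms tau (tiota a) -
      (W%:C)^-1 * psum q (box n m) (fun z => tau (alpha z a)) =
      (W%:C)^-1 * (W%:C * trace_kms tau (tiota a) -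
         psum q (box n m) (fun z => tau (alpha z a))).
    by rewrite mulrBr mulrA mulVf ?mul1r// eq_complex/= gt_eqF.
  rewrite normcM normcV normc_real (ger0_norm (ltW W0)) mulrC ler_pdivrMr// [leRHS]mulrC.
  rewrite (le_trans K)// (@le_trans _ _ ((nr a + 1) * (W - mass q (box n m))))//.
    by rewrite ler_wpM2r// lerDl.
  by rewrite [leLHS]mulrC -(ler_pdivlMr _ _ a1); exact: (ltW m1).
have cvg_span v : mspan w v -> cvgT (fun tau => trace_kms tau v).
  elim=> [|x a y u _ IH]; apply: approx_cvg => e e0.
    exists (fun=> 0); first exact: cst_cvg.
    move=> tau /trace_kmsP[/state_clin cpsi _ _ _ _].
    by rewrite (clin0 cpsi) subrr normc0 ltW.
  exists (fun tau =>
     (if x == y then (qx q x)%:C else 0) * trace_kms tau (tiota a) + trace_kms tau u).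
    exact: (lincomb_cvg _ (@cvg_tiota a) IH).
  move=> tau /trace_kmsP[/state_clin cpsi _ H _ _].
  rewrite (clinD cpsi) H; case: eqP => _; rewrite ?mul0r subrr normc0 ltW//.
apply: approx_cvg => e e0; have [v vs bv] := mspan_dense halpha hN b e0.
exists (fun tau => trace_kms tau v); first exact: cvg_span.
move=> tau /trace_kmsP[spsi _ _ _ _].
by rewrite -(clinB (state_clin spsi)) (le_trans (state_bound spsi _))// ltW.
Qed.

End Continuity.

Lemma trace_kms_continuous :
  {within [set tau : {ptws A -> C} | tracial_state tau],
    continuous (trace_kms : {ptws A -> C} -> {ptws N -> C})}.
Proof.
apply/subspace_continuousP => tau0 htau0.
apply: ptws_cvg => b _ /complex_gt0[e e0 ->].
apply: (filterS _ (trace_kms_cvg htau0 b e0)) => tau /=.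
by rewrite normc_norm ltcR normcC.
Qed.

(** Each value of [kms_trace psi] is a multiple of the value of [psi] at one element, so continuity
    holds on every set [S]. *)
Lemma kms_trace_continuous (S : set {ptws N -> C}) :
  {within S, continuous (kms_trace : {ptws N -> C} -> {ptws A -> C})}.
Proof.
apply/subspace_continuousP => psi0 _.
apply: ptws_cvg => a _ /complex_gt0[e e0 ->].
have k0 : 0 < normc (c%:C)^-1 + 1 by rewrite ltr_wpDl ?normc_ge0.
have e0' : 0 < (e / (normc (c%:C)^-1 + 1))%:C :> C by rewrite ltcR divr_gt0.
have := ptws_near psi0 (tiota a ** P) e0'.
move=> H; apply: (filterS _ H) => psi /= + _.
rewrite !normc_norm !ltcR ltr_pdivlMr// => h.
rewrite /kms_trace -mulrBr normcM mulrC (le_lt_trans _ h)//.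
by rewrite ler_wpM2l ?normc_ge0// lerDl.
Qed.

End Correspondence.

Theorem theorem3p4 (R : realType) (n : nat)
    (A : cstarAlgType R[i]) (alpha : Zplus n -> A -> A)
    (halpha : unital_dynamical_system alpha)
    (NT : cstarAlgType R[i]) (w : Zplus n -> A -> NT)
    (hNT : toeplitz_nica_pimsner alpha w)
    (gamma : ('I_n -> R[i]) -> NT -> NT) (hgamma : gauge_action w gamma)
    (lambda : 'I_n -> R) (beta : R)
    (hbeta : forall k : 'I_n, 0 < lambda k * beta) :
  affine_homeomorphic
    [set tau : A -> R[i] | tracial_state tau]%classic
    [set psi : NT -> R[i] | KMS_state (gauge_flow gamma lambda) beta psi]%classic.
Proof.
have q01 := gibbs01 hbeta.
have KP psi : KMS_state (gauge_flow gamma lambda) beta psi ->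
    state psi /\ kms_class w (gibbs lambda beta) psi.
  move=> h; split; first by case: h.
  exact: (KMS_kms_class halpha hNT hgamma).
exists (trace_kms halpha hNT q01), (kms_trace w (gibbs lambda beta)); split.
- move=> tau htau; split; last exact: trace_kmsK.
  have [spsi kpsi _ _ _] := trace_kmsP halpha hNT q01 htau.
  exact: (kms_class_KMS halpha hNT hgamma).
- move=> psi /KP[spsi kpsi]; split; last exact: kms_traceK.
  exact: (kms_trace_tracial halpha hNT).
- by move=> s tau1 tau2; exact: trace_kms_affine.
- exact: trace_kms_continuous.
- exact: kms_trace_continuous.
Qed.
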